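(* Let $\Omega\subset\mathbb{R}^N$ be a bounded open Lipschitz set. Then $\lambda^\Omega_{1,s}\to\lambda^\Omega_{1,0}$ as $s\to0^+$. Moreover, if $s_k\to0^+$ and $(\xi_{1,s_k})_k$ is a sequence of $L^2(\Omega)$-normalized eigenfunctions of $\mathcal{D}^{s_k}_\Omega$ corresponding to $\lambda^\Omega_{1,s_k}$, then, after passing to a subsequence, $\xi_{1,s_k}\to\xi_1$ in $L^2(\Omega)$ as $k\to\infty$, where $\xi_1$ is an eigenfunction of $\mathcal{D}^0_\Omega$ corresponding to $\lambda^\Omega_{1,0}$.
   Context: A bounded open set $\Omega\subset\mathbb{R}^N$ is a Lipschitz set if each boundary point has a neighborhood in which $\partial\Omega$ is, after rotation, the graph of a Lipschitz function. For $s\in[0,1)$, $\mathbb{H}^s(\Omega)=\{u\in L^2(\Omega):\int_\Omega\int_\Omega\frac{(u(x)-u(y))^2}{|x-y|^{N+2s}}dxdy<\infty\}$, $\mathcal{E}_s(u,v)=\frac12\int_\Omega\int_\Omega\frac{(u(x)-u(y))(v(x)-v(y))}{|x-y|^{N+2s}}dxdy$. An eigenfunction of $\mathcal{D}^s_\Omega$ (where $\mathcal{D}^s_\Omega u(x)=\lim_{\varepsilon\to0^+}\int_{\Omega\setminus B_\varepsilon(x)}\frac{u(x)-u(y)}{|x-y|^{N+2s}}dy$) with eigenvalue $\lambda$ is $u\in\mathbb{H}^s(\Omega)\setminus\{0\}$ with $\mathcal{E}_s(u,v)=\lambda\int_\Omega uv\,dx$ for all $v\in\mathbb{H}^s(\Omega)$.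 The eigenvalues, counted with multiplicity, are $0=\lambda^\Omega_{0,s}<\lambda^\Omega_{1,s}\le\lambda^\Omega_{2,s}\le\cdots\to\infty$, the eigenvalue $0$ having the constants as eigenspace; so $\lambda^\Omega_{1,s}$ is the smallest positive eigenvalue. *)

(* Defs.v *)
From HB Require Import structures.
From mathcomp Require Import all_boot all_order all_algebra.
From mathcomp Require Import all_classical all_reals all_analysis.
Set Implicit Arguments. Unset Strict Implicit. Unset Printing Implicit Defensive.
Import Order.TTheory GRing.Theory Num.Theory.
Import numFieldNormedType.Exports.
Local Open Scope classical_set_scope.
Local Open Scope ring_scope.

(** Product of two sigma-finite measures, packaged as a sigma-finite measure
    (the library's generic instance is shadowed by a subprobability one). *)
Section pmeasure.
Local Open Scope ereal_scope.
Context d1 d2 (T1 : measurableType d1) (T2 : measurableType d2) (R : realType).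
Variable m1 : {sigma_finite_measure set T1 -> \bar R}.
Variable m2 : {sigma_finite_measure set T2 -> \bar R}.

Definition pmeasure := (m1 \x m2)%E.
HB.instance Definition _ := Measure.on pmeasure.

Lemma pmeasure_sigma_finite : sigma_finite setT pmeasure.
Proof.
have /sigma_finiteP[F [TF ndF Foo]] := sigma_finiteT m1.
have /sigma_finiteP[G [TG ndG Goo]] := sigma_finiteT m2.
exists (fun n => F n `*` G n).
 rewrite -setXTT TF TG predeqE => -[x y]; split.
    move=> [/= [n _ Fnx] [k _ Gky]]; exists (maxn n k) => //; split.
    - by move: x Fnx; exact/subsetPset/ndF/leq_maxl.
    - by move: y Gky; exact/subsetPset/ndG/leq_maxr.
  by move=> [n _ []/= ? ?]; split; exists n.
move=> k; have [? ?] := Foo k; have [? ?] := Goo k.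
split; first exact: measurableX.
by rewrite /pmeasure product_measure1E// lte_mul_pinfty// ge0_fin_numE.
Qed.

HB.instance Definition _ := Measure_isSigmaFinite.Build _ _ _ pmeasure
  pmeasure_sigma_finite.
End pmeasure.

Section RegionalFractional.
Variable R : realType.

(** * The measure space R^(n+1) with Lebesgue (Borel) product measure.
    [RN n] is the iterated product ((R * R) * ...) * R with n+1 factors;
    [lebN n] is the iterated product of the Lebesgue measure on R. *)
Fixpoint RN (n : nat) : {d : measure_display & measurableType d} :=
  match n with
  | 0 => existT (fun d => measurableType d) _ (measurableTypeR R : measurableType _)
  | n'.+1 => existT (fun d => measurableType d) _
      ((projT2 (RN n') * measurableTypeR R)%type : measurableType _)
  end.

Fixpoint lebN (n : nat) : {sigma_finite_measure set (projT2 (RN n)) -> \bar R} :=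
  match n return {sigma_finite_measure set (projT2 (RN n)) -> \bar R} with
  | 0 => [the {sigma_finite_measure set _ -> \bar R} of @lebesgue_measure R]
  | n'.+1 => [the {sigma_finite_measure set _ -> \bar R} of
               pmeasure (lebN n') (@lebesgue_measure R)]
  end.

Fixpoint coord (n : nat) : projT2 (RN n) -> nat -> R :=
  match n return projT2 (RN n) -> nat -> R with
  | 0 => fun x _ => x
  | n'.+1 => fun x i => if i == n'.+1 then x.2 else @coord n' x.1 i
  end.

Definition to_vec (n : nat) (x : projT2 (RN n)) : 'rV[R]_(n.+1) :=
  \row_(i < n.+1) @coord n x i.

Definition eucl (m : nat) (x : 'rV[R]_m) : R :=
  Num.sqrt (\sum_(i < m) (x ord0 i) ^+ 2).

Definition intN (n : nat) (A : set 'rV[R]_(n.+1)) (f : 'rV[R]_(n.+1) -> \bar R) :=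
  (\int[lebN n]_(x in @to_vec n @^-1` A) f (@to_vec n x))%E.

Definition int2N (n : nat) (A : set 'rV[R]_(n.+1))
    (F : 'rV[R]_(n.+1) -> 'rV[R]_(n.+1) -> \bar R) :=
  (\int[pmeasure (lebN n) (lebN n)]_(z in (@to_vec n @^-1` A) `*` (@to_vec n @^-1` A))
      F (@to_vec n z.1) (@to_vec n z.2))%E.

Definition measN (n : nat) (A : set 'rV[R]_(n.+1)) (u : 'rV[R]_(n.+1) -> R) :=
  measurable_fun (@to_vec n @^-1` A) (u \o @to_vec n).

Definition L2 (n : nat) (O : set 'rV[R]_(n.+1)) (u : 'rV[R]_(n.+1) -> R) :=
  measN O u /\ (intN O (fun x => ((u x) ^+ 2)%:E) < +oo)%E.

Definition kern (n : nat) (s : R) (x y : 'rV[R]_(n.+1)) : R :=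
  (eucl (x - y) `^ ((n.+1)%:R + 2 * s))^-1.

Definition Hs (n : nat) (s : R) (O : set 'rV[R]_(n.+1)) (u : 'rV[R]_(n.+1) -> R) :=
  L2 O u /\
  (int2N O (fun x y => ((u x - u y) ^+ 2 * kern s x y)%:E) < +oo)%E.

Definition Es (n : nat) (s : R) (O : set 'rV[R]_(n.+1)) (u v : 'rV[R]_(n.+1) -> R) : R :=
  2^-1 * fine (int2N O (fun x y => ((u x - u y) * (v x - v y) * kern s x y)%:E)).

Definition L2dot (n : nat) (O : set 'rV[R]_(n.+1)) (u v : 'rV[R]_(n.+1) -> R) : R :=
  fine (intN O (fun x => (u x * v x)%:E)).

Definition eigenfunction (n : nat) (s : R) (O : set 'rV[R]_(n.+1)) (lam : R)
    (u : 'rV[R]_(n.+1) -> R) :=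
  [/\ Hs s O u,
      ~ (lebN n).-negligible (@to_vec n @^-1` (O `&` [set x | u x != 0]))
    & forall v, Hs s O v -> Es s O u v = lam * L2dot O u v].

Definition eigenvalue (n : nat) (s : R) (O : set 'rV[R]_(n.+1)) (lam : R) :=
  exists u, eigenfunction s O lam u.

Definition lambda1 (n : nat) (O : set 'rV[R]_(n.+1)) (s : R) : R :=
  inf [set lam | 0 < lam /\ eigenvalue s O lam].

Definition boundedN (m : nat) (O : set 'rV[R]_m) :=
  exists M : R, forall x, O x -> eucl x <= M.

Definition bdry (m : nat) (O : set 'rV[R]_m) := closure O `\` interior O.

Definition rotation (m : nat) (Q : 'M[R]_m) := Q^T *m Q = 1%:M /\ \det Q = 1.

Definition lipschitzN (m : nat) (g : 'rV[R]_m -> R) :=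
  exists L : R, forall a b, `|g a - g b| <= L * eucl (a - b).

Definition lipschitz_set (n : nat) (O : set 'rV[R]_(n.+1)) :=
  forall p, bdry O p ->
  exists (U : set 'rV[R]_(n.+1)) (Q : 'M[R]_(n.+1)) (g : 'rV[R]_n -> R),
    [/\ nbhs p U, rotation Q, lipschitzN g &
        forall x, U x ->
          (bdry O x <->
           let y := x *m Q in
           y ord0 ord_max = g (\row_(i < n) y ord0 (widen_ord (leqnSn n) i)))].

End RegionalFractional.

(* Main.v *)
(* Let k_s(x,y) = |x-y|^-(N+2s). On a set of diameter at most M >= 1 we have
   k_0 <= M^(2s) k_s, so that lambda_(1,0) <= M^(2s) lambda_(1,s): this is the
   lower semicontinuity. Conversely, let K_d = max(|x-y|,d)^-N and let T_d u be the
   mean of u with weights K_d. Since K_d <= k_0, the Cauchy-Schwarz inequality gives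
   ||u - T_d u||^2 <= [u]_0^2 / A whenever the degree of K_d, the integral of
   K_d(x,y) in y, is at least A for all x. The degree tends to infinity uniformly up
   to the boundary as d -> 0, because by the Lipschitz condition each point x is the
   apex of a cone in Omega, which contains disjoint cubes at all the scales 4^-j and
   each of them contributes a fixed amount. This has two consequences.
   - Bounded subsets of H^0 are precompact in L^2, as T_d maps them to equicontinuous
     families; with the lower semicontinuity of the forms this yields minimizers of
     the Rayleigh quotients, which are the first eigenfunctions.
   - T_d u lies in H^(1/2) and tends to u in H^0. For v in H^(1/2) the energies of
     order s converge to the energy of order 0, so testing lambda_(1,s) with
     v = T_d u for a minimizer u at s = 0 bounds the upper limit of lambda_(1,s).
   Eigenfunctions of order s_k are then bounded in H^0, and an L^2 limit of a
   subsequence is a minimizer at s = 0. *)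
Require Import Defs.
From HB Require Import structures.
From mathcomp Require Import all_boot all_order all_algebra.
From mathcomp Require Import all_classical all_reals all_analysis measurable_realfun.
From mathcomp Require Import ring lra.
Import Order.TTheory GRing.Theory Num.Theory.
Import numFieldNormedType.Exports.
Local Open Scope classical_set_scope.
Local Open Scope ring_scope.
Set Implicit Arguments. Unset Strict Implicit. Unset Printing Implicit Defensive.

(** The kernel [|x-y|^-N] fails to be integrable by a logarithm only, and at order 0 no positive
    smoothness is at hand: the divergence of the degree takes its place as the source of
    compactness. The delicate point is that T_d u tends to u in H^0, not just in L^2. Beyond
    distance d the form of T_d u - u is at most 4 times the integral of deg (T_d u - u)^2, and this
    weight cancels the gain 1/A: Cauchy-Schwarz alone gives 4 [u]_0^2, which is not small. So the
    integral of K_d(x,y) (u(x) - u(y)) is split at a fixed distance eta. Pairs closer than eta carry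
    little energy of u; for the others the kernel is at most eta^-N, and a factor 1/A survives.
    Hence eta is chosen before A, and A before d. Within distance d, T_d u is Lipschitz with a
    constant governed by the energy density of u divided by the degree. All this needs only a
    distance and a finite measure, so it is done on an abstract set [D]; the shape of Omega enters
    through [admissible] alone. Weak equations are never passed to the limit: a limit is recognized
    as a minimizer among functions of mean zero. *)

(** * Elementary inequalities *)

Lemma ge0_discriminant (R : realFieldType) (a b c : R) : 0 <= c ->
  (forall t, 0 <= a - 2 * t * b + t ^+ 2 * c) -> b ^+ 2 <= c * a.
Proof.
move=> c0 H; case: (eqVneq c 0) => [c00|cn0].
  rewrite c00 mul0r; case: (eqVneq b 0) => [->|b0]; first by rewrite expr0n.
  (* For [c = 0] the expression is affine in [t]; this [t] brings it down to -1. *)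
  have := H ((a + 1) / (2 * b)); rewrite c00 mulr0 addr0.
  suff -> : a - 2 * ((a + 1) / (2 * b)) * b = -1 by rewrite oppr_ge0 ler10.
  by field.
have cp : 0 < c by rewrite lt_def cn0.
have := H (b / c).
have -> : a - 2 * (b / c) * b + (b / c) ^+ 2 * c = (c * a - b ^+ 2) / c by field.
by rewrite pmulr_lge0 ?invr_gt0// subr_ge0.
Qed.

(** The first-order condition for a minimum at [t = 0]; it later turns a minimizer of the Rayleigh
    quotient into an eigenfunction. *)
Lemma ge0_quadratic_linear0 (R : realFieldType) (b c : R) :
  (forall t, 0 <= t * b + t ^+ 2 * c) -> b = 0.
Proof.
move=> H; apply/eqP/negPn/negP => b0.
have [c0|c0] := leP c 0.
  have := H (- b); have b2 : 0 < b ^+ 2 by rewrite exprn_even_gt0.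
  have : b ^+ 2 * c <= 0 by rewrite mulr_ge0_le0// ltW.
  rewrite sqrrN mulNr -expr2; lra.
have := H (- b / (2 * c)).
have -> : - b / (2 * c) * b + (- b / (2 * c)) ^+ 2 * c = - (b ^+ 2 / (4 * c)).
  by field; rewrite gt_eqF.
rewrite oppr_ge0 => H1.
have : 0 < b ^+ 2 / (4 * c) by rewrite divr_gt0 ?exprn_even_gt0// mulr_gt0.
lra.
Qed.

(** On nonnegative reals, 0 included, the inverse is the real power of exponent -1, which is
    measurable. *)
Lemma measurable_fun_inv_ge0 d (T : measurableType d) (R : realType) (D : set T)
  (f : T -> R) : (forall x, D x -> 0 <= f x) -> measurable_fun D f ->
  measurable_fun D (fun x => (f x)^-1).
Proof.
move=> f0 mf; apply: (@eq_measurable_fun _ _ _ _ D (fun x => f x `^ (-1))).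
  by move=> x /set_mem Dx; rewrite powR_inv1// f0.
exact: (measurableT_comp (measurable_powR _) mf).
Qed.

(** * Square integrable functions *)

Section square_integrable.
Context d (T : measurableType d) (R : realType).
Variables (mu : {measure set T -> \bar R}) (D : set T).

Definition sqint (f : T -> R) :=
  measurable_fun D f /\ (\int[mu]_(x in D) ((f x) ^+ 2)%:E < +oo)%E.

Hypothesis mD : measurable D.

Lemma sqint_integrable (f : T -> R) : sqint f ->
  mu.-integrable D (EFin \o (fun x => f x ^+ 2)).
Proof.
move=> [mf foo]; apply/integrableP; split.
  by apply/measurable_EFinP; apply: measurable_funX.
by under eq_integral do rewrite /= ger0_norm ?sqr_ge0//.
Qed.

Lemma integrable_sqint (f : T -> R) : measurable_fun D f ->
  mu.-integrable D (EFin \o (fun x => f x ^+ 2)) -> sqint f.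
Proof. by move=> mf intf; split => //; exact: (integrable_lty mD intf). Qed.

Lemma le_integrable_EFin (f g : T -> R) : measurable_fun D f ->
  (forall x, D x -> `|f x| <= g x) ->
  mu.-integrable D (EFin \o g) -> mu.-integrable D (EFin \o f).
Proof.
move=> mf fg; apply: le_integrable => //; first exact/measurable_EFinP.
by move=> x Dx /=; rewrite lee_fin (le_trans (fg x Dx))// ler_norm.
Qed.

Lemma integrableD_EFin (f g : T -> R) : mu.-integrable D (EFin \o f) ->
  mu.-integrable D (EFin \o g) -> mu.-integrable D (EFin \o (fun x => f x + g x)).
Proof. by move=> intf intg; exact: (integrableD mD intf intg). Qed.

Lemma integrableB_EFin (f g : T -> R) : mu.-integrable D (EFin \o f) ->
  mu.-integrable D (EFin \o g) -> mu.-integrable D (EFin \o (fun x => f x - g x)).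
Proof. by move=> intf intg; exact: (integrableB mD intf intg). Qed.

Lemma integrableZ_EFin k (f : T -> R) : mu.-integrable D (EFin \o f) ->
  mu.-integrable D (EFin \o (fun x => k * f x)).
Proof. by move=> intf; exact: (integrableZl mD k intf). Qed.

Lemma sqint_mul (f g : T -> R) : sqint f -> sqint g ->
  mu.-integrable D (EFin \o (fun x => f x * g x)).
Proof.
move=> sf sg; apply: (@le_integrable_EFin _ (fun x => f x ^+ 2 + g x ^+ 2)).
- by apply: measurable_funM; [case: sf|case: sg].
- move=> x _; rewrite normrM -(real_normK (num_real (f x))) -(real_normK (num_real (g x))).
  have := normr_ge0 (f x); have := normr_ge0 (g x).
  move: `|f x| `|g x| => a b a0 b0; nra.
- by apply: integrableD_EFin; exact: sqint_integrable.
Qed.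

Lemma sqint_lin t (f g : T -> R) : sqint f -> sqint g -> sqint (fun x => f x + t * g x).
Proof.
move=> sf sg; have mf := sf.1; have mg := sg.1; apply: integrable_sqint.
  by apply: measurable_funD => //; exact: measurable_funM.
have h : mu.-integrable D (EFin \o (fun x => f x ^+ 2 + ((2 * t) * (f x * g x) + t ^+ 2 * g x ^+ 2))).
  apply: integrableD_EFin; first exact: sqint_integrable.
  apply: integrableD_EFin; apply: integrableZ_EFin; last exact: sqint_integrable.
  exact: sqint_mul.
by apply: eq_integrable h => // x _ /=; congr EFin; ring.
Qed.

Lemma sqintB (f g : T -> R) : sqint f -> sqint g -> sqint (fun x => f x - g x).
Proof.
move=> sf sg; have := sqint_lin (-1) sf sg.
by under [fun x => f x + _ * g x]eq_fun do rewrite mulN1r.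
Qed.

Lemma le_sqint (f g : T -> R) : measurable_fun D f ->
  (forall x, D x -> f x ^+ 2 <= g x) -> mu.-integrable D (EFin \o g) -> sqint f.
Proof.
move=> mf fg ig; apply: integrable_sqint => //.
apply: le_integrable_EFin ig; first exact: measurable_funX.
by move=> x Dx; rewrite ger0_norm ?sqr_ge0// fg.
Qed.

Lemma sqint_ext f g : {in D, f =1 g} -> sqint f -> sqint g.
Proof.
move=> fg [mf foo]; split; first exact: eq_measurable_fun mf.
by rewrite (eq_integral (fun x => ((f x) ^+ 2)%:E))// => x xD; rewrite fg.
Qed.

Lemma Rintegral_sqr_lin t (f g : T -> R) : sqint f -> sqint g ->
  \int[mu]_(x in D) ((f x + t * g x) ^+ 2) =
  \int[mu]_(x in D) (f x ^+ 2) + 2 * t * \int[mu]_(x in D) (f x * g x) +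
  t ^+ 2 * \int[mu]_(x in D) (g x ^+ 2).
Proof.
move=> sf sg.
have ff := sqint_integrable sf; have gg := sqint_integrable sg.
have fg := sqint_mul sf sg.
have i1 := integrableZ_EFin (2 * t) fg; have i2 := integrableZ_EFin (t ^+ 2) gg.
rewrite -(RintegralZl _ mD fg) -(RintegralZl _ mD gg).
rewrite -(RintegralD mD ff i1) -(RintegralD mD _ i2); last exact: integrableD_EFin.
by apply: eq_Rintegral => x _; ring.
Qed.

Lemma Rintegral_fineK (f : T -> R) : mu.-integrable D (EFin \o f) ->
  (\int[mu]_(x in D) (f x)%:E)%E = (\int[mu]_(x in D) f x)%:E.
Proof. by move=> intf; rewrite /Rintegral fineK//; exact: integrable_fin_num intf. Qed.

(** The integral of [w (g - t)^2] is a nonnegative quadratic polynomial in [t]. The bounds on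
    weighted means all come from this. *)
Lemma weighted_cauchy_schwarz (w g : T -> R) : (forall x, D x -> 0 <= w x) ->
  mu.-integrable D (EFin \o w) -> mu.-integrable D (EFin \o (fun x => w x * g x)) ->
  mu.-integrable D (EFin \o (fun x => w x * g x ^+ 2)) ->
  (\int[mu]_(x in D) (w x * g x)) ^+ 2 <=
  \int[mu]_(x in D) w x * \int[mu]_(x in D) (w x * g x ^+ 2).
Proof.
move=> w0 iw iwg iwg2; apply: ge0_discriminant; first exact: Rintegral_ge0.
move=> t; have i1 := integrableZ_EFin (2 * t) iwg; have i2 := integrableZ_EFin (t ^+ 2) iw.
rewrite -(RintegralZl _ mD iwg) -(RintegralZl _ mD iw).
rewrite -(RintegralB mD iwg2 i1) -(RintegralD mD _ i2); last exact: integrableB_EFin.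
apply: Rintegral_ge0 => x Dx.
have -> : w x * g x ^+ 2 - 2 * t * (w x * g x) + t ^+ 2 * w x = w x * (g x - t) ^+ 2.
  by ring.
by rewrite mulr_ge0 ?sqr_ge0 ?w0.
Qed.

Lemma Rintegral_eq0_ae (f : T -> R) : mu.-integrable D (EFin \o f) ->
  (forall x, D x -> 0 <= f x) -> \int[mu]_(x in D) f x = 0 ->
  mu.-negligible (D `&` [set x | f x != 0]).
Proof.
move=> intf f0 If; have mf := measurable_int mu intf.
have /(ae_eq_integral_abs mu mD mf) : (\int[mu]_(x in D) `|(EFin \o f) x|)%E = 0%E.
  rewrite (eq_integral (EFin \o f)); first by rewrite Rintegral_fineK// If.
  by move=> x /set_mem Dx /=; rewrite ger0_norm ?f0.
apply: negligibleS => x [Dx /= fx] /(_ Dx) /= [] /eqP.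
by rewrite (negbTE fx).
Qed.

End square_integrable.

(** * Completeness of L^2 *)

Section L2_complete.
Context d (T : measurableType d) (R : realType).
Variables (mu : {measure set T -> \bar R}) (D : set T).
Hypothesis mD : measurable D.

(* On the full-measure set where h = \sum_k 4^k (u_{k+1} - u_k)^2 is finite, the
   increments are O(2^-k), so the sequence converges pointwise. *)
Lemma L2_complete (u : nat -> T -> R) : (forall k, sqint mu D (u k)) ->
  (forall k j, (k <= j)%N ->
     (\int[mu]_(x in D) ((u k x - u j x) ^+ 2)%:E <= ((16^-1) ^+ k)%:E)%E) ->
  exists v, sqint mu D v /\
   forall k, (\int[mu]_(x in D) ((u k x - v x) ^+ 2)%:E <= ((16^-1) ^+ k)%:E)%E.
Proof.
move=> su cu.
pose hk k x : \bar R := (4 ^+ k * (u k x - u k.+1 x) ^+ 2)%:E.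
have hk0 k x : (0 <= hk k x)%E by rewrite lee_fin mulr_ge0 ?sqr_ge0 ?exprn_ge0.
have mhk k : measurable_fun D (hk k).
  apply/measurable_EFinP/measurable_funM => //; apply: measurable_funX.
  by apply: measurable_funB; case: (su k); case: (su k.+1).
pose h x := (\sum_(k <oo) hk k x)%E.
have h0 x : (0 <= h x)%E by apply: nneseries_ge0.
have mdiff2 k j : measurable_fun D (fun x => (u k x - u j x) ^+ 2).
  by apply: measurable_funX; apply: measurable_funB; [case: (su k)|case: (su j)].
have mh : measurable_fun D h by apply: ge0_emeasurable_sum.
have ih : (\int[mu]_(x in D) h x < +oo)%E.
  rewrite integral_nneseries//.
  (* The weight [4^k] against the rate [16^-k] leaves the summable [4^-k]. *)
  apply: (@le_lt_trans _ _ (\sum_(k <oo) ((4^-1) ^+ k)%:E)%E).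
    apply: lee_nneseries => k _; first by move=> _; apply: integral_ge0.
    rewrite /hk.
    under eq_integral do rewrite EFinM.
    rewrite ge0_integralZl_EFin//.
    - apply: (@le_trans _ _ ((4 ^+ k)%:E * ((16^-1) ^+ k)%:E)%E).
        by rewrite lee_wpmul2l ?lee_fin ?exprn_ge0 ?cu.
      rewrite -EFinM lee_fin -exprMn.
      by have -> : 4 * 16^-1 = 4^-1 :> R by field.
    - by move=> x _; rewrite lee_fin sqr_ge0.
    - exact/measurable_EFinP/mdiff2.
  rewrite (_ : (fun n => _) = EFin \o series (fun k => (4^-1 : R) ^+ k)); last first.
    by apply/funext => m /=; rewrite /series/= sumEFin.
  have cv : cvgn (series (fun k => (4^-1 : R) ^+ k)).
    have -> : (fun k => (4^-1 : R) ^+ k) = geometric 1 4^-1 by apply/funext => k /=; rewrite mul1r.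
    apply: is_cvg_geometric_series; rewrite ger0_norm; lra.
  by rewrite EFin_lim// ltry.
pose E := D `&` [set x | h x < +oo]%E.
have mE : measurable E by exact: emeasurable_fun_infty_o.
have ED : E `<=` D by move=> x [].
have muDE : mu (D `\` E) = 0%E.
  have : mu.-integrable D h.
    apply/integrableP; split => //.
    by rewrite (eq_integral h)// => x _; rewrite gee0_abs.
  move=> /(integrable_ae mD)[N [mN N0 sN]].
  apply: (subset_measure0 _ mN _ N0); first exact: measurableD.
  move=> x [Dx nEx]; apply: sN => /= /(_ Dx) hx; apply: nEx; split => //=.
  by rewrite ltey_eq hx.
have cvu x : E x -> cvgn (fun k => u k x).
  move=> [Dx hx].
  have hfin : h x \is a fin_num by rewrite ge0_fin_numE.
  pose c := Num.sqrt (fine (h x)).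
  have bd k : `|u k.+1 x - u k x| <= c * (2^-1) ^+ k.
    have h1 : (hk k x <= h x)%E.
      by rewrite /h (nneseriesD1 (n := k))// leeDl// nneseries_ge0.
    have h2 : (u k.+1 x - u k x) ^+ 2 <= (c * (2^-1) ^+ k) ^+ 2.
      rewrite exprMn sqr_sqrtr ?fine_ge0// -exprM mulnC exprM.
      rewrite -[(u k.+1 x - _) ^+ 2](mulKf (x := 4 ^+ k)) ?expf_neq0 ?pnatr_eq0// -exprVn.
      have -> : (2^-1) ^+ 2 = 4^-1 :> R by field.
      rewrite mulrC ler_wpM2r ?exprn_ge0 ?invr_ge0// -lee_fin fineK//.
      by rewrite -sqrrN opprB.
    rewrite -[leRHS]ger0_norm ?mulr_ge0 ?sqrtr_ge0 ?exprn_ge0//.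
    by rewrite -ler_sqr ?nnegrE// !real_normK ?num_real.
  have -> : (fun k => u k x) = (fun k => u 0%N x + series (telescope (u ^~ x)) k).
    by apply/funext => k; rewrite -(eq_sum_telescope (u ^~ x)).
  apply: is_cvgD; first exact: is_cvg_cst.
  apply: normed_cvg; apply: (@series_le_cvg _ _ (geometric c 2^-1)) => //=.
  - by move=> k; rewrite mulr_ge0 ?sqrtr_ge0 ?exprn_ge0.
  - by apply: is_cvg_geometric_series; rewrite ger0_norm; lra.
pose v x := limn ((fun k => u k x) : R^nat).
(* Setting the limit to 0 off [E] keeps it measurable on all of [D]. *)
pose w := v \_ E.
have mw : measurable_fun D w.
  apply: (@measurable_fun_cvg _ _ _ D (fun k => u k \_ E)).
    move=> k; apply/(measurable_restrict (u k) mE mD).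
    by apply: measurable_funS (su k).1 => //; exact: subIsetr.
  move=> x _; rewrite /w /patch; case: ifPn => [/set_mem Ex|_]; last exact: cvg_cst.
  exact: cvu.
have uw k : (\int[mu]_(x in D) ((u k x - w x) ^+ 2)%:E <= ((16^-1) ^+ k)%:E)%E.
  have muw : measurable_fun D (fun x => (u k x - w x) ^+ 2).
    by apply: measurable_funX; apply: measurable_funB => //; case: (su k).
  have DE : D `\` (D `\` E) = E by rewrite setDD; apply/setIidPr.
  rewrite (@ge0_negligible_integral _ _ _ mu D (D `\` E))//; last 3 first.
  - exact: measurableD.
  - exact/measurable_EFinP.
  - by move=> x _; rewrite lee_fin sqr_ge0.
  rewrite DE.
  (* With [k] fixed, the bound on [u k - u j] passes to the limit in [j] by Fatou's lemma. *)
  have wE x : x \in E -> ((u k x - w x) ^+ 2)%:E =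
      limn_einf (fun j => ((u k x - u j x) ^+ 2)%:E).
    move=> Ex; apply/esym.
    have : (fun j => ((u k x - u j x) ^+ 2)%:E) @ \oo --> ((u k x - w x) ^+ 2)%:E.
      apply: cvg_EFin; first by near=> j.
      have hh : (fun j => u k x - u j x) @ \oo --> u k x - w x.
        apply: cvgB; first exact: cvg_cst.
        by rewrite /w /patch Ex; exact: (cvu x (set_mem Ex)).
      exact: (cvgM hh hh).
    by move=> /cvg_limn_einf_sup[].
  rewrite (eq_integral _ _ wE).
  apply: le_trans; first apply: fatou => //.
  - move=> j; apply/measurable_EFinP; exact: (measurable_funS mD ED (mdiff2 k j)).
  - by move=> j x _; rewrite lee_fin sqr_ge0.
  rewrite limn_einf_lim; apply: lime_le; first exact: is_cvg_einfs.
  near=> j.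
  (* [maxn j k], because the Cauchy bound asks for a second index at least [k]. *)
  apply: (@le_trans _ _ (\int[mu]_(x in E) ((u k x - u (maxn j k) x) ^+ 2)%:E)%E).
    by apply: ereal_inf_lbound; exists (maxn j k) => //=; exact: leq_maxl.
  apply: le_trans (cu k (maxn j k) (leq_maxr _ _)).
  apply: ge0_subset_integral => //.
  - exact/measurable_EFinP.
  - by move=> x _; rewrite lee_fin sqr_ge0.
exists w; split => //.
have : sqint mu D (fun x => u 0%N x - (u 0%N x - w x)).
  apply: sqintB => //; split; last by rewrite (le_lt_trans (uw 0%N))// ltry.
  by apply: measurable_funB => //; case: (su 0%N).
by under [fun x => u 0%N x - _]eq_fun do rewrite subKr.
Unshelve. all: by end_near. Qed.

End L2_complete.

(** Since [h <= delta <= b], the bases satisfy [a <= 2 b]; the second bound then follows by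
    induction on [m] from the product rule for differences. The error is relative to [a ^- m], so
    that integrating it gives back an integral of the kernel itself. *)
Lemma inv_expr_diff (R : realFieldType) (delta a b h : R) m : 0 < delta ->
  delta <= a -> delta <= b -> `|a - b| <= h -> h <= delta ->
  b ^- m <= 2 ^+ m * a ^- m /\
  `|a ^- m - b ^- m| <= m%:R * 2 ^+ m * (h / delta) * a ^- m.
Proof.
move=> d0 da db; rewrite ler_distlC => /andP[abl abu] hd.
have a2b : a <= 2 * b by lra.
have a0 : 0 < a by apply: lt_le_trans da.
have b0 : 0 < b by apply: lt_le_trans db.
have ba : b ^-1 <= 2 * a^-1.
  by rewrite ler_pdivlMr// mulrC ler_pdivrMr.
have h0 : 0 <= h by lra.
have hdd : 0 <= h / delta by rewrite divr_ge0// ltW.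
have bm k : b ^- k <= 2 ^+ k * a ^- k.
  rewrite -!exprVn -exprMn lerXn2r// nnegrE; first by rewrite invr_ge0 ltW.
  by rewrite mulr_ge0// invr_ge0 ltW.
split=> //.
elim: m => [|m IH]; first by rewrite !expr0 subrr normr0 !mul0r.
have am0 : 0 <= a ^- m by rewrite invr_ge0 exprn_ge0// ltW.
have bm0 : 0 <= b ^- m by rewrite invr_ge0 exprn_ge0// ltW.
have -> : a ^- m.+1 - b ^- m.+1 = a^-1 * (a ^- m - b ^- m) + b ^- m * (a^-1 - b^-1).
  by rewrite !exprSr !invfM; ring.
apply: (le_trans (ler_normD _ _)); rewrite !normrM (gtr0_norm (_ : 0 < a^-1)) ?invr_gt0//.
rewrite (ger0_norm bm0).
have ab1 : `|a^-1 - b^-1| <= a^-1 * (h / delta).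
  have -> : a^-1 - b^-1 = a^-1 * ((b - a) / b) by field; rewrite !gt_eqF.
  rewrite normrM (gtr0_norm (_ : 0 < a^-1)) ?invr_gt0// ler_wpM2l ?invr_ge0 ?(ltW a0)//.
  rewrite normrM ler_pM//; first by rewrite ler_norml; apply/andP; split; lra.
  by rewrite gtr0_norm ?invr_gt0// lef_pV2.
have -> : (m.+1)%:R * 2 ^+ m.+1 * (h / delta) * a ^- m.+1 =
   a^-1 * (m%:R * 2 ^+ m * (h / delta) * a ^- m) +
   (2 ^+ m * a ^- m) * (a^-1 * (h / delta)) +
   (m.+1)%:R * 2 ^+ m * (h / delta) * a ^- m.+1.
  by rewrite !exprS invfM -natr1; ring.
apply: (@le_trans _ _ (a^-1 * (m%:R * 2 ^+ m * (h / delta) * a ^- m) +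
   (2 ^+ m * a ^- m) * (a^-1 * (h / delta)))).
  apply: lerD; first by rewrite ler_wpM2l// invr_ge0 ltW.
  by apply: ler_pM => //; rewrite invr_ge0 exprn_ge0 // ltW.
rewrite lerDl mulr_ge0//; last by rewrite invr_ge0 exprn_ge0// ltW.
by rewrite mulr_ge0// mulr_ge0// exprn_ge0.
Qed.

(** * Tonelli's theorem on D x D *)

Section fubini_on.
Local Open Scope ereal_scope.
Context d (T : measurableType d) (R : realType).
Variables (mu : {sigma_finite_measure set T -> \bar R}) (D : set T).
Hypothesis mD : measurable D.

Lemma measurable_fstD (f : T -> R) : measurable_fun D f ->
  measurable_fun (D `*` D) (fun z => f z.1).
Proof.
move=> mf; apply: (measurable_comp mD _ mf) => //.
  by move=> _ [z [Dz _] <-].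
by apply: measurable_funTS; exact: measurable_fst.
Qed.

Lemma measurable_sndD (f : T -> R) : measurable_fun D f ->
  measurable_fun (D `*` D) (fun z => f z.2).
Proof.
move=> mf; apply: (measurable_comp mD _ mf) => //.
  by move=> _ [z [_ Dz] <-].
by apply: measurable_funTS; exact: measurable_snd.
Qed.

Variable F : T * T -> \bar R.
Hypothesis mF : measurable_fun (D `*` D) F.
Hypothesis F0 : forall z, (D `*` D) z -> 0 <= F z.

(** Extension by zero reduces the statements to the whole product space. *)
Let FD := F \_ (D `*` D).

Let mDD : measurable (D `*` D). Proof. exact: measurableX. Qed.

Let mFD : measurable_fun setT FD.
Proof. by apply/(measurable_restrictT F mDD). Qed.

Let FD0 z : 0 <= FD z.
Proof. by rewrite /FD /patch; case: ifPn => // /set_mem /F0. Qed.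

Let FDE x : D x -> \int[mu]_y FD (x, y) = \int[mu]_(y in D) F (x, y).
Proof.
move=> Dx; rewrite [RHS]integral_mkcond; apply: eq_integral => y _.
rewrite /FD /patch /=; congr (if _ then _ else _).
by rewrite in_setX /= (mem_set Dx).
Qed.

Let FDE0 x : ~ D x -> \int[mu]_y FD (x, y) = 0.
Proof.
move=> Dx; apply: integral0_eq => y _.
by rewrite /FD /patch /= in_setX/= memNset.
Qed.

Lemma measurable_fubini_on :
  measurable_fun D (fun x => \int[mu]_(y in D) F (x, y)).
Proof.
apply: (eq_measurable_fun (fun x => \int[mu]_y FD (x, y))).
  by move=> x /set_mem; exact: FDE.
by apply: measurable_funTS; apply: (measurable_fun_fubini_tonelli_F (m2 := mu) FD).
Qed.

Lemma fubini_on1 : \int[pmeasure mu mu]_(z in D `*` D) F z =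
  \int[mu]_(x in D) \int[mu]_(y in D) F (x, y).
Proof.
rewrite integral_mkcond.
have := @fubini_tonelli1 _ _ _ _ _ mu mu FD mFD FD0.
rewrite /pmeasure => ->.
rewrite [RHS]integral_mkcond; apply: eq_integral => x _.
rewrite /fubini_F [RHS]/patch; case: ifPn => [/set_mem/FDE|]//.
by move=> nDx; apply: FDE0 => Dx; move: nDx; rewrite (mem_set Dx).
Qed.

End fubini_on.

Section fubini_swap.
Local Open Scope ereal_scope.
Context d (T : measurableType d) (R : realType).
Variables (mu : {sigma_finite_measure set T -> \bar R}) (D : set T).
Hypothesis mD : measurable D.

Lemma fubini_on2 (F : T * T -> \bar R) : measurable_fun (D `*` D) F ->
  (forall z, (D `*` D) z -> 0 <= F z) ->
  \int[pmeasure mu mu]_(z in D `*` D) F z =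
  \int[mu]_(y in D) \int[mu]_(x in D) F (x, y).
Proof.
move=> mF F0.
have mDD : measurable (D `*` D) by exact: measurableX.
rewrite integral_mkcond; have := @fubini_tonelli2 _ _ _ _ _ mu mu (F \_ (D `*` D)).
rewrite /pmeasure => ->.
- rewrite [RHS]integral_mkcond; apply: eq_integral => y _.
  rewrite /fubini_G [RHS]/patch; case: ifPn => [Dy|nDy].
    rewrite [RHS]integral_mkcond; apply: eq_integral => x _.
    rewrite /patch /=; congr (if _ then _ else _).
    by rewrite in_setX /= Dy andbT.
  apply: integral0_eq => x _.
  by rewrite /patch /= in_setX/= (negbTE nDy) andbF.
- exact/(measurable_restrictT F mDD).
- by move=> z; rewrite /patch; case: ifPn => // /set_mem /F0.
Qed.

End fubini_swap.

(** * The abstract setting: a set of finite measure with a distance *)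

Section truncated_kernel.
Context d (T : measurableType d) (R : realType).
Variable mu : {sigma_finite_measure set T -> \bar R}.

(* The singular kernel rho^-(n+1) of the form at s = 0, cut off at distance delta. *)
Definition tker (n : nat) (rho : T -> T -> R) (delta : R) x y : R :=
  (Num.max (rho x y) delta) ^- n.+1.

(* [tker_unbounded] is the only field that needs a regular boundary; [rho_pow_int]
   says that the measure is (n+1)-dimensional at small scales; [rho_lip] ensures
   that there are nonconstant functions of finite energy. *)
Record admissible (n : nat) (D : set T) (rho : T -> T -> R) (M : R) : Prop := {
  adm_mD : measurable D;
  adm_gt0 : (0 < mu D)%E;
  adm_lty : (mu D < +oo)%E;
  rho_ge0 : forall x y, 0 <= rho x y;
  rhoC : forall x y, rho x y = rho y x;
  rho_tri : forall x y z, rho x z <= rho x y + rho y z;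
  rho_eq0 : forall x y, (rho x y == 0) = (x == y);
  measurable_rho : measurable_fun setT (fun z => rho z.1 z.2);
  adm_M1 : 1 <= M;
  rho_le : forall x y, D x -> D y -> rho x y <= M;
  tker_unbounded : forall A : R, exists2 d0 : R, 0 < d0 &
    forall delta : R, 0 < delta -> delta <= d0 -> forall x, D x ->
    A <= \int[mu]_(y in D) tker n rho delta x y;
  rho_pow_int : exists C : R, forall (t : R) x, 0 < t -> D x ->
    (\int[mu]_(y in D `&` [set y | (rho x y < t)%R]) (rho x y ^- n)%:E <= (C * t)%:E)%E;
  rho_net : forall eta : R, 0 < eta ->
    exists s : seq T, forall x, D x -> exists2 y, y \in s & rho x y < eta;
  rho_lip : exists f : T -> R, [/\ measurable_fun D f,
    (forall x y, D x -> D y -> `|f x - f y| <= rho x y) &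
    forall c, ~ mu.-negligible (D `&` [set x | f x != c])]
}.

End truncated_kernel.

(** * Weighted means *)

Section smoothing.
Context d (T : measurableType d) (R : realType).
Variable mu : {sigma_finite_measure set T -> \bar R}.
Variables (n : nat) (D : set T) (rho : T -> T -> R) (M : R).
Hypothesis adm : admissible mu n D rho M.

Let mD := adm_mD adm.
Let mDD : measurable (D `*` D). Proof. exact: measurableX. Qed.
Local Hint Resolve mD mDD : core.

Lemma integrable_cst k : mu.-integrable D (EFin \o (fun=> k)).
Proof.
apply/integrableP; split; first exact: measurable_cst.
rewrite (eq_integral (cst `|k|%:E))// integral_cst//.
by rewrite lte_mul_pinfty// (adm_lty adm).
Qed.

Lemma sqint_cst k : sqint mu D (fun=> k).
Proof.
apply: le_sqint (integrable_cst (k ^+ 2)) => //.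
Qed.

Lemma sqint_L1 (f : T -> R) : sqint mu D f -> mu.-integrable D (EFin \o f).
Proof.
move=> sf; have := sqint_mul mD sf (sqint_cst 1).
by under [EFin \o _]eq_fun do rewrite /= mulr1.
Qed.

Lemma fine_muD_gt0 : 0 < fine (mu D).
Proof. by rewrite fine_gt0// (adm_gt0 adm) (adm_lty adm). Qed.

Lemma measurable_rho1 x : measurable_fun D (rho x).
Proof.
apply: measurable_funTS.
exact: (measurableT_comp (measurable_rho adm) (pair1_measurable x)).
Qed.

Section fixed_delta.
Variable delta : R.
Hypothesis d0 : 0 < delta.

Local Notation K := (tker n rho delta).

Lemma maxd_gt0 x y : 0 < Num.max (rho x y) delta.
Proof. by rewrite lt_max d0 orbT. Qed.

Lemma tker_gt0 x y : 0 < K x y.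
Proof. by rewrite invr_gt0 exprn_gt0// maxd_gt0. Qed.

Lemma tker_ge0 x y : 0 <= K x y. Proof. exact/ltW/tker_gt0. Qed.

Lemma tker_le x y : K x y <= delta ^- n.+1.
Proof.
rewrite lef_pV2 ?posrE ?exprn_gt0 ?maxd_gt0//.
by rewrite lerXn2r ?nnegrE ?(ltW d0) ?(ltW (maxd_gt0 _ _))// le_max lexx orbT.
Qed.

Lemma tker_ge x y : D x -> D y -> Num.max M delta ^- n.+1 <= K x y.
Proof.
move=> Dx Dy; have hM : 0 < Num.max M delta by rewrite lt_max d0 orbT.
rewrite lef_pV2 ?posrE ?exprn_gt0 ?maxd_gt0//.
rewrite lerXn2r ?nnegrE ?(ltW hM) ?(ltW (maxd_gt0 _ _))//.
by rewrite ge_max !le_max lexx (rho_le adm Dx Dy) orbT.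
Qed.

Lemma measurable_tker : measurable_fun setT (fun z => K z.1 z.2).
Proof.
apply: measurable_fun_inv_ge0.
  by move=> z _; rewrite exprn_ge0// ltW// maxd_gt0.
apply: measurable_funX; apply: measurable_maxr => //.
exact: measurable_rho adm.
Qed.

Lemma measurable_tker1 x : measurable_fun D (K x).
Proof.
apply: measurable_funTS.
exact: (measurableT_comp measurable_tker (pair1_measurable x)).
Qed.

Lemma tker_integrableM x (f : T -> R) : mu.-integrable D (EFin \o f) ->
  mu.-integrable D (EFin \o (fun y => K x y * f y)).
Proof.
move=> intf; apply: (@le_integrable_EFin _ _ _ _ _ _ _ (fun y => delta ^- n.+1 * `|f y|)) => //.
- apply: measurable_funM; first exact: measurable_tker1.
  exact/measurable_EFinP/(measurable_int mu).
- move=> y _; rewrite normrM ler_wpM2r//.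
  by rewrite ger0_norm ?tker_ge0// tker_le.
- by apply: integrableZ_EFin => //; exact: integrable_norm.
Qed.

Lemma tker_integrable x : mu.-integrable D (EFin \o K x).
Proof.
have := tker_integrableM x (integrable_cst 1).
by under [EFin \o _]eq_fun do rewrite /= mulr1.
Qed.

(** In the notation of the overview [kdeg] is the degree of K_d and [kmean] is T_d; [kenergy u] is
    the density whose integral is the form of K_d at [u]. *)
Definition kdeg x := \int[mu]_(y in D) K x y.
Definition ksum (u : T -> R) x := \int[mu]_(y in D) (K x y * u y).
Definition kenergy (u : T -> R) x := \int[mu]_(y in D) (K x y * (u x - u y) ^+ 2).
Definition kmean (u : T -> R) x := ksum u x / kdeg x.

Lemma kdeg_ge x : D x -> Num.max M delta ^- n.+1 * fine (mu D) <= kdeg x.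
Proof.
move=> Dx; rewrite -Rintegral_cst//; apply: le_Rintegral => //.
- exact: integrable_cst.
- exact: tker_integrable.
- by move=> y Dy; exact: tker_ge.
Qed.

Lemma kdeg_gt0 x : D x -> 0 < kdeg x.
Proof.
move=> Dx; apply: lt_le_trans (kdeg_ge Dx).
by rewrite mulr_gt0 ?fine_muD_gt0// invr_gt0 exprn_gt0// lt_max d0 orbT.
Qed.

Section fixed_u.
Variable u : T -> R.
Hypothesis su : sqint mu D u.

Lemma sqint_subc c : sqint mu D (fun y => c - u y).
Proof. by apply: sqintB => //; exact: sqint_cst. Qed.

Lemma kenergy_integrable x c :
  mu.-integrable D (EFin \o (fun y => K x y * (c - u y) ^+ 2)).
Proof. by apply: tker_integrableM; apply: sqint_integrable => //; exact: sqint_subc. Qed.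

Lemma kenergy_ge0 x : 0 <= kenergy u x.
Proof. by apply: Rintegral_ge0 => y _; rewrite mulr_ge0 ?tker_ge0 ?sqr_ge0. Qed.

Lemma kmean_sub x : D x ->
  kdeg x * (u x - kmean u x) = \int[mu]_(y in D) (K x y * (u x - u y)).
Proof.
move=> Dx; rewrite mulrBr /kmean mulrCA mulfV ?gt_eqF ?kdeg_gt0// mulr1.
rewrite /kdeg -RintegralZr//; last exact: tker_integrable.
rewrite -RintegralB//.
- by apply: eq_Rintegral => y _; rewrite mulrBr.
- have := tker_integrableM x (integrable_cst (u x)); exact.
- exact: tker_integrableM (sqint_L1 su).
Qed.

(** Cauchy-Schwarz with the weight [K x] in [kmean_sub], after which one factor [kdeg x] cancels.
    Integrated in [x], this is the L^2 estimate of the overview. *)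
Lemma kmean_near x : D x -> kdeg x * (u x - kmean u x) ^+ 2 <= kenergy u x.
Proof.
move=> Dx; have k0 := kdeg_gt0 Dx.
rewrite -(ler_pM2l k0).
have -> : kdeg x * (kdeg x * (u x - kmean u x) ^+ 2) = (kdeg x * (u x - kmean u x)) ^+ 2.
  by ring.
rewrite kmean_sub//; apply: weighted_cauchy_schwarz => //.
- by move=> y _; exact: tker_ge0.
- exact: tker_integrable.
- by apply: tker_integrableM; apply: sqint_L1; exact: sqint_subc.
- exact: kenergy_integrable.
Qed.

End fixed_u.

(** The constant of [inv_expr_diff] for the exponent [n.+1], with the division by [delta]
    included. *)
Definition klip : R := (n.+1)%:R * 2 ^+ n.+1 / delta.

Lemma klip_ge0 : 0 <= klip.
Proof. by rewrite /klip divr_ge0 ?mulr_ge0 ?exprn_ge0// ltW. Qed.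

(** The truncated distance to [z] is at least [delta] and is 1-Lipschitz in the other point, which
    is what [inv_expr_diff] asks for. *)
Lemma tker_diff x y z : rho x y <= delta ->
  K y z <= 2 ^+ n.+1 * K x z /\ `|K x z - K y z| <= klip * rho x y * K x z.
Proof.
move=> hd.
have := @inv_expr_diff R delta (Num.max (rho x z) delta) (Num.max (rho y z) delta)
  (rho x y) n.+1 d0.
rewrite !le_max !lexx !orbT => /(_ isT isT).
have t1 := rho_tri adm x y z; have t2 := rho_tri adm y x z.
have -> : klip * rho x y = (n.+1)%:R * 2 ^+ n.+1 * (rho x y / delta) by rewrite /klip; ring.
apply => //.
rewrite (rhoC adm y x) in t2.
rewrite ler_norml lerBlDr lerBrDr !maxEle; have := rho_ge0 adm x y.
by case: (leP (rho x z)); case: (leP (rho y z)) => *; apply/andP; split; lra.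
Qed.

Lemma ksum_lip (w : T -> R) x y : mu.-integrable D (EFin \o w) -> rho x y <= delta ->
  `|ksum w x - ksum w y| <=
    klip * rho x y * \int[mu]_(z in D) (K x z * `|w z|).
Proof.
move=> iw hd; have iK := tker_integrableM _ iw.
rewrite /ksum -RintegralB// -RintegralZl//; last first.
  by apply: tker_integrableM; exact: integrable_norm.
apply: (le_trans (le_normr_Rintegral _ _)) => //.
  exact: integrableB_EFin.
apply: le_Rintegral => //.
- by apply: integrable_norm; exact: integrableB_EFin.
- by apply: integrableZ_EFin => //; apply: tker_integrableM; exact: integrable_norm.
- move=> z _; rewrite -mulrBl normrM mulrA ler_wpM2r//.
  by have [_] := tker_diff z hd.
Qed.

Lemma kdeg_lip x y : rho x y <= delta ->
  `|kdeg x - kdeg y| <= klip * rho x y * kdeg x.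
Proof.
move=> hd; have := ksum_lip (integrable_cst 1) hd.
rewrite /ksum /kdeg.
under eq_Rintegral do rewrite mulr1.
under [X in _ - X]eq_Rintegral do rewrite mulr1.
by under [X in _ <= _ * X]eq_Rintegral do rewrite normr1 mulr1.
Qed.

Lemma kdeg_comp x y : rho x y <= delta -> kdeg y <= 2 ^+ n.+1 * kdeg x.
Proof.
move=> hd; rewrite /kdeg -RintegralZl//; last exact: tker_integrable.
apply: le_Rintegral => //; first exact: tker_integrable.
- by apply: integrableZ_EFin => //; exact: tker_integrable.
- by move=> z _; have [] := tker_diff z hd.
Qed.

(** The summand 1 comes from the variation of the numerator of [kmean]. The product of two powers of
    2 comes from that of its denominator, where [ksum] and [kdeg] at [y] are both compared with
    integrals at [x]. *)
Definition klipC : R := (klip * (1 + 2 ^+ n.+1 * 2 ^+ n.+1)) ^+ 2.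

Lemma klipC_ge0 : 0 <= klipC. Proof. exact: sqr_ge0. Qed.

(** Weighted means fix constants, so [u] may be replaced by [g = u x - u]: this is what puts the
    energy density at [x] on the right, and not the size of [u]. What remains is the quotient rule,
    with Cauchy-Schwarz for the integral of [K x |g|]. *)
Lemma kmean_lip (u : T -> R) x y : sqint mu D u -> D x -> D y -> rho x y <= delta ->
  (kmean u x - kmean u y) ^+ 2 <= klipC * rho x y ^+ 2 * (kenergy u x / kdeg x).
Proof.
move=> su Dx Dy hd.
have kx := kdeg_gt0 Dx; have ky := kdeg_gt0 Dy.
pose g z := u x - u z.
have sg : sqint mu D g by exact: sqint_subc.
have ig := sqint_L1 sg.
have kmE v : D v -> u x - kmean u v = ksum g v / kdeg v.
  move=> Dv; have kv := kdeg_gt0 Dv.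
  rewrite /kmean -[u x](@mulfK _ (kdeg v)) ?gt_eqF// -mulrBl; congr (_ / _).
  rewrite /kdeg -RintegralZl//; last exact: tker_integrable.
  rewrite /ksum -RintegralB//; last 2 first.
  - by apply: integrableZ_EFin => //; exact: tker_integrable.
  - exact: tker_integrableM (sqint_L1 su).
  by apply: eq_Rintegral => z _; rewrite /g; ring.
have -> : kmean u x - kmean u y = ksum g y / kdeg y - ksum g x / kdeg x.
  by rewrite -!kmE//; ring.
set m1 := \int[mu]_(z in D) (K x z * `|g z|).
have m1E : m1 ^+ 2 <= kdeg x * kenergy u x.
  apply: le_trans.
    apply: (@weighted_cauchy_schwarz _ _ _ mu D mD (K x) (fun z => `|g z|)) => //.
    - by move=> z _; exact: tker_ge0.
    - exact: tker_integrable.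
    - by apply: tker_integrableM; exact: integrable_norm.
    - under [EFin \o _]eq_fun do rewrite /= real_normK ?num_real//.
      exact: kenergy_integrable.
  by under [X in _ * X <= _]eq_Rintegral do rewrite real_normK ?num_real//.
have m10 : 0 <= m1 by apply: Rintegral_ge0 => z _; rewrite mulr_ge0 ?tker_ge0.
have AB := ksum_lip ig hd; rewrite -/m1 in AB.
have kk := kdeg_lip hd.
have kc : kdeg x <= 2 ^+ n.+1 * kdeg y by apply: kdeg_comp; rewrite (rhoC adm).
have By : `|ksum g y| <= 2 ^+ n.+1 * m1.
  apply: (le_trans (le_normr_Rintegral _ _)) => //.
    exact: tker_integrableM.
  rewrite /m1 -RintegralZl//; last by apply: tker_integrableM; exact: integrable_norm.
  apply: le_Rintegral => //.
  - by apply: integrable_norm; exact: tker_integrableM.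
  - by apply: integrableZ_EFin => //; apply: tker_integrableM; exact: integrable_norm.
  - move=> z _; rewrite normrM (ger0_norm (tker_ge0 _ _)) mulrA ler_wpM2r//.
    by have [] := tker_diff z hd.
have L0 := klip_ge0; have r0 := rho_ge0 adm x y.
set p := (2 : R) ^+ n.+1 in kc By *.
have p0 : 0 <= p by exact: exprn_ge0.
have key : `|ksum g y / kdeg y - ksum g x / kdeg x| <=
    klip * rho x y * (1 + p * p) * (m1 / kdeg x).
  have -> : ksum g y / kdeg y - ksum g x / kdeg x =
    (ksum g y * (kdeg x - kdeg y)) / (kdeg x * kdeg y) - (ksum g x - ksum g y) / kdeg x.
    by field; rewrite !gt_eqF.
  apply: (le_trans (ler_normB _ _)).
  rewrite !normrM !normfV !normrM !(gtr0_norm kx) (gtr0_norm ky).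
  have -> : klip * rho x y * (1 + p * p) * (m1 / kdeg x) =
    (p * m1 * (klip * rho x y * kdeg x)) * ((p * kdeg y) / (kdeg x * kdeg x * kdeg y)) +
    klip * rho x y * m1 / kdeg x by field; rewrite !gt_eqF.
  apply: lerD; last by rewrite ler_pM2r// invr_gt0.
  apply: ler_pM => //.
  - by rewrite invr_ge0 mulr_ge0// ltW.
  - by apply: ler_pM.
  - rewrite ler_pdivlMr ?mulr_gt0//.
    have -> : (kdeg x * kdeg y)^-1 * (kdeg x * kdeg x * kdeg y) = kdeg x.
      by field; rewrite !gt_eqF.
    by [].
rewrite -(real_normK (num_real _)).
apply: (@le_trans _ _ ((klip * rho x y * (1 + p * p) * (m1 / kdeg x)) ^+ 2)).
  apply: lerXn2r => //; rewrite nnegrE ?normr_ge0//.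
  have i0 : 0 <= (kdeg x)^-1 by rewrite invr_ge0 ltW.
  apply: mulr_ge0; last exact: mulr_ge0.
  by apply: mulr_ge0; [exact: mulr_ge0|rewrite addr_ge0// mulr_ge0].
have -> : (klip * rho x y * (1 + p * p) * (m1 / kdeg x)) ^+ 2 =
  klipC * rho x y ^+ 2 * (m1 ^+ 2 / (kdeg x * kdeg x)).
  by rewrite /klipC -/p; field; rewrite gt_eqF.
apply: (ler_wpM2l (mulr_ge0 klipC_ge0 (sqr_ge0 _))).
rewrite ler_pdivrMr ?mulr_gt0//.
by have -> : kenergy u x / kdeg x * (kdeg x * kdeg x) = kdeg x * kenergy u x
  by field; rewrite gt_eqF.
Qed.

End fixed_delta.
End smoothing.

(* Bounded real sequences converge along a free ultrafilter, which gives all the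
   limits needed for a diagonal extraction at once. *)
Lemma ultra_bounded_cauchy (R : realType) (U : set_system nat) (a : nat -> R) (B e : R) :
  UltraFilter U -> (forall k, `|a k| <= B) -> 0 < e ->
  exists2 A, U A & forall i j, A i -> A j -> `|a i - a j| <= e.
Proof.
move=> FU aB e0.
have Usub : (a @ U) `[- B, B]%classic.
  rewrite /fmap /= (_ : _ @^-1` _ = setT); first exact: filterT.
  by apply/seteqP; split => // k _ /=; rewrite in_itv /= -ler_norml.
have [p [_ clp]] := @segment_compact R (- B) B (a @ U) _ Usub.
have e20 : 0 < e / 2 by rewrite divr_gt0.
have nb : nbhs p (ball p (e / 2)) by exact: nbhsx_ballx.
exists (a @^-1` ball p (e / 2)).
  have [//|Uc] := in_ultra_setVsetC (a @^-1` ball p (e / 2)) FU.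
  have : (a @ U) (~` ball p (e / 2)) by [].
  by move=> /clp /(_ nb) [x []].
move=> i j /= ai aj; rewrite /ball /= in ai aj.
have -> : a i - a j = (p - a j) - (p - a i) by ring.
by apply: (le_trans (ler_normB _ _)); lra.
Qed.

(** Finite intersections of the sets [A m] stay in [U], and [U] contains the sets of large integers;
    so each intersection has arbitrarily large members, and [phi m] can be picked in the [m]-th one,
    increasingly. *)
Lemma ultra_diagonal (U : set_system nat) (P : nat -> nat -> nat -> Prop) :
  UltraFilter U -> \oo `<=` U ->
  (forall m, exists2 A, U A & forall i j, A i -> A j -> P m i j) ->
  exists phi : nat -> nat, (forall i j, (i < j)%N -> (phi i < phi j)%N) /\
    forall m i j, (m <= i)%N -> (m <= j)%N -> P m (phi i) (phi j).
Proof.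
move=> FU oU H.
have /choice[A HA] m : exists A, U A /\ forall i j, A i -> A j -> P m i j.
  by have [A UA PA] := H m; exists A.
have UA m := (HA m).1.
pose B m := [set k | forall l, (l <= m)%N -> A l k].
have UB m : U (B m).
  elim: m => [|m IH].
    by apply: filterS (UA 0%N) => k Ak l; rewrite leqn0 => /eqP ->.
  apply: filterS (filterI IH (UA m.+1)) => k [Bk Ak] l.
  by rewrite leq_eqVlt => /predU1P[->//|]; exact: Bk.
have ex m N : exists k, B m k /\ (N < k)%N.
  have UN : U [set k | (N < k)%N] by apply: oU; exists N.+1.
  have UBN : U (B m `&` [set k | (N < k)%N]) by exact: filterI.
  by have [k [Bk Nk]] := filter_ex UBN; exists k.
have [next nextP] := choice (fun mN : nat * nat => ex mN.1 mN.2).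
pose phi := fix phi m := if m is m'.+1 then next (m, phi m') else next (0, 0)%N.
have Bphi m : B m (phi m) by case: m => [|m]; [exact: (nextP (0, 0)%N).1|exact: (nextP (m.+1, phi m)).1].
exists phi; split.
  apply: (@homo_ltn _ phi (fun a b => a < b)%N).
    by move=> a b c; exact: ltn_trans.
  by move=> i; exact: (nextP (i.+1, phi i)).2.
by move=> m i j mi mj; apply: (HA m).2; exact: Bphi.
Qed.

(** * Quadratic forms of nonnegative kernels *)

Section forms.
Context d (T : measurableType d) (R : realType).
Variable mu : {sigma_finite_measure set T -> \bar R}.
Variables (n : nat) (D : set T) (rho : T -> T -> R) (M : R).
Hypothesis adm : admissible mu n D rho M.

Let mD := adm_mD adm.
Let mDD : measurable (D `*` D). Proof. exact: measurableX. Qed.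
Local Hint Resolve mD mDD : core.

(** Without the factor 1/2 of [Es], and with extended values, so that Tonelli and Fatou apply before
    finiteness is known. *)
Definition kform (k : T -> T -> R) (u : T -> R) : \bar R :=
  (\int[pmeasure mu mu]_(z in D `*` D) ((u z.1 - u z.2) ^+ 2 * k z.1 z.2)%:E)%E.

Definition mkernel (k : T -> T -> R) :=
  measurable_fun (D `*` D) (fun z => k z.1 z.2) /\ forall x y, 0 <= k x y.

Lemma mkernel_tker delta : 0 < delta -> mkernel (tker n rho delta).
Proof.
move=> d0; split; last by move=> x y; exact: tker_ge0.
by apply: measurable_funTS; exact: (measurable_tker adm).
Qed.

Lemma kform_ge0 k u : mkernel k -> (0 <= kform k u)%E.
Proof.
by move=> [_ k0]; apply: integral_ge0 => z _; rewrite lee_fin mulr_ge0 ?sqr_ge0.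
Qed.

Lemma measurable_diff (u : T -> R) : measurable_fun D u ->
  measurable_fun (D `*` D) (fun z => u z.1 - u z.2).
Proof.
by move=> mu_; apply: measurable_funB; [exact: measurable_fstD|exact: measurable_sndD].
Qed.

Lemma measurable_kform k (u : T -> R) : mkernel k -> measurable_fun D u ->
  measurable_fun (D `*` D) (fun z => (u z.1 - u z.2) ^+ 2 * k z.1 z.2).
Proof.
move=> [mk _] mu_; apply: measurable_funM => //; apply: measurable_funX.
exact: measurable_diff.
Qed.

Lemma measurable_kformE k (u : T -> R) : mkernel k -> measurable_fun D u ->
  measurable_fun (D `*` D) (fun z => ((u z.1 - u z.2) ^+ 2 * k z.1 z.2)%:E).
Proof. by move=> mk mu_; apply/measurable_EFinP; exact: measurable_kform. Qed.

Lemma le_kform k1 k2 (u v : T -> R) : mkernel k1 -> mkernel k2 ->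
  measurable_fun D u -> measurable_fun D v ->
  (forall x y, D x -> D y ->
     (u x - u y) ^+ 2 * k1 x y <= (v x - v y) ^+ 2 * k2 x y) ->
  (kform k1 u <= kform k2 v)%E.
Proof.
move=> mk1 mk2 mu_ mv uv; apply: ge0_le_integral => //.
- by move=> z _; rewrite lee_fin mulr_ge0 ?sqr_ge0 ?mk1.2.
- exact: measurable_kformE.
- exact: measurable_kformE.
- by move=> [x y] [/= Dx Dy]; rewrite lee_fin; exact: uv.
Qed.

Lemma kformZ k c (u : T -> R) : 0 <= c -> mkernel k -> measurable_fun D u ->
  kform (fun x y => c * k x y) u = (c%:E * kform k u)%E.
Proof.
move=> c0 mk mu_; rewrite /kform -ge0_integralZl//.
- by apply: eq_integral => z _; rewrite -EFinM; congr EFin; ring.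
- exact: measurable_kformE.
- by move=> z _; rewrite lee_fin mulr_ge0 ?sqr_ge0 ?mk.2.
Qed.

Lemma mkernelZ k c : 0 <= c -> mkernel k -> mkernel (fun x y => c * k x y).
Proof.
move=> c0 [mk k0]; split; first by apply: measurable_funM.
by move=> x y; rewrite mulr_ge0.
Qed.

Lemma mkernelD k1 k2 : mkernel k1 -> mkernel k2 -> mkernel (fun x y => k1 x y + k2 x y).
Proof.
move=> [mk1 k10] [mk2 k20]; split; first exact: measurable_funD.
by move=> x y; rewrite addr_ge0.
Qed.

Lemma kformD k1 k2 (u : T -> R) : mkernel k1 -> mkernel k2 -> measurable_fun D u ->
  kform (fun x y => k1 x y + k2 x y) u = (kform k1 u + kform k2 u)%E.
Proof.
move=> mk1 mk2 mu_; rewrite /kform -ge0_integralD//.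
- by apply: eq_integral => z _; rewrite -EFinD; congr EFin; ring.
- by move=> z _; rewrite lee_fin mulr_ge0 ?sqr_ge0 ?mk1.2.
- exact: measurable_kformE.
- by move=> z _; rewrite lee_fin mulr_ge0 ?sqr_ge0 ?mk2.2.
- exact: measurable_kformE.
Qed.

Lemma kformB_le k (u v : T -> R) : mkernel k -> measurable_fun D u -> measurable_fun D v ->
  (kform k (fun x => (u x - v x)%R) <= 2%:E * kform k u + 2%:E * kform k v)%E.
Proof.
move=> mk mu_ mv; rewrite /kform -!ge0_integralZl//; last 4 first.
- exact: measurable_kformE.
- by move=> z _; rewrite lee_fin mulr_ge0 ?sqr_ge0 ?mk.2.
- exact: measurable_kformE.
- by move=> z _; rewrite lee_fin mulr_ge0 ?sqr_ge0 ?mk.2.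
rewrite -ge0_integralD//.
- apply: ge0_le_integral => //.
  + by move=> z _; rewrite lee_fin mulr_ge0 ?sqr_ge0 ?mk.2.
  + by apply: (@measurable_kformE k (fun x => u x - v x)) => //; exact: measurable_funB.
  + by apply: emeasurable_funD; apply: measurable_funeM;
      exact: measurable_kformE.
  + move=> z _; rewrite -!EFinM -EFinD lee_fin.
    have := mk.2 z.1 z.2; move: (k z.1 z.2) => c c0.
    have h : (u z.1 - v z.1 - (u z.2 - v z.2)) ^+ 2 <=
       2 * (u z.1 - u z.2) ^+ 2 + 2 * (v z.1 - v z.2) ^+ 2.
      have := sqr_ge0 ((u z.1 - u z.2) + (v z.1 - v z.2)); lra.
    by apply: (le_trans (ler_wpM2r c0 h)); rewrite mulrDl !mulrA.
- by move=> z _; rewrite -EFinM lee_fin mulr_ge0// mulr_ge0 ?sqr_ge0 ?mk.2.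
- by apply: measurable_funeM; exact: measurable_kformE.
- by move=> z _; rewrite -EFinM lee_fin mulr_ge0// mulr_ge0 ?sqr_ge0 ?mk.2.
- by apply: measurable_funeM; exact: measurable_kformE.
Qed.

Lemma measurable_Rintegral_section (F : T * T -> R) :
  measurable_fun (D `*` D) F -> (forall z, (D `*` D) z -> 0 <= F z) ->
  (forall x, D x -> mu.-integrable D (EFin \o (fun y => F (x, y)))) ->
  measurable_fun D (fun x => \int[mu]_(y in D) F (x, y)).
Proof.
move=> mF F0 iF; apply/measurable_EFinP.
apply: (@eq_measurable_fun _ _ _ _ D (fun x => \int[mu]_(y in D) (F (x, y))%:E)%E).
  by move=> x /set_mem Dx; rewrite /= -Rintegral_fineK//; exact: iF.
apply: (@measurable_fubini_on _ _ _ mu D mD (EFin \o F)).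
  exact/measurable_EFinP.
by move=> z Dz; rewrite lee_fin; exact: F0.
Qed.

Section fixed_delta.
Variable delta : R.
Hypothesis d0 : 0 < delta.
Local Notation K := (tker n rho delta).

Let mK := mkernel_tker d0.

Lemma kform_fubini k (u : T -> R) : mkernel k -> measurable_fun D u ->
  kform k u = (\int[mu]_(x in D) \int[mu]_(y in D) ((u x - u y) ^+ 2 * k x y)%:E)%E.
Proof.
move=> mk mu_; rewrite /kform.
apply: (@fubini_on1 _ _ _ mu D mD (fun z => ((u z.1 - u z.2) ^+ 2 * k z.1 z.2)%:E)).
  exact: measurable_kformE.
by move=> z _; rewrite lee_fin mulr_ge0 ?sqr_ge0 ?mk.2.
Qed.

Lemma kenergy_form (u : T -> R) : sqint mu D u ->
  (\int[mu]_(x in D) (kenergy mu n D rho delta u x)%:E = kform K u)%E.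
Proof.
move=> su; rewrite kform_fubini//; last exact: su.1.
apply: eq_integral => x _; rewrite /kenergy -Rintegral_fineK//.
  by apply: eq_integral => y _; rewrite mulrC.
exact: (kenergy_integrable adm).
Qed.

Lemma measurable_kenergy_gen (g : T -> T -> R) :
  measurable_fun (D `*` D) (fun z => g z.1 z.2) -> (forall x y, 0 <= g x y) ->
  (forall x, D x -> mu.-integrable D (EFin \o g x)) ->
  measurable_fun D (fun x => \int[mu]_(y in D) (K x y * g x y)).
Proof.
move=> mg g0 ig.
apply: (@measurable_Rintegral_section (fun z => K z.1 z.2 * g z.1 z.2)).
- by apply: measurable_funM => //; exact: mK.1.
- by move=> z _; rewrite mulr_ge0 ?tker_ge0.
- by move=> x Dx; apply: (tker_integrableM adm) => //; exact: ig.
Qed.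

Lemma measurable_kenergy (u : T -> R) : sqint mu D u ->
  measurable_fun D (kenergy mu n D rho delta u).
Proof.
move=> su; apply: measurable_kenergy_gen.
- by apply: measurable_funX; exact: measurable_diff su.1.
- by move=> x y; rewrite sqr_ge0.
- by move=> x Dx; apply: sqint_integrable => //; exact: (sqint_subc adm).
Qed.

Lemma measurable_kdeg : measurable_fun D (kdeg mu n D rho delta).
Proof.
have := @measurable_kenergy_gen (fun _ _ => 1) (measurable_cst _) (fun _ _ => ler01)
  (fun x _ => integrable_cst adm 1).
by under [fun x => _]eq_fun do under eq_Rintegral do rewrite mulr1.
Qed.

(* ksum u is recovered from the nonnegative integrals of (1 - u)^2 and u^2. *)
Lemma measurable_ksum (u : T -> R) : sqint mu D u ->
  measurable_fun D (ksum mu n D rho delta u).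
Proof.
move=> su.
pose E c x := \int[mu]_(y in D) (K x y * (c - u y) ^+ 2).
have mE c : measurable_fun D (E c).
  apply: (measurable_kenergy_gen (g := fun _ y => (c - u y) ^+ 2)).
  - apply: measurable_funX; apply: measurable_funB => //.
    exact: measurable_sndD su.1.
  - by move=> x y; rewrite sqr_ge0.
  - by move=> x Dx; apply: sqint_integrable => //; exact: (sqint_subc adm).
have SE x : ksum mu n D rho delta u x = 2^-1 * (kdeg mu n D rho delta x + E 0 x - E 1 x).
  have i0 := kenergy_integrable adm d0 su x 0.
  have i1 := kenergy_integrable adm d0 su x 1.
  have ik := tker_integrable adm d0 x.
  rewrite /E /kdeg -RintegralD// -RintegralB//; last exact: integrableD_EFin.
  rewrite -RintegralZl//; last by apply: integrableB_EFin => //; exact: integrableD_EFin.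
  by apply: eq_Rintegral => y _; field.
rewrite (funext SE); apply: measurable_funM => //; apply: measurable_funB => //.
by apply: measurable_funD => //; exact: measurable_kdeg.
Qed.

Lemma measurable_kmean (u : T -> R) : sqint mu D u ->
  measurable_fun D (kmean mu n D rho delta u).
Proof.
move=> su; apply: measurable_funM; first exact: measurable_ksum.
apply: measurable_fun_inv_ge0; last exact: measurable_kdeg.
by move=> x Dx; rewrite ltW// (kdeg_gt0 adm).
Qed.

Lemma kmean_mean_sq (u : T -> R) A : sqint mu D u -> 0 < A ->
  (forall x, D x -> A <= kdeg mu n D rho delta x) ->
  (A%:E * \int[mu]_(x in D) ((u x - kmean mu n D rho delta u x) ^+ 2)%:E <= kform K u)%E.
Proof.
move=> su A0 Ak; rewrite -kenergy_form// -ge0_integralZl_EFin//; last 3 first.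
- by move=> x _; rewrite lee_fin sqr_ge0.
- apply/measurable_EFinP/measurable_funX; apply: measurable_funB; first exact: su.1.
  exact: measurable_kmean.
- exact: ltW.
apply: ge0_le_integral => //.
- by move=> x _; rewrite -EFinM lee_fin mulr_ge0 ?sqr_ge0 ?ltW.
- apply: measurable_funeM; apply/measurable_EFinP/measurable_funX.
  by apply: measurable_funB; [exact: su.1|exact: measurable_kmean].
- exact/measurable_EFinP/measurable_kenergy.
- move=> x Dx; rewrite -EFinM lee_fin.
  apply: le_trans (kmean_near adm d0 su Dx).
  by rewrite ler_wpM2r ?sqr_ge0 ?Ak.
Qed.

End fixed_delta.
End forms.

(** * Compactness of H^0 in L^2 *)

Section fractional_kernel.
Context d (T : measurableType d) (R : realType).
Variable mu : {sigma_finite_measure set T -> \bar R}.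
Variables (n : nat) (D : set T) (rho : T -> T -> R) (M : R).
Hypothesis adm : admissible mu n D rho M.

Let mD := adm_mD adm.
Local Hint Resolve mD : core.

Definition fker (s : R) x y : R := (rho x y `^ ((n.+1)%:R + 2 * s))^-1.

Lemma fker_ge0 s x y : 0 <= fker s x y.
Proof. by rewrite invr_ge0 powR_ge0. Qed.

Lemma mkernel_fker s : mkernel D (fker s).
Proof.
split; last exact: fker_ge0.
apply: measurable_fun_inv_ge0; first by move=> z _; exact: powR_ge0.
apply: (measurableT_comp (measurable_powR _)).
by apply: measurable_funTS; exact: measurable_rho adm.
Qed.

Lemma rho_gt0 x y : x != y -> 0 < rho x y.
Proof. by move=> xy; rewrite lt_def (rho_eq0 adm) xy (rho_ge0 adm). Qed.

Lemma fker0E x y : fker 0 x y = rho x y ^- n.+1.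
Proof. by rewrite /fker mulr0 addr0 powR_mulrn// (rho_ge0 adm). Qed.

Lemma fker_halfE x y : fker 2^-1 x y = rho x y ^- n.+2.
Proof.
rewrite /fker mulfV ?pnatr_eq0// -[_ + 1]/(_ + 1%:R) -natrD addn1.
by rewrite powR_mulrn// (rho_ge0 adm).
Qed.

Lemma fkerxx s x : 0 <= s -> fker s x x = 0.
Proof.
move=> s0; have /eqP r0 : rho x x == 0 by rewrite (rho_eq0 adm).
by rewrite /fker r0 powR0 ?invr0// gt_eqF// ltr_wpDr// mulr_ge0.
Qed.

(** The kernels themselves are not ordered on the diagonal, where [fker 0] takes the default value 0
    and [tker] is positive; there the factor [(u x - u y)^2] vanishes. *)
Lemma tker_le_fker0 (delta : R) (u : T -> R) x y : 0 < delta ->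
  (u x - u y) ^+ 2 * tker n rho delta x y <= (u x - u y) ^+ 2 * fker 0 x y.
Proof.
move=> d0; have [->|xy] := eqVneq x y; first by rewrite subrr expr0n !mul0r.
have r0 := rho_gt0 xy.
rewrite ler_wpM2l ?sqr_ge0// fker0E lef_pV2 ?posrE ?exprn_gt0 ?lt_max ?r0//.
by rewrite lerXn2r ?nnegrE ?le_max ?lexx// ltW.
Qed.

Lemma fker0_le s x y : 0 <= s -> D x -> D y -> fker 0 x y <= M `^ (2 * s) * fker s x y.
Proof.
move=> s0 Dx Dy; have [->|xy] := eqVneq x y.
  by rewrite !fkerxx// mulr0.
have r0 := rho_gt0 xy.
have p0 := powR_gt0 ((n.+1)%:R + 2 * s) r0.
rewrite fker0E /fker ler_pdivlMr// mulrC ler_pdivrMr ?exprn_gt0//.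
rewrite powRD; last by rewrite (gt_eqF r0) implybT.
rewrite powR_mulrn ?(ltW r0)// mulrC ler_wpM2r ?exprn_ge0 ?(ltW r0)//.
apply: ge0_ler_powR; rewrite ?nnegrE ?(ltW r0) ?mulr_ge0//.
  by apply: le_trans (adm_M1 adm).
exact: (rho_le adm).
Qed.

Lemma fker_le_half s x y : 0 <= s -> s <= 2^-1 -> rho x y <= 1 -> fker s x y <= fker 2^-1 x y.
Proof.
move=> s0 s1 r1; have [->|xy] := eqVneq x y.
  by rewrite !fkerxx// invr_ge0.
have r0 := rho_gt0 xy.
rewrite /fker lef_pV2 ?posrE ?powR_gt0//; apply: ger_powR; first by rewrite r0.
lra.
Qed.

Lemma fker_far_le s eta x y : 0 <= s -> 0 < eta -> eta <= rho x y ->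
  fker s x y <= (eta^-1) `^ (2 * s) * fker 0 x y.
Proof.
move=> s0 e0 er; have r0 : 0 < rho x y by exact: lt_le_trans er.
rewrite fker0E /fker powRD; last by rewrite (gt_eqF r0) implybT.
rewrite powR_mulrn ?(ltW r0)// invfM mulrC.
apply: ler_wpM2r; first by rewrite invr_ge0 exprn_ge0// ltW.
have -> : eta^-1 `^ (2 * s) = (eta `^ (2 * s))^-1.
  by rewrite -(powR_inv1 (ltW e0)) -powRrM mulN1r powRN.
rewrite lef_pV2 ?posrE ?powR_gt0//.
by apply: ge0_ler_powR; rewrite ?nnegrE ?mulr_ge0 ?(ltW e0) ?(ltW r0).
Qed.

(** Split at distance 1: below it the kernel increases with [s], above it it decreases. *)
Lemma fker_le s x y : 0 <= s -> s <= 2^-1 -> fker s x y <= fker 0 x y + fker 2^-1 x y.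
Proof.
move=> s0 s1; have [r1|r1] := leP (rho x y) 1.
  by apply: (le_trans (fker_le_half s0 s1 r1)); rewrite lerDr fker_ge0.
apply: (@le_trans _ _ (fker 0 x y)); last by rewrite lerDl fker_ge0.
by have := fker_far_le s0 ltr01 (ltW r1); rewrite invr1 powR1 mul1r.
Qed.

Lemma form_tker_le (delta : R) (u : T -> R) : 0 < delta -> measurable_fun D u ->
  (kform mu D (tker n rho delta) u <= kform mu D (fker 0) u)%E.
Proof.
move=> d0 mu_; apply: (le_kform adm) => //.
- exact: (mkernel_tker adm).
- exact: mkernel_fker.
- by move=> x y _ _; exact: tker_le_fker0.
Qed.

Lemma ge0_Rintegral_le (f : T -> R) c : measurable_fun D f -> (forall x, D x -> 0 <= f x) ->
  (\int[mu]_(x in D) (f x)%:E <= c%:E)%E ->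
  mu.-integrable D (EFin \o f) /\ \int[mu]_(x in D) f x <= c.
Proof.
move=> mf f0 fc.
have intf : mu.-integrable D (EFin \o f).
  apply/integrableP; split; first exact/measurable_EFinP.
  rewrite (eq_integral (EFin \o f)); first by rewrite (le_lt_trans fc)// ltry.
  by move=> x /set_mem Dx /=; rewrite ger0_norm ?f0.
by split => //; rewrite -lee_fin -Rintegral_fineK.
Qed.

Lemma sqint_L1_le (w : T -> R) : sqint mu D w ->
  \int[mu]_(x in D) `|w x| <= fine (mu D) + \int[mu]_(x in D) (w x ^+ 2).
Proof.
move=> sw; have i1 := sqint_L1 adm sw; have i2 := sqint_integrable sw.
have c1 := integrable_cst adm 1.
rewrite -[fine _]mul1r -Rintegral_cst// -RintegralD//.
apply: le_Rintegral => //; first exact: integrable_norm.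
  exact: integrableD_EFin.
move=> x _; rewrite -(real_normK (num_real (w x))).
have := sqr_ge0 (`|w x| - 1); have := normr_ge0 (w x); nra.
Qed.

(* Smallness of finitely many functionals w |-> ksum w y controls the L2 norm on
   bounded subsets of H^0. *)
Lemma finitely_many_functionals B eps : 0 <= B -> 0 < eps ->
  exists2 delta, 0 < delta & exists s : seq T, forall w : T -> R, sqint mu D w ->
   (\int[mu]_(x in D) (w x ^+ 2)%:E <= B%:E)%E -> (kform mu D (fker 0) w <= B%:E)%E ->
   (forall y, y \in s -> `|ksum mu n D rho delta w y| <= 2^-1) ->
   (\int[mu]_(x in D) (w x ^+ 2)%:E <= eps%:E)%E.
Proof.
move=> B0 eps0.
set m := fine (mu D); have m0 : 0 < m := fine_muD_gt0 adm.
(* The final bound is [(2 B + 2 m) / A]: the first summand for [w - kmean w], the second for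
   [kmean w]. *)
pose A := Num.max 1 ((2 * B + 2 * m) / eps).
have A1 : 1 <= A by rewrite le_max lexx.
have A0 : 0 < A by apply: lt_le_trans A1.
have Aeps : 2 * B + 2 * m <= eps * A.
  by rewrite [leRHS]mulrC -ler_pdivrMr// le_max lexx orbT.
have [delta d0 Hd] := tker_unbounded adm A.
exists delta => //.
have {Hd} kA x : D x -> A <= kdeg mu n D rho delta x by move=> Dx; exact: Hd.
set L := klip n delta.
have L0 : 0 <= L := klip_ge0 n d0.
(* A Lipschitz constant of [ksum w] at distances up to [delta], uniform in [w]: the kernel is at
   most [delta ^- n.+1] and the L^1 norm of [w] at most [m + B]. *)
pose c := L * (delta ^- n.+1 * (m + B)).
have c0 : 0 <= c.
  apply: mulr_ge0 => //; apply: mulr_ge0; first by rewrite invr_ge0 exprn_ge0// ltW.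
  by rewrite addr_ge0// ltW.
(* Within [eta] the function [ksum w] varies by at most 1/2, so values at most 1/2 on an [eta]-net
   give [|ksum w| <= 1] on [D]. *)
pose eta := Num.min delta (2^-1 / (1 + c)).
have eta0 : 0 < eta by rewrite lt_min d0 divr_gt0// ltr_wpDr.
have [s Hs] := rho_net adm eta0.
exists s => w sw wB fB ws.
have [iw2 wB'] := ge0_Rintegral_le (measurable_funX 2 sw.1) (fun x _ => sqr_ge0 (w x)) wB.
have iw := sqint_L1 adm sw.
have Sw x : D x -> `|ksum mu n D rho delta w x| <= 1.
  move=> Dx; have [y ys rxy] := Hs x Dx.
  have rd : rho x y <= delta by rewrite ltW// (lt_le_trans rxy)// ge_min lexx.
  have := ksum_lip adm d0 iw rd; rewrite -/L.
  have : \int[mu]_(z in D) (tker n rho delta x z * `|w z|) <= delta ^- n.+1 * (m + B).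
    apply: (@le_trans _ _ (delta ^- n.+1 * \int[mu]_(z in D) `|w z|)).
      rewrite -RintegralZl//; last exact: integrable_norm.
      apply: le_Rintegral => //.
      - by apply: (tker_integrableM adm) => //; exact: integrable_norm.
      - by apply: integrableZ_EFin => //; exact: integrable_norm.
      - by move=> z _; rewrite ler_wpM2r// tker_le.
    rewrite ler_wpM2l ?invr_ge0 ?exprn_ge0 ?(ltW d0)//.
    by apply: (le_trans (sqint_L1_le sw)); rewrite lerD2l.
  set I := \int[mu]_(z in D) _ => hI hS.
  have Lr0 : 0 <= L * rho x y by rewrite mulr_ge0// (rho_ge0 adm).
  have h1 : L * rho x y * I <= 2^-1.
    apply: (le_trans (ler_wpM2l Lr0 hI)).
    have -> : L * rho x y * (delta ^- n.+1 * (m + B)) = c * rho x y by rewrite /c; ring.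
    apply: (@le_trans _ _ (c * (2^-1 / (1 + c)))).
      by rewrite ler_wpM2l// ltW// (lt_le_trans rxy)// ge_min lexx orbT.
    rewrite mulrCA ler_piMr// ler_pdivrMr ?ltr_wpDr//; lra.
  have := ws y ys.
  have -> : ksum mu n D rho delta w x = ksum mu n D rho delta w y +
    (ksum mu n D rho delta w x - ksum mu n D rho delta w y) by ring.
  move=> hy; apply: (le_trans (ler_normD _ _)); lra.
have K0 x : D x -> 0 < kdeg mu n D rho delta x by move=> Dx; exact: (kdeg_gt0 adm).
(* [kmean w] is [ksum w / kdeg], hence at most [1 / A] in absolute value. *)
have ptw x : D x -> w x ^+ 2 <= 2 * (w x - kmean mu n D rho delta w x) ^+ 2 + 2 * A ^- 2.
  move=> Dx.
  have : kmean mu n D rho delta w x ^+ 2 <= A ^- 2.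
    rewrite /kmean expr_div_n -[A ^- 2]mul1r; apply: ler_pM; rewrite ?sqr_ge0//.
    - by rewrite invr_ge0 sqr_ge0.
    - by rewrite -(real_normK (num_real _)) exprn_ile1// Sw.
    - rewrite lef_pV2 ?posrE ?exprn_gt0 ?K0//.
      by apply: lerXn2r; rewrite ?nnegrE ?kA//; apply: ltW => //; exact: K0.
  have := sqr_ge0 (w x - 2 * kmean mu n D rho delta w x); nra.
have mTw : measurable_fun D (fun x => (w x - kmean mu n D rho delta w x) ^+ 2).
  apply: measurable_funX; apply: measurable_funB; first exact: sw.1.
  exact: (measurable_kmean adm).
have mean := kmean_mean_sq adm d0 sw A0 kA.
have {}mean : (\int[mu]_(x in D) ((w x - kmean mu n D rho delta w x) ^+ 2)%:E <= (B / A)%:E)%E.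
  have {mean} := le_trans mean (le_trans (form_tker_le d0 sw.1) fB).
  by rewrite muleC EFinM lee_pdivlMr.
have [iT mean'] := ge0_Rintegral_le mTw (fun x _ => sqr_ge0 _) mean.
rewrite Rintegral_fineK// lee_fin.
have i2T := integrableZ_EFin mD 2 iT.
have icst := integrable_cst adm (2 * A ^- 2).
apply: (@le_trans _ _ (\int[mu]_(x in D)
   (2 * (w x - kmean mu n D rho delta w x) ^+ 2 + 2 * A ^- 2))).
  by apply: le_Rintegral => //; exact: integrableD_EFin.
rewrite RintegralD// RintegralZl// Rintegral_cst//.
apply: (@le_trans _ _ (2 * (B / A) + 2 * A ^- 2 * m)); first by rewrite lerD2r ler_wpM2l.
have -> : 2 * (B / A) + 2 * A ^- 2 * m = (2 * B + 2 * m * A^-1) / A by field; rewrite gt_eqF.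
rewrite ler_pdivrMr//; apply: le_trans Aeps.
by rewrite lerD2l ler_piMr ?mulr_ge0 ?(ltW m0)// invf_le1.
Qed.

Lemma ksum_bounded (delta B : R) (w : T -> R) y : 0 < delta -> sqint mu D w ->
  (\int[mu]_(x in D) (w x ^+ 2)%:E <= B%:E)%E ->
  `|ksum mu n D rho delta w y| <= delta ^- n.+1 * (fine (mu D) + B).
Proof.
move=> d0 sw wB; have iw := sqint_L1 adm sw.
have [iw2 wB'] := ge0_Rintegral_le (measurable_funX 2 sw.1) (fun x _ => sqr_ge0 (w x)) wB.
have iK := tker_integrableM adm d0 y iw.
apply: (le_trans (le_normr_Rintegral mD iK)).
apply: (@le_trans _ _ (delta ^- n.+1 * \int[mu]_(z in D) `|w z|)).
  rewrite -RintegralZl//; last exact: integrable_norm.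
  apply: le_Rintegral => //.
  - exact: integrable_norm.
  - by apply: integrableZ_EFin => //; exact: integrable_norm.
  - by move=> z _; rewrite normrM ger0_norm ?tker_ge0// ler_wpM2r// tker_le.
rewrite ler_wpM2l ?invr_ge0 ?exprn_ge0 ?(ltW d0)//.
by apply: (le_trans (sqint_L1_le sw)); rewrite lerD2l.
Qed.

Lemma sqintB_le (u v : T -> R) : sqint mu D u -> sqint mu D v ->
  (\int[mu]_(x in D) ((u x - v x) ^+ 2)%:E <=
   2%:E * \int[mu]_(x in D) (u x ^+ 2)%:E + 2%:E * \int[mu]_(x in D) (v x ^+ 2)%:E)%E.
Proof.
move=> su sv.
have iu := sqint_integrable su; have iv := sqint_integrable sv.
have iuv := sqint_integrable (sqintB mD su sv).
have iu2 := integrableZ_EFin mD 2 iu; have iv2 := integrableZ_EFin mD 2 iv.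
rewrite !Rintegral_fineK// -!EFinM -EFinD lee_fin -!RintegralZl// -RintegralD//.
apply: le_Rintegral => //; first exact: integrableD_EFin.
by move=> x _; have := sqr_ge0 (u x + v x); lra.
Qed.

(** On a set of the ultrafilter the finitely many functionals vary by at most 1/2, so
    [finitely_many_functionals] applies to the differences [u i - u j]. The extraction imposes the
    rate [16^-m] because [L2_complete] asks for it. *)
Lemma compact_embedding (u : nat -> T -> R) B : 0 <= B ->
  (forall k, sqint mu D (u k)) ->
  (forall k, \int[mu]_(x in D) (u k x ^+ 2)%:E <= B%:E)%E ->
  (forall k, kform mu D (fker 0) (u k) <= B%:E)%E ->
  exists (phi : nat -> nat) (v : T -> R), [/\ forall i j, (i < j)%N -> (phi i < phi j)%N,
    sqint mu D v &
    forall k, (\int[mu]_(x in D) ((u (phi k) x - v x) ^+ 2)%:E <= ((16^-1) ^+ k)%:E)%E].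
Proof.
move=> B0 su uB fB.
have [U [FU oU]] := ultraFilterLemma eventually_filter.
pose P m i j := (\int[mu]_(x in D) ((u i x - u j x) ^+ 2)%:E <= ((16^-1) ^+ m)%:E)%E.
have [phi [phiS phiP]] : exists phi : nat -> nat, (forall i j, (i < j)%N -> (phi i < phi j)%N) /\
    forall m i j, (m <= i)%N -> (m <= j)%N -> P m (phi i) (phi j).
  apply: (@ultra_diagonal U P FU oU) => m.
  have e0 : (0 : R) < (16^-1) ^+ m by rewrite exprn_gt0.
  (* A difference of two members has squared norm and form at most [2 B + 2 B]. *)
  have B40 : 0 <= 4 * B by rewrite mulr_ge0.
  have B4E : (4 * B)%:E = (2%:E * B%:E + 2%:E * B%:E)%E.
    by rewrite -!EFinM -EFinD; congr EFin; ring.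
  have [delta d0 [s Hs]] := finitely_many_functionals B40 e0.
  have [A UA HA] : exists2 A, U A & forall i j, A i -> A j -> forall y, y \in s ->
      `|ksum mu n D rho delta (u i) y - ksum mu n D rho delta (u j) y| <= 2^-1.
    elim: s {Hs} => [|y s [A UA HA]]; first by exists setT => //; exact: filterT.
    have h0 : (0 : R) < 2^-1 by rewrite invr_gt0.
    have [A' UA' HA'] := ultra_bounded_cauchy FU
      (fun k => ksum_bounded y d0 (su k) (uB k)) h0.
    exists (A `&` A'); first exact: filterI.
    move=> i j [Ai A'i] [Aj A'j] z; rewrite in_cons => /predU1P[->|zs].
      exact: HA'.
    exact: HA.
  exists A => // i j Ai Aj; apply: Hs.
  - exact: sqintB.
  - apply: (le_trans (sqintB_le (su i) (su j))).
    by rewrite B4E leeD// lee_wpmul2l// lee_fin.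
  - apply: (le_trans (kformB_le adm (mkernel_fker 0) (su i).1 (su j).1)).
    by rewrite B4E leeD// lee_wpmul2l// lee_fin.
  - move=> y ys; apply: le_trans (HA i j Ai Aj y ys).
    rewrite /ksum -RintegralB//; last 2 first.
    + by apply: (tker_integrableM adm) => //; exact: (sqint_L1 adm).
    + by apply: (tker_integrableM adm) => //; exact: (sqint_L1 adm).
    by under eq_Rintegral do rewrite mulrBr.
have [v [sv vP]] := L2_complete mD (fun k => su (phi k))
  (fun k j kj => phiP k k j (leqnn k) kj).
by exists phi, v.
Qed.

End fractional_kernel.

(** * Energies near and away from the diagonal *)

Section density.
Context d (T : measurableType d) (R : realType).
Variable mu : {sigma_finite_measure set T -> \bar R}.
Variables (n : nat) (D : set T) (rho : T -> T -> R) (M : R).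
Hypothesis adm : admissible mu n D rho M.

Let mD := adm_mD adm.
Let mDD : measurable (D `*` D). Proof. exact: measurableX. Qed.
Local Hint Resolve mD mDD : core.

Definition near_part (eta : R) (k : T -> T -> R) x y : R := if rho x y < eta then k x y else 0.
Definition far_part (eta : R) (k : T -> T -> R) x y : R := if rho x y < eta then 0 else k x y.

Let measurable_rho_lt eta : measurable_fun (D `*` D) (fun z => rho z.1 z.2 < eta).
Proof.
apply: measurable_fun_ltr; last exact: measurable_cst.
by apply: measurable_funTS; exact: measurable_rho adm.
Qed.

Lemma mkernel_near eta k : mkernel D k -> mkernel D (near_part eta k).
Proof.
move=> [mk k0]; split; last by move=> x y; rewrite /near_part; case: ifP.
by apply: measurable_fun_if => //; apply: measurable_funS mk => // z [].
Qed.

Lemma mkernel_far eta k : mkernel D k -> mkernel D (far_part eta k).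
Proof.
move=> [mk k0]; split; last by move=> x y; rewrite /far_part; case: ifP.
by apply: measurable_fun_if => //; apply: measurable_funS mk => // z [].
Qed.

Lemma kform_near_far eta k (u : T -> R) : mkernel D k -> measurable_fun D u ->
  kform mu D k u = (kform mu D (near_part eta k) u + kform mu D (far_part eta k) u)%E.
Proof.
move=> mk mu_; rewrite -(kformD adm)//; [|exact: mkernel_near|exact: mkernel_far].
apply: eq_integral => z _; congr (_ * _)%:E.
by rewrite /near_part /far_part; case: ifP; rewrite ?addr0 ?add0r.
Qed.

Lemma near_part_le eta k x y : 0 <= k x y -> near_part eta k x y <= k x y.
Proof. by rewrite /near_part; case: ifP. Qed.

Lemma kform_near_le eta k (u : T -> R) : mkernel D k -> measurable_fun D u ->
  (kform mu D (near_part eta k) u <= kform mu D k u)%E.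
Proof.
move=> mk mu_; apply: (le_kform adm) => //; first exact: mkernel_near.
by move=> x y _ _; rewrite ler_wpM2l ?sqr_ge0// near_part_le// mk.2.
Qed.

(** Dominated convergence along [eta = 1 / (m + 1)]: off the diagonal the integrand is eventually 0,
    and on the diagonal it always is. *)
Lemma kform_near_small k (u : T -> R) eps : mkernel D k -> measurable_fun D u ->
  (kform mu D k u < +oo)%E -> 0 < eps ->
  exists2 eta, 0 < eta & (kform mu D (near_part eta k) u <= eps%:E)%E.
Proof.
move=> mk mu_ fin eps0.
pose f_ m (z : T * T) := ((u z.1 - u z.2) ^+ 2 * near_part (m.+1%:R^-1) k z.1 z.2)%:E.
have mf m : measurable_fun (D `*` D) (f_ m).
  by apply: (measurable_kformE adm) => //; exact: mkernel_near.
have ig : (pmeasure mu mu).-integrable (D `*` D)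
    (fun z => ((u z.1 - u z.2) ^+ 2 * k z.1 z.2)%:E).
  apply/integrableP; split; first exact: (measurable_kformE adm).
  rewrite (eq_integral (fun z => ((u z.1 - u z.2) ^+ 2 * k z.1 z.2)%:E))// => z _.
  by rewrite gee0_abs// lee_fin mulr_ge0 ?sqr_ge0 ?mk.2.
have [] := @dominated_convergence _ _ _ (pmeasure mu mu) (D `*` D) mDD f_ (cst 0%E)
   (fun z => ((u z.1 - u z.2) ^+ 2 * k z.1 z.2)%:E) mf (measurable_cst _) _ ig _.
- apply: aeW => -[x y] /= _.
  have [->|xy] := eqVneq x y.
    rewrite (_ : f_ ^~ (y, y) = (fun=> 0%E)); first exact: cvg_cst.
    by apply/funext => m; rewrite /f_ /= subrr expr0n mul0r.
  have r0 := rho_gt0 adm xy.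
  apply: cvg_near_cst; near=> m; rewrite /f_ /near_part /= ltNge.
  rewrite (_ : _ <= _) ?mulr0//; apply: ltW.
  by near: m; exact: near_infty_natSinv_lt (PosNum r0).
- apply: aeW => z /= m _; have nk := (mkernel_near m.+1%:R^-1 mk).2 z.1 z.2.
  rewrite lee_fin (ger0_norm (mulr_ge0 (sqr_ge0 _) nk)).
  by rewrite ler_wpM2l ?sqr_ge0// near_part_le// mk.2.
move=> _ _; rewrite integral0_eq// => /fine_cvgP[_].
move=> /cvgrPdist_lt/(_ _ eps0) [N _ HN].
have := HN N (leqnn N); rewrite /= sub0r normrN => h.
exists N.+1%:R^-1; first by rewrite invr_gt0.
have g0 : (0 <= kform mu D (near_part N.+1%:R^-1 k) u)%E.
  by apply: kform_ge0; exact: mkernel_near.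
have gfin : kform mu D (near_part N.+1%:R^-1 k) u \is a fin_num.
  rewrite ge0_fin_numE//; apply: le_lt_trans fin.
  exact: kform_near_le.
rewrite -(fineK gfin) lee_fin; apply: ltW; apply: le_lt_trans h.
exact: ler_norm.
Unshelve. all: by end_near. Qed.

(* (w x - w y)^2 <= 2 (w x)^2 + 2 (w y)^2, and the two terms have the same
   integral by symmetry. *)
Lemma kform_le_deg k (w : T -> R) : mkernel D k -> (forall x y, k x y = k y x) ->
  measurable_fun D w ->
  (kform mu D k w <= 4%:E *
     \int[mu]_(x in D) \int[mu]_(y in D) (k x y * w x ^+ 2)%:E)%E.
Proof.
move=> mk ksym mw.
have mkw1 : measurable_fun (D `*` D) (fun z => (k z.1 z.2 * w z.1 ^+ 2)%:E).
  apply/measurable_EFinP/measurable_funM; first exact: mk.1.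
  by apply: measurable_funX; exact: measurable_fstD.
have mkw2 : measurable_fun (D `*` D) (fun z => (k z.1 z.2 * w z.2 ^+ 2)%:E).
  apply/measurable_EFinP/measurable_funM; first exact: mk.1.
  by apply: measurable_funX; exact: measurable_sndD.
have kw10 z : (0 <= (k z.1 z.2 * w z.1 ^+ 2)%:E)%E by rewrite lee_fin mulr_ge0 ?sqr_ge0 ?mk.2.
have kw20 z : (0 <= (k z.1 z.2 * w z.2 ^+ 2)%:E)%E by rewrite lee_fin mulr_ge0 ?sqr_ge0 ?mk.2.
have E1 := fubini_on1 mu mD mkw1 (fun z _ => kw10 z).
have E2 := fubini_on2 mu mD mkw2 (fun z _ => kw20 z).
set I := (\int[mu]_(x in D) _)%E.
have {}E2 : (\int[pmeasure mu mu]_(z in D `*` D) (k z.1 z.2 * w z.2 ^+ 2)%:E = I)%E.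
  rewrite E2; apply: eq_integral => y _; apply: eq_integral => x _ /=.
  by rewrite ksym.
apply: (@le_trans _ _ (\int[pmeasure mu mu]_(z in D `*` D)
   (2%:E * (k z.1 z.2 * w z.1 ^+ 2)%:E + 2%:E * (k z.1 z.2 * w z.2 ^+ 2)%:E))%E).
  apply: ge0_le_integral => //.
  - by move=> z _; rewrite lee_fin mulr_ge0 ?sqr_ge0 ?mk.2.
  - exact: (measurable_kformE adm).
  - by apply: emeasurable_funD; apply: measurable_funeM.
  - move=> z _; rewrite -!EFinM -EFinD lee_fin.
    have := mk.2 z.1 z.2; move: (k z.1 z.2) => c c0.
    have h : (w z.1 - w z.2) ^+ 2 <= 2 * w z.1 ^+ 2 + 2 * w z.2 ^+ 2.
      have := sqr_ge0 (w z.1 + w z.2); lra.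
    apply: (le_trans (ler_wpM2r c0 h)).
    by rewrite le_eqVlt; apply/orP; left; apply/eqP; ring.
rewrite ge0_integralD//; last 4 first.
- by move=> z _; rewrite mule_ge0.
- exact: measurable_funeM.
- by move=> z _; rewrite mule_ge0.
- exact: measurable_funeM.
rewrite !ge0_integralZl// E1 E2 -/I -ge0_muleDl//.
by rewrite -EFinD -natrD.
Qed.

Lemma kform_bounded k c (w : T -> R) : mkernel D k -> sqint mu D w -> 0 <= c ->
  (forall x y, D x -> D y -> k x y <= c) ->
  (kform mu D k w <= (4 * c * fine (mu D))%:E * \int[mu]_(x in D) (w x ^+ 2)%:E)%E.
Proof.
move=> mk sw c0 kc.
have mc : mkernel D (fun _ _ => c) by split => // ; exact: measurable_cst.
apply: (@le_trans _ _ (kform mu D (fun _ _ => c) w)).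
  apply: (le_kform adm) => //; [exact: sw.1|exact: sw.1|].
  by move=> x y Dx Dy; rewrite ler_wpM2l ?sqr_ge0 ?kc.
apply: (le_trans (kform_le_deg mc _ sw.1)) => //.
have mw2 : measurable_fun D (fun x => (w x ^+ 2)%:E).
  by apply/measurable_EFinP/measurable_funX; case: sw.
have w20 x : (0 <= (w x ^+ 2)%:E)%E by rewrite lee_fin sqr_ge0.
rewrite (eq_integral (fun x => (c * fine (mu D))%:E * (w x ^+ 2)%:E)%E); last first.
  move=> x _; rewrite (eq_integral (cst (c * w x ^+ 2)%:E))// integral_cst//.
  have muE : mu D = (fine (mu D))%:E by rewrite fineK// ge0_fin_numE ?(adm_lty adm).
  transitivity ((c * w x ^+ 2)%:E * (fine (mu D))%:E)%E; first by congr (_ * _)%E.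
  by rewrite -!EFinM; congr EFin; ring.
rewrite ge0_integralZl//; last by rewrite lee_fin mulr_ge0// fine_ge0.
by rewrite muleA -EFinM mulrA.
Qed.

Section fixed_delta.
Variable delta : R.
Hypothesis d0 : 0 < delta.
Local Notation K := (tker n rho delta).
Local Notation kdeg := (kdeg mu n D rho delta).
Local Notation kmean := (kmean mu n D rho delta).
Local Notation kenergy := (kenergy mu n D rho delta).

Let mK := mkernel_tker adm d0.

Lemma tkerC x y : K x y = K y x.
Proof. by rewrite /tker (rhoC adm). Qed.

(** For [w = kmean u - u] the integrand on the right is the quantity that [kmean_near_far]
    bounds. *)
Lemma kform_tker_le_deg (w : T -> R) : measurable_fun D w ->
  (kform mu D K w <= 4%:E * \int[mu]_(x in D) (kdeg x * w x ^+ 2)%:E)%E.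
Proof.
move=> mw; apply: (le_trans (kform_le_deg mK tkerC mw)).
rewrite le_eqVlt; apply/orP; left; apply/eqP; congr (_ * _)%E.
apply: eq_integral => x _.
under eq_integral do rewrite mulrC EFinM.
rewrite ge0_integralZl_EFin ?sqr_ge0//.
- by rewrite EFinM muleC; congr (_ * _)%E; rewrite Rintegral_fineK//; exact: (tker_integrable adm).
- by move=> y _; rewrite lee_fin tker_ge0.
- by apply/measurable_EFinP; exact: (measurable_tker1 adm).
Qed.

Lemma measurable_near_tker eta x : measurable_fun D (near_part eta K x).
Proof.
apply: measurable_fun_if => //.
- by apply: measurable_fun_ltr; [exact: (measurable_rho1 adm)|exact: measurable_cst].
- apply: (measurable_funS _ _ (measurable_tker1 adm d0 x)) => //.
Qed.

Let mfar eta x : measurable_fun D (far_part eta K x).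
Proof.
apply: measurable_fun_if => //.
- by apply: measurable_fun_ltr; [exact: (measurable_rho1 adm)|exact: measurable_cst].
- apply: (measurable_funS _ _ (measurable_tker1 adm d0 x)) => //.
Qed.

(* kdeg (u - kmean u) is the K-weighted integral of u x - u y; the part near the
   diagonal is bounded by the near energy, the far part carries the factor 1/A. *)
Lemma kmean_near_far (u : T -> R) eta A x : sqint mu D u -> 0 < eta -> delta <= eta -> 0 < A ->
  A <= kdeg x -> D x ->
  kdeg x * (u x - kmean u x) ^+ 2 <=
  2 * \int[mu]_(y in D) ((u x - u y) ^+ 2 * near_part eta K x y) +
  2 * (eta ^- n.+1 * fine (mu D) / A) * kenergy u x.
Proof.
move=> su eta0 deta A0 Ak Dx; have k0 := kdeg_gt0 adm d0 Dx.
pose g y := u x - u y.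
have sg : sqint mu D g := sqint_subc adm su (u x).
have ig := sqint_L1 adm sg.
have ig2 := sqint_integrable sg.
have dom (k : T -> R) (f : T -> R) : measurable_fun D k -> (forall y, D y -> 0 <= k y <= K x y) ->
    mu.-integrable D (EFin \o f) -> mu.-integrable D (EFin \o (fun y => k y * f y)).
  move=> mk kK intf; apply: (@le_integrable_EFin _ _ _ _ _ mD _ (fun y => K x y * `|f y|)).
  - by apply: measurable_funM => //; exact/measurable_EFinP/(measurable_int mu).
  - move=> y Dy; have /andP[k1 k2] := kK y Dy.
    by rewrite normrM ger0_norm// ler_wpM2r.
  - by apply: (tker_integrableM adm) => //; exact: integrable_norm.
have nK y : D y -> 0 <= near_part eta K x y <= K x y.
  by move=> _; rewrite near_part_le ?tker_ge0// andbT (mkernel_near _ mK).2.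
have fK y : D y -> 0 <= far_part eta K x y <= K x y.
  move=> _; rewrite (mkernel_far _ mK).2 /=.
  by rewrite /far_part; case: ifP; rewrite ?tker_ge0.
have i1 := integrable_cst adm 1.
have near1 := dom _ _ (measurable_near_tker eta x) nK i1; have far1 := dom _ _ (mfar eta x) fK i1.
have nearg := dom _ _ (measurable_near_tker eta x) nK ig; have farg := dom _ _ (mfar eta x) fK ig.
have nearg2 := dom _ _ (measurable_near_tker eta x) nK ig2; have farg2 := dom _ _ (mfar eta x) fK ig2.
have {}near1 : mu.-integrable D (EFin \o near_part eta K x).
  by apply: eq_integrable near1 => // y _ /=; rewrite mulr1.
have {}far1 : mu.-integrable D (EFin \o far_part eta K x).
  by apply: eq_integrable far1 => // y _ /=; rewrite mulr1.
have CSn := weighted_cauchy_schwarz mD (fun y Dy => proj1 (andP (nK y Dy))) near1 nearg nearg2.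
have CSf := weighted_cauchy_schwarz mD (fun y Dy => proj1 (andP (fK y Dy))) far1 farg farg2.
have kg2 : mu.-integrable D (EFin \o (fun y => K x y * g y ^+ 2)).
  by apply: (tker_integrableM adm).
have n1 : \int[mu]_(y in D) near_part eta K x y <= kdeg x.
  apply: le_Rintegral => //; first exact: (tker_integrable adm).
  by move=> y Dy; have /andP[] := nK y Dy.
(* Unlike the near part, the far part has a total weight bounded independently of [delta]. *)
have f1 : \int[mu]_(y in D) far_part eta K x y <= eta ^- n.+1 * fine (mu D).
  rewrite -Rintegral_cst//; apply: le_Rintegral => //; first exact: (integrable_cst adm).
  move=> y Dy; rewrite /far_part; case: ltP => // ry.
    by rewrite invr_ge0 exprn_ge0// ltW.
  rewrite /tker lef_pV2 ?posrE ?exprn_gt0 ?lt_max ?d0 ?orbT//.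
  apply: lerXn2r; rewrite ?nnegrE ?le_max ?ry ?(ltW d0) ?orbT// ?(ltW eta0)//.
set N1 := \int[mu]_(y in D) near_part eta K x y in CSn n1.
set F1 := \int[mu]_(y in D) far_part eta K x y in CSf f1.
have G2 : \int[mu]_(y in D) (far_part eta K x y * g y ^+ 2) <= kenergy u x.
  apply: le_Rintegral => // y Dy; have /andP[_ h] := fK y Dy.
  by rewrite ler_wpM2r ?sqr_ge0.
have E : kdeg x * (u x - kmean u x) = \int[mu]_(y in D) (near_part eta K x y * g y) +
    \int[mu]_(y in D) (far_part eta K x y * g y).
  rewrite (kmean_sub adm d0 su Dx) -RintegralD//; apply: eq_Rintegral => y _.
  by rewrite /near_part /far_part; case: ifP => _; rewrite mul0r ?addr0 ?add0r.
have -> : \int[mu]_(y in D) ((u x - u y) ^+ 2 * near_part eta K x y) =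
  \int[mu]_(y in D) (near_part eta K x y * g y ^+ 2).
  by apply: eq_Rintegral => y _; rewrite mulrC.
set n2 := \int[mu]_(y in D) (near_part eta K x y * g y ^+ 2) in CSn *.
set f2 := \int[mu]_(y in D) (far_part eta K x y * g y ^+ 2) in CSf G2.
set a := \int[mu]_(y in D) (near_part eta K x y * g y) in CSn E.
set b := \int[mu]_(y in D) (far_part eta K x y * g y) in CSf E.
have n20 : 0 <= n2.
  apply: Rintegral_ge0 => y Dy; have /andP[h _] := nK y Dy.
  by rewrite mulr_ge0 ?sqr_ge0.
have f20 : 0 <= f2.
  apply: Rintegral_ge0 => y Dy; have /andP[h _] := fK y Dy.
  by rewrite mulr_ge0 ?sqr_ge0.
have F10 : 0 <= F1.
  by apply: Rintegral_ge0 => y Dy; have /andP[] := fK y Dy.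
set c := eta ^- n.+1 * fine (mu D) in f1 *.
have c0 : 0 <= c := le_trans F10 f1.
have a2 : a ^+ 2 <= kdeg x * n2 by apply: (le_trans CSn); rewrite ler_wpM2r.
have b2 : b ^+ 2 <= c * kenergy u x.
  by apply: (le_trans CSf); apply: ler_pM.
rewrite -(ler_pM2l k0).
have -> : kdeg x * (kdeg x * (u x - kmean u x) ^+ 2) = (kdeg x * (u x - kmean u x)) ^+ 2 by ring.
rewrite E.
apply: (@le_trans _ _ (2 * a ^+ 2 + 2 * b ^+ 2)); first by have := sqr_ge0 (a - b); lra.
apply: (@le_trans _ _ (2 * (kdeg x * n2) + 2 * (c * kenergy u x))); first by lra.
rewrite mulrDr; apply: lerD; first by rewrite mulrCA.
(* The far term was estimated without a factor [kdeg x]; as [kdeg x / A >= 1], one is inserted at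
   the price of [1 / A]. *)
have -> : kdeg x * (2 * (c / A) * kenergy u x) = 2 * (c * kenergy u x) * (kdeg x / A) by ring.
rewrite ler_peMr//; last by rewrite ler_pdivlMr// mul1r.
by rewrite mulr_ge0// mulr_ge0//; exact: kenergy_ge0.
Qed.

End fixed_delta.
End density.

Lemma powR_small_exponent (R : realType) (b e : R) : 1 <= b -> 0 < e ->
  exists2 s0, 0 < s0 & forall s, 0 <= s -> s <= s0 -> b `^ (2 * s) <= 1 + e.
Proof.
move=> b1 e0; have lb0 : 0 <= ln b by exact: ln_ge0.
have le0 : 0 < ln (1 + e) by apply: ln_gt0; rewrite ltrDl.
have b0 : 0 < b by apply: lt_le_trans b1.
have e10 : 0 < 1 + e by rewrite addr_gt0.
have c0 : 0 < 2 * ln b + 1 by rewrite ltr_wpDl ?mulr_ge0.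
(* The power is [exp (2 s ln b)]. The [+ 1] keeps the denominator positive when [b = 1]. *)
exists (ln (1 + e) / (2 * ln b + 1)); first by rewrite divr_gt0.
move=> s s0 hs; rewrite /powR gt_eqF// -[leRHS]lnK ?posrE// ler_expR.
have h : s * (2 * ln b + 1) <= ln (1 + e) by rewrite -ler_pdivlMr.
nra.
Qed.

(** * Density of H^(1/2) in H^0 *)

Section smooth_approximation.
Context d (T : measurableType d) (R : realType).
Variable mu : {sigma_finite_measure set T -> \bar R}.
Variables (n : nat) (D : set T) (rho : T -> T -> R) (M : R).
Hypothesis adm : admissible mu n D rho M.

Let mD := adm_mD adm.
Let mDD : measurable (D `*` D). Proof. exact: measurableX. Qed.
Local Hint Resolve mD mDD : core.

Local Notation fker := (fker n rho).
Local Notation kform := (kform mu D).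
Local Notation tker := (tker n rho).
Local Notation kdeg := (kdeg mu n D rho).
Local Notation kmean := (kmean mu n D rho).
Local Notation kenergy := (kenergy mu n D rho).
Local Notation near := (near_part rho).
Local Notation far := (far_part rho).

Let mfker s : mkernel D (fker s). Proof. exact: (mkernel_fker adm). Qed.
Local Hint Resolve mfker : core.

(** The factor [delta] absorbs the order [1 / delta] of the constant in [kmean_near_form]. *)
Lemma near_fker_half_le delta x y : 0 <= near delta (fker 0) x y <= delta * near delta (fker 2^-1) x y.
Proof.
rewrite /near_part; case: ifP => xd; last by rewrite mulr0 lexx.
have [->|xy] := eqVneq x y.
  by rewrite !(fkerxx adm)// ?invr_ge0// mulr0 lexx.
have r0 := rho_gt0 adm xy.
rewrite (fker0E adm) (fker_halfE adm) invr_ge0 exprn_ge0 ?(ltW r0)//=.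
rewrite [_ ^+ n.+2]exprS invfM mulrA ler_peMl ?invr_ge0 ?exprn_ge0 ?(ltW r0)//.
by rewrite ler_pdivlMr// mul1r ltW.
Qed.

(** By [kmean_lip] the squared difference carries [rho^2], which lowers the kernel [rho ^- n.+2] to
    the integrable [rho ^- n]. As [klipC] is of order [delta^-2], the constant is of order
    [1 / (delta A)]. *)
Lemma kmean_near_form C delta A (u : T -> R) :
  (forall (t : R) x, 0 < t -> D x ->
    (\int[mu]_(y in D `&` [set y | (rho x y < t)%R]) (rho x y ^- n)%:E <= (C * t)%:E)%E) ->
  0 < delta -> 0 < A -> (forall x, D x -> A <= kdeg delta x) -> sqint mu D u ->
  (kform (near delta (fker 2^-1)) (kmean delta u) <=
   (klipC n delta * C * delta / A)%:E * kform (tker delta) u)%E.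
Proof.
move=> HC d0 A0 Ak su.
have mv : measurable_fun D (kmean delta u) by exact: (measurable_kmean adm).
have mnk : mkernel D (near delta (fker 2^-1)) by exact: (mkernel_near adm).
rewrite (kform_fubini adm)// -(kenergy_form adm)//.
have mG := measurable_kenergy adm d0 su.
have G0 x : 0 <= kenergy delta u x by exact: kenergy_ge0.
(* [C] comes without a sign; [HC] at a point of [D] supplies it, and [D] has a point because its
   measure is positive. *)
have c0 x : D x -> 0 <= klipC n delta * C * delta / A.
  move=> Dx; rewrite divr_ge0 ?(ltW A0)// -mulrA mulr_ge0 ?klipC_ge0//.
  rewrite -lee_fin; apply: le_trans (HC delta x d0 Dx).
  by apply: integral_ge0 => y _; rewrite lee_fin invr_ge0 exprn_ge0// (rho_ge0 adm).
have [x0 Dx0] : D !=set0.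
  apply/set0P/eqP => D0; have := adm_gt0 adm.
  have -> : mu D = mu set0 := congr1 (fun A => mu A) D0.
  by rewrite measure0 ltxx.
rewrite -ge0_integralZl_EFin//; [|by move=> x _; rewrite lee_fin|exact/measurable_EFinP|exact: (c0 x0)].
apply: ge0_le_integral => //.
- move=> x _; apply: integral_ge0 => y _.
  by rewrite lee_fin mulr_ge0 ?sqr_ge0 ?mnk.2.
- apply: (@measurable_fubini_on _ _ _ mu D mD
    (fun z => ((kmean delta u z.1 - kmean delta u z.2) ^+ 2 * near delta (fker 2^-1) z.1 z.2)%:E)).
    exact: (measurable_kformE adm).
  by move=> z _; rewrite lee_fin mulr_ge0 ?sqr_ge0 ?mnk.2.
- by apply: measurable_funeM; exact/measurable_EFinP.
move=> x Dx; have k0 := kdeg_gt0 adm d0 Dx.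
pose c := klipC n delta * (kenergy delta u x / kdeg delta x).
have cc0 : 0 <= c by rewrite mulr_ge0 ?klipC_ge0// divr_ge0// ltW.
have mrho : measurable_fun D (fun y => rho x y ^- n).
  apply: measurable_fun_inv_ge0; first by move=> y _; rewrite exprn_ge0// (rho_ge0 adm).
  by apply: measurable_funX; exact: (measurable_rho1 adm).
have mball : measurable [set y | (rho x y < delta)%R].
  have := measurableT_comp (measurable_rho adm) (pair1_measurable x).
  move=> /(_ measurableT _ (measurable_itv `]-oo, delta[)).
  rewrite setTI; congr measurable; apply/seteqP; split => y /=; rewrite in_itv//.
have mset : measurable (D `&` [set y | (rho x y < delta)%R]) by exact: measurableI.
apply: (@le_trans _ _ (\int[mu]_(y in D `&` [set y | (rho x y < delta)%R]) (c%:E * (rho x y ^- n)%:E))%E).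
  rewrite integral_mkcondr; apply: ge0_le_integral => //.
  - by move=> y _; rewrite lee_fin mulr_ge0 ?sqr_ge0 ?mnk.2.
  - apply/measurable_EFinP/measurable_funM.
      by apply: measurable_funX; apply: measurable_funB.
    apply: measurable_fun_if => //.
      by apply: measurable_fun_ltr; [exact: (measurable_rho1 adm)|exact: measurable_cst].
    apply: measurable_fun_inv_ge0; first by move=> y _; exact: powR_ge0.
    apply: (measurableT_comp (measurable_powR _)).
    by apply: (measurable_funS _ _ (measurable_rho1 adm x)).
  - apply/(measurable_restrict _ mball mD)/measurable_funeM/measurable_EFinP.
    by apply: (measurable_funS _ _ mrho).
  - move=> y Dy; rewrite /patch /near_part; have [xd|xd] := ltP (rho x y) delta; last first.
      by rewrite memNset ?mulr0//= ltNge xd.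
    rewrite mem_set// -EFinM lee_fin.
    have [->|xy] := eqVneq x y.
      by rewrite subrr expr0n mul0r mulr_ge0// invr_ge0 exprn_ge0// (rho_ge0 adm).
    have r0 := rho_gt0 adm xy.
    apply: le_trans (_ : klipC n delta * rho x y ^+ 2 * (kenergy delta u x / kdeg delta x) *
       fker 2^-1 x y <= _).
      rewrite ler_wpM2r ?fker_ge0//; apply: (kmean_lip adm) => //; exact: ltW.
    have rE : rho x y ^- n.+2 = rho x y ^- 2 * rho x y ^- n.
      by rewrite -invfM -exprD add2n.
    rewrite (fker_halfE adm) /c rE le_eqVlt; apply/orP; left; apply/eqP.
    by field; rewrite !gt_eqF ?exprn_gt0.
rewrite ge0_integralZl_EFin//; last 2 first.
- by move=> y _; rewrite lee_fin invr_ge0 exprn_ge0// (rho_ge0 adm).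
- by apply/measurable_EFinP; apply: (measurable_funS _ _ mrho).
apply: (@le_trans _ _ (c%:E * (C * delta)%:E)%E).
  by rewrite lee_wpmul2l// ?lee_fin// HC.
rewrite -!EFinM lee_fin /c.
have -> : klipC n delta * (kenergy delta u x / kdeg delta x) * (C * delta) =
  (klipC n delta * C * delta / A * kenergy delta u x) * (A / kdeg delta x).
  by field; rewrite !gt_eqF.
apply: ler_piMr; first exact: (mulr_ge0 (c0 x Dx) (G0 x)).
by rewrite ler_pdivrMr// mul1r Ak.
Qed.

Lemma kform_fker0_le s (u : T -> R) : 0 <= s -> measurable_fun D u ->
  (kform (fker 0) u <= (M `^ (2 * s))%:E * kform (fker s) u)%E.
Proof.
move=> s0 mu_; rewrite -(kformZ adm)//; last exact: powR_ge0.
apply: (le_kform adm) => //; first by apply: mkernelZ => //; exact: powR_ge0.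
by move=> x y Dx Dy; rewrite ler_wpM2l ?sqr_ge0// (fker0_le adm).
Qed.

Lemma kform_fker_le s (u : T -> R) : 0 <= s -> s <= 2^-1 -> measurable_fun D u ->
  (kform (fker s) u <= kform (fker 0) u + kform (fker 2^-1) u)%E.
Proof.
move=> s0 s1 mu_; rewrite -(kformD adm)//.
apply: (le_kform adm) => //; first exact: mkernelD.
by move=> x y Dx Dy; rewrite ler_wpM2l ?sqr_ge0// (fker_le adm).
Qed.

Lemma kform_half_lty s (u : T -> R) : 0 <= s -> s <= 2^-1 -> measurable_fun D u ->
  (kform (fker 2^-1) u < +oo)%E -> (kform (fker s) u < +oo)%E.
Proof.
move=> s0 s1 mu_ fin; apply: (le_lt_trans (kform_fker_le s0 s1 mu_)).
have h2 : (0 : R) <= 2^-1 by rewrite invr_ge0.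
apply: lte_add_pinfty; last exact: fin.
apply: (le_lt_trans (kform_fker0_le h2 mu_)).
by rewrite lte_mul_pinfty// lee_fin powR_ge0.
Qed.

(** Beyond [delta] the kernel of order 0 is [tker delta], so [kform_tker_le_deg] applies; its factor
    4 and the factors 2 of [kmean_near_far] make the 8s. Here [eta] stays fixed while [A] grows. *)
Lemma far_energy_kmean (delta eta A e F : R) (u : T -> R) : sqint mu D u -> 0 < delta ->
  delta <= eta -> 0 < A -> (forall x, D x -> A <= kdeg delta x) ->
  (kform (tker delta) u <= F%:E)%E -> (kform (near eta (fker 0)) u <= e%:E)%E ->
  (kform (far delta (fker 0)) (fun x => (kmean delta u x - u x)%R) <=
     (8 * e + 8 * (eta ^- n.+1 * fine (mu D) / A * F))%:E)%E.
Proof.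
move=> su d0 deta A0 Ak ktF Heta; have mu_ := su.1.
have eta0 : 0 < eta by apply: lt_le_trans deta.
have mv : measurable_fun D (kmean delta u) by exact: (measurable_kmean adm).
have mvu : measurable_fun D (fun x => kmean delta u x - u x) by exact: measurable_funB.
have mK := mkernel_tker adm d0.
have mnK : mkernel D (near eta (tker delta)) by exact: (mkernel_near adm).
set c := eta ^- n.+1 * fine (mu D) / A.
have c0 : 0 <= c.
  by rewrite divr_ge0 ?(ltW A0)// mulr_ge0 ?fine_ge0// invr_ge0 exprn_ge0// ltW.
apply: (@le_trans _ _ (kform (tker delta) (fun x => (kmean delta u x - u x)%R))).
  apply: (le_kform adm) => //; first exact: (mkernel_far adm).
  move=> x y _ _; rewrite ler_wpM2l ?sqr_ge0// /far_part.
  case: ltP => xd; first exact: tker_ge0.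
  by rewrite (fker0E adm) /tker (max_idPl xd).
apply: (le_trans (kform_tker_le_deg adm d0 mvu)).
have mG := measurable_kenergy adm d0 su.
have inear x : D x -> mu.-integrable D (EFin \o (fun y => (u x - u y) ^+ 2 * near eta (tker delta) x y)).
  move=> Dx; apply: (le_integrable_EFin mD _ _ (kenergy_integrable adm d0 su x (u x))).
    apply: measurable_funM; last exact: (measurable_near_tker adm).
    by apply: measurable_funX; apply: measurable_funB.
  move=> y Dy; rewrite (ger0_norm (mulr_ge0 (sqr_ge0 _) (mnK.2 x y))).
  by rewrite mulrC ler_wpM2r ?sqr_ge0// near_part_le// tker_ge0.
have mnear : measurable_fun D (fun x => \int[mu]_(y in D) ((u x - u y) ^+ 2 * near eta (tker delta) x y)).
  apply: (@measurable_Rintegral_section _ _ _ mu n D rho M adm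
    (fun z => (u z.1 - u z.2) ^+ 2 * near eta (tker delta) z.1 z.2)) => //.
  - exact: (measurable_kform adm).
  - by move=> z _; exact: (mulr_ge0 (sqr_ge0 _) (mnK.2 _ _)).
have n0 : forall x, 0 <= \int[mu]_(y in D) ((u x - u y) ^+ 2 * near eta (tker delta) x y).
  by move=> x; apply: Rintegral_ge0 => y _; rewrite mulr_ge0 ?sqr_ge0 ?mnK.2.
have G0 x : 0 <= kenergy delta u x by exact: kenergy_ge0.
have nearE : (\int[mu]_(x in D) (\int[mu]_(y in D)
   ((u x - u y) ^+ 2 * near eta (tker delta) x y)%R)%:E <= e%:E)%E.
  apply: le_trans Heta.
  apply: (@le_trans _ _ (kform (near eta (tker delta)) u)).
    rewrite (kform_fubini adm)// le_eqVlt; apply/orP; left; apply/eqP.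
    by apply: eq_integral => x /set_mem Dx; rewrite -Rintegral_fineK//; exact: inear.
  apply: (le_kform adm) => //; first exact: (mkernel_near adm).
  move=> x y _ _; rewrite /near_part; case: ifP => _; last by rewrite mulr0.
  exact: (tker_le_fker0 adm).
have c20 : 0 <= 2 * c by exact: mulr_ge0.
have -> : 8 * e + 8 * (c * F) = 4 * (2 * e + 2 * c * F) by ring.
rewrite EFinM lee_wpmul2l//.
apply: (@le_trans _ _ (\int[mu]_(x in D) (2%:E * (\int[mu]_(y in D)
   ((u x - u y) ^+ 2 * near eta (tker delta) x y)%R)%:E + (2 * c)%:E * (kenergy delta u x)%:E))%E).
  apply: ge0_le_integral => //.
  - by move=> x Dx; rewrite lee_fin mulr_ge0 ?sqr_ge0// ltW// (kdeg_gt0 adm).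
  - apply/measurable_EFinP/measurable_funM; first exact: (measurable_kdeg adm).
    exact: measurable_funX.
  - by apply: emeasurable_funD; apply: measurable_funeM; exact/measurable_EFinP.
  - move=> x Dx; rewrite -!EFinM -EFinD lee_fin -sqrrN opprB.
    exact: (kmean_near_far adm d0 su eta0 deta A0 (Ak x Dx) Dx).
rewrite ge0_integralD//; last 4 first.
- by move=> x _; rewrite -EFinM lee_fin mulr_ge0.
- by apply: measurable_funeM; exact/measurable_EFinP.
- by move=> x _; rewrite -EFinM lee_fin mulr_ge0// mulr_ge0.
- by apply: measurable_funeM; exact/measurable_EFinP.
rewrite !ge0_integralZl_EFin//; [|by move=> x _; rewrite lee_fin|exact/measurable_EFinP
  |by move=> x _; rewrite lee_fin|exact/measurable_EFinP].
have -> : (2 * e + 2 * c * F)%:E = (2%:E * e%:E + (2 * c)%:E * F%:E)%E.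
  by rewrite -!EFinM -EFinD.
by rewrite (kenergy_form adm)// leeD// lee_wpmul2l// lee_fin.
Qed.

Lemma smooth_approximation (u : T -> R) eps : sqint mu D u ->
  (kform (fker 0) u < +oo)%E -> 0 < eps ->
  exists v, [/\ sqint mu D v, (kform (fker 2^-1) v < +oo)%E,
    (kform (fker 0) (fun x => (v x - u x)%R) <= eps%:E)%E &
    (\int[mu]_(x in D) ((u x - v x) ^+ 2)%:E <= eps%:E)%E].
Proof.
move=> su fin eps0; have mu_ := su.1.
have F0 : (0 <= kform (fker 0) u)%E by exact: kform_ge0.
pose F := fine (kform (fker 0) u).
have FE : kform (fker 0) u = F%:E by rewrite fineK// ge0_fin_numE.
have F0' : 0 <= F by exact: fine_ge0.
have [C HC] := rho_pow_int adm.
(* In the end this quantity is counted 2 + 8 times, which uses up [eps / 2]. *)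
have e20 : 0 < eps / 20 by rewrite divr_gt0.
have [eta eta0 Heta] := kform_near_small adm (mfker 0) mu_ fin e20.
(* [Q] is [delta^2] times [klipC n delta]: the part of that constant that does not depend on
   [delta]. *)
pose Q := (n.+1%:R * 2 ^+ n.+1 * (1 + 2 ^+ n.+1 * 2 ^+ n.+1)) ^+ 2 : R.
pose m := fine (mu D).
(* [E0] collects the coefficients of [F / A]. The absolute value is there because [C] has no sign
   yet, the [+ 1] so that [F / A] itself is also controlled. *)
pose E0 := `|2 * (Q * C)| + 8 * (eta ^- n.+1 * m) + 1.
have m0 : 0 < m := fine_muD_gt0 adm.
have em0 : 0 <= eta ^- n.+1 * m by rewrite mulr_ge0 ?invr_ge0 ?exprn_ge0// ltW.
have E01 : 1 <= E0.
  by rewrite /E0 lerDr addr_ge0// mulr_ge0.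
have E00 : 0 < E0 by apply: lt_le_trans E01.
pose A := 1 + 2 * E0 * F / eps.
have A0 : 0 < A by rewrite ltr_wpDr// !mulr_ge0 ?invr_ge0// ltW.
have AF : E0 * F / A <= eps / 2.
  rewrite ler_pdivrMr// /A mulrDr mulr1.
  have -> : eps / 2 * (2 * E0 * F / eps) = E0 * F by field; rewrite gt_eqF.
  by rewrite lerDr divr_ge0// ltW.
have [d1 d10 Hd] := tker_unbounded adm A.
pose delta := Num.min eta d1.
have d0 : 0 < delta by rewrite lt_min eta0.
have deta : delta <= eta by rewrite ge_min lexx.
have Ak x : D x -> A <= kdeg delta x.
  by move=> Dx; apply: Hd => //; rewrite ge_min lexx orbT.
pose v := kmean delta u.
have mv : measurable_fun D v by exact: (measurable_kmean adm).
have ktF : (kform (tker delta) u <= F%:E)%E by rewrite -FE; exact: (form_tker_le adm).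
have meanv : (\int[mu]_(x in D) ((u x - v x) ^+ 2)%:E <= (F / A)%:E)%E.
  have := le_trans (kmean_mean_sq adm d0 su A0 Ak) ktF.
  by rewrite muleC EFinM lee_pdivlMr.
have suv : sqint mu D (fun x => u x - v x).
  split; first exact: measurable_funB.
  by apply: le_lt_trans meanv _; rewrite ltry.
have sv : sqint mu D v.
  by apply: sqint_ext (sqintB mD su suv) => x _; rewrite subKr.
have FA : F / A <= eps.
  have : F / A <= E0 * F / A.
    by rewrite ler_wpM2r ?invr_ge0 ?(ltW A0)// ler_peMl.
  lra.
have near1 := kmean_near_form HC d0 A0 Ak su.
have c0 : 0 <= klipC n delta * C * delta / A.
  have [x0 Dx0] : D !=set0.
    apply/set0P/eqP => D0; have := adm_gt0 adm.
    have -> : mu D = mu set0 := congr1 (fun A => mu A) D0.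
    by rewrite measure0 ltxx.
  rewrite divr_ge0 ?(ltW A0)// -mulrA mulr_ge0 ?klipC_ge0//.
  rewrite -lee_fin; apply: le_trans (HC delta x0 d0 Dx0).
  by apply: integral_ge0 => y _; rewrite lee_fin invr_ge0 exprn_ge0// (rho_ge0 adm).
have near2 : (kform (near delta (fker 2^-1)) v <= (klipC n delta * C * delta / A * F)%:E)%E.
  by apply: (le_trans near1); rewrite [leRHS]EFinM lee_wpmul2l// lee_fin.
exists v; split; first exact: sv.
- rewrite (kform_near_far adm delta)//.
  apply: lte_add_pinfty; first by apply: (le_lt_trans near2); rewrite ltry.
  apply: (@le_lt_trans _ _ ((4 * delta ^- n.+2 * fine (mu D))%:E * \int[mu]_(x in D) (v x ^+ 2)%:E)%E).
    apply: (kform_bounded adm) => //; first exact: (mkernel_far adm).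
      by rewrite invr_ge0 exprn_ge0// ltW.
    move=> x y _ _; rewrite /far_part; case: ltP => xd.
      by rewrite invr_ge0 exprn_ge0// ltW.
    rewrite (fker_halfE adm) lef_pV2 ?posrE ?exprn_gt0// ?(lt_le_trans d0)//.
    by apply: lerXn2r => //; rewrite nnegrE ?(rho_ge0 adm)// ltW.
  rewrite lte_mul_pinfty ?sv.2// lee_fin !mulr_ge0// ?(ltW m0)//.
  by rewrite invr_ge0 exprn_ge0// ltW.
- have mvu : measurable_fun D (fun x => v x - u x) by exact: measurable_funB.
  rewrite (kform_near_far adm delta)//.
  have Ndelta : (kform (near delta (fker 0)) v <= (Q * C * F / A)%:E)%E.
    apply: (@le_trans _ _ (delta%:E * kform (near delta (fker 2^-1)) v)%E).
      rewrite -(kformZ adm)//; [|exact: ltW|exact: (mkernel_near adm)].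
      apply: (le_kform adm) => //; first exact: (mkernel_near adm).
        by apply: mkernelZ; [exact: ltW|exact: (mkernel_near adm)].
      move=> x y _ _; rewrite ler_wpM2l ?sqr_ge0//.
      by have /andP[] := near_fker_half_le delta x y.
    apply: (@le_trans _ _ (delta%:E * (klipC n delta * C * delta / A * F)%:E)%E).
      by rewrite lee_wpmul2l// lee_fin ltW.
    rewrite -EFinM lee_fin /klipC /klip /Q le_eqVlt; apply/orP; left; apply/eqP.
    by field; rewrite !gt_eqF.
  have Nu : (kform (near delta (fker 0)) u <= (eps / 20)%:E)%E.
    apply: le_trans Heta; apply: (le_kform adm) => //; [exact: (mkernel_near adm)..|].
    move=> x y _ _; rewrite ler_wpM2l ?sqr_ge0// /near_part.
    case: ifP => xd; last by case: ifP => // _; rewrite fker_ge0.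
    by rewrite (lt_le_trans xd).
  have near3 : (kform (near delta (fker 0)) (fun x => (v x - u x)%R) <=
      (2 * (Q * C * F / A) + 2 * (eps / 20))%:E)%E.
    apply: (le_trans (kformB_le adm _ mv mu_)); first exact: (mkernel_near adm).
    have -> : (2 * (Q * C * F / A) + 2 * (eps / 20))%:E =
      (2%:E * (Q * C * F / A)%:E + 2%:E * (eps / 20)%:E)%E by rewrite -!EFinM -EFinD.
    by rewrite leeD// lee_wpmul2l.
  have far1 : (kform (far delta (fker 0)) (fun x => (v x - u x)%R) <=
      (8 * (eps / 20) + 8 * (eta ^- n.+1 * m / A * F))%:E)%E.
    exact: far_energy_kmean.
  apply: (le_trans (leeD near3 far1)); rewrite -EFinD lee_fin.
  have h1 : 2 * (Q * C) <= `|2 * (Q * C)| by exact: ler_norm.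
  have h2 : 2 * (Q * C * F / A) + 8 * (eta ^- n.+1 * m / A * F) <= E0 * F / A.
    have -> : 2 * (Q * C * F / A) + 8 * (eta ^- n.+1 * m / A * F) =
      (2 * (Q * C) + 8 * (eta ^- n.+1 * m)) * (F / A) by ring.
    rewrite -[E0 * F / A]mulrA ler_wpM2r ?divr_ge0 ?(ltW A0)// /E0.
    lra.
  lra.
- by apply: (le_trans meanv); rewrite lee_fin.
Qed.

End smooth_approximation.

Lemma norm_le_geometric_eq0 (R : realType) (a C : R) :
  (forall j, `|a| <= C * (4^-1) ^+ j) -> a = 0.
Proof.
move=> H; apply/eqP; rewrite -normr_le0.
have cv : (fun j => C * (4^-1) ^+ j) @ \oo --> 0.
  rewrite -[X in _ --> X](mulr0 C); apply: cvgM; first exact: cvg_cst.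
  by apply: cvg_expr; rewrite ger0_norm; lra.
rewrite -(cvg_lim _ cv)//; apply: limr_ge; first by apply/cvg_ex; exists 0.
by near=> j; exact: H.
Unshelve. all: by end_near. Qed.

Lemma Rintegral_cauchy_schwarz d (T : measurableType d) (R : realType)
  (mu : {measure set T -> \bar R}) (D : set T) (f g : T -> R) : measurable D ->
  sqint mu D f -> sqint mu D g ->
  (\int[mu]_(x in D) (f x * g x)) ^+ 2 <=
  \int[mu]_(x in D) (f x ^+ 2) * \int[mu]_(x in D) (g x ^+ 2).
Proof.
move=> mD sf sg; apply: ge0_discriminant.
  by apply: Rintegral_ge0 => x _; exact: sqr_ge0.
move=> t; have := Rintegral_sqr_lin mD (- t) sg sf.
rewrite sqrrN mulrN mulNr => E.
under [\int[mu]_(x in D) (f x * g x)]eq_Rintegral do rewrite mulrC.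
by rewrite -E; apply: Rintegral_ge0 => x _; exact: sqr_ge0.
Qed.

(** * The forms as the order tends to 0, and under L^2 limits *)

Section lower_semicontinuity.
Context d (T : measurableType d) (R : realType).
Variable mu : {sigma_finite_measure set T -> \bar R}.
Variables (n : nat) (D : set T) (rho : T -> T -> R) (M : R).
Hypothesis adm : admissible mu n D rho M.

Let mD := adm_mD adm.
Let mDD : measurable (D `*` D). Proof. exact: measurableX. Qed.
Local Hint Resolve mD mDD : core.

Local Notation fker := (fker n rho).
Local Notation Q := (kform mu D).
Local Notation near := (near_part rho).

Let mfker s : mkernel D (fker s). Proof. exact: (mkernel_fker adm). Qed.
Local Hint Resolve mfker : core.

(** Within [eta <= 1] the kernel of order [s] is below that of order 1/2, whose near energy is
    small. Beyond [eta] it is at most [eta^(-2s)] times the kernel of order 0, and this factor tends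
    to 1. *)
Lemma kform_limsup (v : T -> R) eps : measurable_fun D v ->
  (Q (fker 2^-1) v < +oo)%E -> 0 < eps ->
  exists s0, [/\ 0 < s0, s0 <= 2^-1 & forall s, 0 <= s -> s <= s0 ->
    (Q (fker s) v <= Q (fker 0) v + eps%:E)%E].
Proof.
move=> mv fin eps0.
have h2 : (0 : R) <= 2^-1 by rewrite invr_ge0.
have fin0 : (Q (fker 0) v < +oo)%E by exact: (kform_half_lty adm).
have F0 : (0 <= Q (fker 0) v)%E by exact: kform_ge0.
pose F := fine (Q (fker 0) v).
have FE : Q (fker 0) v = F%:E by rewrite fineK// ge0_fin_numE.
have F0' : 0 <= F by exact: fine_ge0.
have e20 : 0 < eps / 2 by rewrite divr_gt0.
have [eta' eta'0 Heta'] := kform_near_small adm (mfker 2^-1) mv fin e20.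
pose eta := Num.min eta' 1.
have eta0 : 0 < eta by rewrite lt_min eta'0 ltr01.
have eta1 : eta <= 1 by rewrite ge_min lexx orbT.
have Heta : (Q (near eta (fker 2^-1)) v <= (eps / 2)%:E)%E.
  apply: le_trans Heta'; apply: (le_kform adm) => //; [exact: (mkernel_near adm)..|].
  move=> x y _ _; rewrite ler_wpM2l ?sqr_ge0// /near_part lt_min.
  by case: ifP => //=; case: ifP => //= _; rewrite fker_ge0.
have e10 : 0 < eps / 2 / (F + 1) by rewrite divr_gt0// ltr_wpDl.
have eta1' : 1 <= eta^-1 by rewrite invf_ge1.
have [s0 s00 Hs0] := powR_small_exponent eta1' e10.
exists (Num.min s0 2^-1); split; first by rewrite lt_min s00 invr_gt0 ltr0n.
  by rewrite ge_min lexx orbT.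
move=> s sge0; rewrite le_min => /andP[ss0 s1].
have b0 : 0 <= eta^-1 `^ (2 * s) by exact: powR_ge0.
apply: (@le_trans _ _ (Q (fun x y => eta^-1 `^ (2 * s) * fker 0 x y + near eta (fker 2^-1) x y) v)).
  apply: (le_kform adm) => //.
    by apply: mkernelD; [exact: mkernelZ|exact: (mkernel_near adm)].
  move=> x y _ _; rewrite ler_wpM2l ?sqr_ge0//.
  rewrite /near_part; case: ltP => xd.
    apply: (@le_trans _ _ (fker 2^-1 x y)); last by rewrite lerDr mulr_ge0 ?fker_ge0.
    by apply: (fker_le_half adm) => //; rewrite (le_trans (ltW xd)).
  by rewrite addr0; exact: (fker_far_le adm).
rewrite (kformD adm)//; [|exact: mkernelZ|exact: (mkernel_near adm)].
rewrite (kformZ adm)// FE -EFinM.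
apply: (@le_trans _ _ ((eta^-1 `^ (2 * s) * F)%:E + (eps / 2)%:E)%E); first exact: leeD2l.
rewrite -!EFinD lee_fin.
have h : eta^-1 `^ (2 * s) * F <= (1 + eps / 2 / (F + 1)) * F by rewrite ler_wpM2r// Hs0.
have : eps / 2 / (F + 1) * F <= eps / 2.
  by rewrite -mulrA ler_piMr ?(ltW e20)// mulrC ler_pdivrMr ?ltr_wpDl// mul1r lerDl.
lra.
Qed.

Lemma mkernel_min k (m : R) : mkernel D k -> 0 <= m -> mkernel D (fun x y => Num.min (k x y) m).
Proof.
move=> [mk k0] m0; split; first by apply: measurable_minr => //; exact: measurable_cst.
by move=> x y; rewrite le_min k0.
Qed.

(** Young's inequality with a free parameter: for small [t] the coefficient of the form of [u] is
    close to 1, whereas [kformB_le] would lose a factor 2. *)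
Lemma kform_weighted_triangle k t (u v : T -> R) : mkernel D k -> 0 < t ->
  measurable_fun D u -> measurable_fun D v ->
  (Q k v <= (1 + t)%:E * Q k u + (1 + t^-1)%:E * Q k (fun x => (u x - v x)%R))%E.
Proof.
move=> mk t0 mu_ mv.
have muv : measurable_fun D (fun x => u x - v x) by exact: measurable_funB.
have t1 : 0 <= 1 + t by rewrite addr_ge0// ltW.
have t2 : 0 <= 1 + t^-1 by rewrite addr_ge0// invr_ge0 ltW.
have fge0 (f : T -> R) z : (0 <= ((f z.1 - f z.2) ^+ 2 * k z.1 z.2)%:E)%E.
  by rewrite lee_fin; exact: (mulr_ge0 (sqr_ge0 _) (mk.2 _ _)).
have mf (f : T -> R) : measurable_fun D f ->
    measurable_fun (D `*` D) (fun z => ((f z.1 - f z.2) ^+ 2 * k z.1 z.2)%:E).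
  exact: (measurable_kformE adm).
rewrite /kform -!ge0_integralZl_EFin//;
  [|by move=> z _; exact: (fge0 (fun x => u x - v x))|exact: (mf _ muv)|exact: mf].
rewrite -ge0_integralD//; first last.
- by apply: measurable_funeM; exact: (mf _ muv).
- by move=> z _; rewrite mule_ge0//; exact: (fge0 (fun x => u x - v x)).
- by apply: measurable_funeM; exact: mf.
- by move=> z _; rewrite mule_ge0.
apply: ge0_le_integral => //; first exact: mf.
  by apply: emeasurable_funD; apply: measurable_funeM; [exact: mf|exact: (mf _ muv)].
move=> z _; rewrite -!EFinM -EFinD lee_fin.
have := mk.2 z.1 z.2; move: (k z.1 z.2) => c k0.
have h (p q : R) : p ^+ 2 <= (1 + t) * q ^+ 2 + (1 + t^-1) * (q - p) ^+ 2.
  (* This quotient is the difference of the two sides. *)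
  have : 0 <= (t * q - (p - q)) ^+ 2 / t by rewrite divr_ge0 ?sqr_ge0// ltW.
  have -> : (t * q - (p - q)) ^+ 2 / t = t * q ^+ 2 - 2 * q * (p - q) + t^-1 * (p - q) ^+ 2.
    by field; rewrite gt_eqF.
  rewrite -[(q - p) ^+ 2]sqrrN opprB; lra.
apply: (le_trans (ler_wpM2r k0 (h _ (u z.1 - u z.2)))).
by rewrite le_eqVlt; apply/orP; left; apply/eqP; ring.
Qed.

(* For the bounded kernels min(k, m) the form is L2-continuous; then let m tend to
   infinity. *)
Lemma kform_lsc k c (u : nat -> T -> R) (v : T -> R) : mkernel D k -> 0 <= c ->
  (forall j, sqint mu D (u j)) -> sqint mu D v ->
  (forall j, (\int[mu]_(x in D) ((u j x - v x) ^+ 2)%:E <= ((16^-1) ^+ j)%:E)%E) ->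
  (forall e, 0 < e -> exists N, forall j, (N <= j)%N -> (Q k (u j) <= (c + e)%:E)%E) ->
  (Q k v <= c%:E)%E.
Proof.
move=> mk c0 su sv uv uc.
pose km m x y := Num.min (k x y) m%:R.
have mkm m : mkernel D (km m) by exact: mkernel_min.
have kmle m : (Q (km m) v <= c%:E)%E.
  apply/lee_addgt0Pr => e e0.
  have e30 : 0 < e / 3 by rewrite divr_gt0.
  have [N1 HN1] := uc _ e30.
  (* Chosen so that [(1 + t) (c + e / 3) = c + 2 e / 3]. *)
  pose t := e / 3 / (c + e / 3).
  have ce0 : 0 < c + e / 3 by rewrite ltr_wpDl.
  have t0 : 0 < t by rewrite divr_gt0.
  (* The coefficient of the squared L^2 distance from [u j] to [v]: the kernel [km m] is at most
     [m], so [kform_bounded] applies. *)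
  pose B := (1 + t^-1) * (4 * m%:R * fine (mu D)).
  have B0 : 0 <= B by rewrite mulr_ge0 ?addr_ge0 ?invr_ge0 ?(ltW t0)// mulr_ge0 ?fine_ge0.
  have [j [jN jB]] : exists j, (N1 <= j)%N /\ B * (16^-1) ^+ j <= e / 3.
    have cv : (fun j => B * (16^-1) ^+ j) @ \oo --> 0.
      rewrite -[X in _ --> X](mulr0 B); apply: cvgM; first exact: cvg_cst.
      by apply: cvg_expr; rewrite ger0_norm; lra.
    have /cvgrPdist_lt/(_ _ e30)[N2 _ HN2] := cv.
    exists (maxn N1 N2); split; first exact: leq_maxl.
    have := HN2 (maxn N1 N2) (leq_maxr _ _); rewrite /= sub0r normrN.
    by move=> h; apply: le_trans (ler_norm _) (ltW h).
  have sw : sqint mu D (fun x => u j x - v x) by exact: sqintB.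
  have mdu := (su j).1; have mw := sw.1.
  have step : (Q (km m) v <= (1 + t)%:E * Q (km m) (u j) +
       (1 + t^-1)%:E * Q (km m) (fun x => (u j x - v x)%R))%E.
    exact: (kform_weighted_triangle (mkm m) t0 mdu sv.1).
  apply: (le_trans step).
  apply: (@le_trans _ _ (((1 + t) * (c + e / 3))%:E + (e / 3)%:E)%E).
    apply: leeD.
      rewrite EFinM lee_wpmul2l ?lee_fin ?addr_ge0 ?(ltW t0)//.
      apply: le_trans (HN1 j jN); apply: (le_kform adm) => //; [exact: (su j).1..|].
      by move=> x y _ _; rewrite ler_wpM2l ?sqr_ge0// /km ge_min lexx.
    apply: (@le_trans _ _ (B%:E * ((16^-1) ^+ j)%:E)%E); last by rewrite -EFinM lee_fin.
    rewrite /B EFinM -muleA lee_wpmul2l ?lee_fin ?addr_ge0 ?invr_ge0 ?(ltW t0)//.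
    apply: (le_trans (kform_bounded adm (mkm m) sw (ler0n _ m) _)).
      by move=> x y _ _; rewrite /km ge_min lexx orbT.
    by rewrite lee_wpmul2l// lee_fin mulr_ge0 ?fine_ge0.
  rewrite -!EFinD lee_fin mulrDl mul1r /t divfK ?gt_eqF//; lra.
have -> : Q k v = (\int[pmeasure mu mu]_(z in D `*` D)
   limn_einf (fun m => ((v z.1 - v z.2) ^+ 2 * km m z.1 z.2)%:E))%E.
  apply: eq_integral => z _; apply/esym.
  have : (fun m => ((v z.1 - v z.2) ^+ 2 * km m z.1 z.2)%:E) @ \oo -->
      ((v z.1 - v z.2) ^+ 2 * k z.1 z.2)%:E.
    apply: cvg_near_cst; near=> m; rewrite /km; congr (_ * _)%:E.
    apply/min_idPl; near: m; exact: nbhs_infty_ger.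
  by move=> /cvg_limn_einf_sup[].
apply: le_trans.
  apply: fatou => //.
  - by move=> m; exact: (measurable_kformE adm (mkm m) sv.1).
  - by move=> m z _; rewrite lee_fin; exact: (mulr_ge0 (sqr_ge0 _) ((mkm m).2 _ _)).
rewrite limn_einf_lim; apply: lime_le; first exact: is_cvg_einfs.
near=> j; apply: le_trans (kmle j).
by apply: ereal_inf_lbound; exists j => /=.
Unshelve. all: by end_near. Qed.

End lower_semicontinuity.

(** * The first positive eigenvalue *)

Section spectral.
Context d (T : measurableType d) (R : realType).
Variable mu : {sigma_finite_measure set T -> \bar R}.
Variables (n : nat) (D : set T) (rho : T -> T -> R) (M : R).
Hypothesis adm : admissible mu n D rho M.

Let mD := adm_mD adm.
Let mDD : measurable (D `*` D). Proof. exact: measurableX. Qed.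
Local Hint Resolve mD mDD : core.

Local Notation fker := (fker n rho).
Local Notation Q := (kform mu D).

Let mfker s : mkernel D (fker s). Proof. exact: (mkernel_fker adm). Qed.
Local Hint Resolve mfker : core.

Definition hspace s u := sqint mu D u /\ (Q (fker s) u < +oo)%E.

Definition energy s (u v : T -> R) : R :=
  2^-1 * fine (\int[pmeasure mu mu]_(z in D `*` D)
    ((u z.1 - u z.2) * (v z.1 - v z.2) * fker s z.1 z.2)%:E)%E.

Definition dotp (u v : T -> R) : R := \int[mu]_(x in D) (u x * v x).

Definition is_eigen s lam u := [/\ hspace s u,
  ~ mu.-negligible (D `&` [set x | u x != 0]) &
  forall v, hspace s v -> energy s u v = lam * dotp u v].

Definition first_eigen s := inf [set lam | 0 < lam /\ exists u, is_eigen s lam u].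

(** Energies are L^2 products of such functions on D x D; bilinearity and integrability are
    inherited from there. *)
Definition wdiff s (u : T -> R) (z : T * T) : R :=
  (u z.1 - u z.2) * Num.sqrt (fker s z.1 z.2).

Lemma wdiffM s u v z : wdiff s u z * wdiff s v z =
  (u z.1 - u z.2) * (v z.1 - v z.2) * fker s z.1 z.2.
Proof.
rewrite /wdiff mulrACA; congr (_ * _).
by rewrite -expr2 sqr_sqrtr// fker_ge0.
Qed.

Lemma wdiff_sqint s u : hspace s u -> sqint (pmeasure mu mu) (D `*` D) (wdiff s u).
Proof.
move=> [su fin]; split.
  apply: measurable_funM; first exact: (measurable_diff adm su.1).
  apply: (@eq_measurable_fun _ _ _ _ _ (fun z => fker s z.1 z.2 `^ (2^-1))).
    by move=> z _; rewrite powR12_sqrt// fker_ge0.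
  exact: (measurableT_comp (measurable_powR _) (mfker s).1).
rewrite (eq_integral (fun z => ((u z.1 - u z.2) ^+ 2 * fker s z.1 z.2)%:E))// => z _.
by rewrite expr2 wdiffM -expr2.
Qed.

Lemma energyE s u v : energy s u v =
  2^-1 * \int[pmeasure mu mu]_(z in D `*` D) (wdiff s u z * wdiff s v z).
Proof.
rewrite /energy /Rintegral; congr (_ * fine _); apply: eq_integral => z _.
by rewrite wdiffM.
Qed.

Lemma energy_kform s u : hspace s u -> (2 * energy s u u)%:E = Q (fker s) u.
Proof.
move=> hu; have sw := wdiff_sqint hu.
rewrite energyE mulrA mulfV ?pnatr_eq0// mul1r.
under eq_Rintegral do rewrite -expr2.
rewrite -(Rintegral_fineK mDD); last exact: sqint_integrable.
by apply: eq_integral => z _; rewrite expr2 wdiffM -expr2.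
Qed.

Lemma energy_ge0 s u : 0 <= energy s u u.
Proof.
rewrite energyE mulr_ge0//; apply: Rintegral_ge0 => z _.
by rewrite -expr2 sqr_ge0.
Qed.

Lemma wdiff_lin s t u v z :
  wdiff s (fun x => u x + t * v x) z = wdiff s u z + t * wdiff s v z.
Proof. by rewrite /wdiff; ring. Qed.

Lemma hspace_lin s t u v : hspace s u -> hspace s v ->
  hspace s (fun x => u x + t * v x).
Proof.
move=> hu hv; split; first exact: sqint_lin hu.1 hv.1.
have [_] := sqint_lin mDD t (wdiff_sqint hu) (wdiff_sqint hv).
rewrite (eq_integral (fun z => ((u z.1 + t * v z.1 - (u z.2 + t * v z.2)) ^+ 2 * fker s z.1 z.2)%:E))//.
by move=> z _; rewrite -wdiff_lin expr2 wdiffM -expr2.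
Qed.

Lemma hspace_cst s c : hspace s (fun=> c).
Proof.
split; first exact: (sqint_cst adm).
rewrite /kform (eq_integral (cst 0%E)) ?integral0 ?ltry//.
by move=> z _; rewrite subrr expr0n mul0r.
Qed.

Lemma energy_lin s t u v : hspace s u -> hspace s v ->
  energy s (fun x => u x + t * v x) (fun x => u x + t * v x) =
  energy s u u + 2 * t * energy s u v + t ^+ 2 * energy s v v.
Proof.
move=> hu hv; rewrite !energyE.
under eq_Rintegral do rewrite !wdiff_lin -expr2.
rewrite (Rintegral_sqr_lin mDD _ (wdiff_sqint hu) (wdiff_sqint hv)).
under [\int[_]_(x in _) (wdiff s u x * wdiff s u x)]eq_Rintegral do rewrite -expr2.
under [\int[_]_(x in _) (wdiff s v x * wdiff s v x)]eq_Rintegral do rewrite -expr2.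
by ring.
Qed.

Lemma energy_addc s u v c : energy s u (fun x => v x + c) = energy s u v.
Proof.
rewrite /energy; congr (_ * fine _); apply: eq_integral => z _.
by congr (_ * _ * _)%:E; ring.
Qed.

Lemma energyC s u v : energy s u v = energy s v u.
Proof.
rewrite /energy; congr (_ * fine _); apply: eq_integral => z _.
by congr (_ * _)%:E; rewrite mulrC.
Qed.

Lemma energy_cst s u c : energy s u (fun=> c) = 0.
Proof.
rewrite /energy (_ : (\int[_]_(z in _) _)%E = 0%E) ?mulr0//.
by apply: integral0_eq => z _; rewrite subrr mulr0 mul0r.
Qed.

Lemma dotp_lin t u v : sqint mu D u -> sqint mu D v ->
  dotp (fun x => u x + t * v x) (fun x => u x + t * v x) =
  dotp u u + 2 * t * dotp u v + t ^+ 2 * dotp v v.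
Proof.
move=> su sv; rewrite /dotp.
under [LHS]eq_Rintegral do rewrite -expr2.
by rewrite (Rintegral_sqr_lin mD).
Qed.

Lemma dotp_ge0 u : 0 <= dotp u u.
Proof. by apply: Rintegral_ge0 => x _; rewrite -expr2 sqr_ge0. Qed.

Definition avg (u : T -> R) : R := \int[mu]_(x in D) u x / fine (mu D).

Lemma Rintegral_center u : sqint mu D u -> \int[mu]_(x in D) (u x - avg u) = 0.
Proof.
move=> su; rewrite (RintegralB mD (sqint_L1 adm su) (integrable_cst adm _)).
by rewrite Rintegral_cst// /avg divfK ?subrr// gt_eqF// (fine_muD_gt0 adm).
Qed.

Lemma hspace_addc s u c : hspace s u -> hspace s (fun x => u x + c).
Proof.
move=> hu; have := hspace_lin 1 hu (hspace_cst s c).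
by under [fun x => u x + _]eq_fun do rewrite mul1r.
Qed.

Lemma hspaceZ s u c : hspace s u -> hspace s (fun x => c * u x).
Proof.
move=> hu; have := hspace_lin c (hspace_cst s 0) hu.
by under [fun x => _ + _]eq_fun do rewrite add0r.
Qed.

Lemma energyZ s u c : hspace s u ->
  energy s (fun x => c * u x) (fun x => c * u x) = c ^+ 2 * energy s u u.
Proof.
move=> hu; have := energy_lin c (hspace_cst s 0) hu.
rewrite energy_cst energyC energy_cst mulr0 !add0r.
by under [fun x => _ + _]eq_fun do rewrite add0r.
Qed.

Lemma dotpZ u c : sqint mu D u -> dotp (fun x => c * u x) (fun x => c * u x) = c ^+ 2 * dotp u u.
Proof.
move=> su; rewrite /dotp -RintegralZl//; last exact: sqint_mul.
by apply: eq_Rintegral => x _; ring.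
Qed.

Lemma dotp_gt0 u : sqint mu D u -> ~ mu.-negligible (D `&` [set x | u x != 0]) -> 0 < dotp u u.
Proof.
move=> su nz; rewrite lt_def dotp_ge0 andbT; apply/eqP => u0; apply: nz.
have : mu.-negligible (D `&` [set x | u x * u x != 0]).
  apply: Rintegral_eq0_ae => //; first exact: sqint_mul.
  by move=> x _; rewrite -expr2 sqr_ge0.
by apply: negligibleS => x [Dx /= ux]; split => //=; rewrite mulf_neq0.
Qed.

Lemma dotp_neq0 u : sqint mu D u -> 0 < dotp u u ->
  ~ mu.-negligible (D `&` [set x | u x != 0]).
Proof.
move=> su u0 nu; suff E : dotp u u = 0 by rewrite E ltxx in u0.
rewrite /dotp /Rintegral (ae_eq_integral (cst 0%E)) ?integral0//.
  by apply/measurable_EFinP/measurable_funM; exact: su.1.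
apply: negligibleS nu => x /= /not_implyP[Dx ux]; split => //=.
by apply/eqP => u0'; apply: ux; rewrite u0' mulr0.
Qed.

(* Testing with the constant 1 and with u itself. *)
Lemma eigen_mean s lam u : 0 < lam -> is_eigen s lam u ->
  \int[mu]_(x in D) u x = 0 /\ energy s u u = lam * dotp u u.
Proof.
move=> l0 [hu _ Hu]; split; last exact: Hu.
have := Hu _ (hspace_cst s 1); rewrite energy_cst /dotp.
under eq_Rintegral do rewrite mulr1.
by move=> /esym/eqP; rewrite mulf_eq0 gt_eqF//= => /eqP.
Qed.

(** Mean zero is orthogonality to the eigenspace of the eigenvalue 0. *)
Definition rayleigh s m := forall u, hspace s u -> \int[mu]_(x in D) u x = 0 ->
  m * dotp u u <= energy s u u.

(** For [w] of mean zero, energy minus [m] times squared norm at [u + t w] is a polynomial in [t]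
    with minimum 0 at [t = 0]. A general test function is centred first: the constant changes
    neither side, as [u] has mean zero. *)
Lemma minimizer_is_eigen s m u : rayleigh s m -> hspace s u ->
  \int[mu]_(x in D) u x = 0 -> 0 < dotp u u -> energy s u u <= m * dotp u u ->
  is_eigen s m u.
Proof.
move=> Hm hu u0 upos Eu; split => //; first exact: (dotp_neq0 hu.1).
have su := hu.1.
have EE : energy s u u = m * dotp u u by apply/eqP; rewrite eq_le Eu Hm.
move=> v hv; have sv := hv.1.
pose w x := v x + - avg v.
have hw : hspace s w by exact: hspace_addc.
have w0 : \int[mu]_(x in D) w x = 0 by exact: Rintegral_center.
have -> : energy s u v = energy s u w by rewrite energy_addc.
have -> : dotp u v = dotp u w.
  rewrite /dotp /w.
  under [RHS]eq_Rintegral do rewrite mulrDr.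
  rewrite RintegralD//; [|exact: sqint_mul|]; last first.
    by apply: sqint_mul => //; exact: (sqint_cst adm).
  by rewrite RintegralZr ?u0 ?mul0r ?addr0//; exact: (sqint_L1 adm).
apply/eqP; rewrite -subr_eq0; apply/eqP.
have : 2 * (energy s u w - m * dotp u w) = 0.
  apply: (@ge0_quadratic_linear0 _ _ (energy s w w - m * dotp w w)) => t.
  have := Hm _ (hspace_lin t hu hw).
  rewrite energy_lin// dotp_lin//; last exact: hw.1.
  rewrite RintegralD//; [|exact: (sqint_L1 adm)|]; last first.
    by apply: integrableZ_EFin => //; apply: (sqint_L1 adm); exact: hw.1.
  rewrite RintegralZl//; last by apply: (sqint_L1 adm); exact: hw.1.
  rewrite u0 w0 mulr0 addr0 => /(_ erefl); rewrite EE; lra.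
by move=> /eqP; rewrite mulf_eq0 pnatr_eq0/= => /eqP.
Qed.

(* The double integral of (u x - u y)^2 is 2 mu(D) ||u||^2 for u of mean zero. *)
Lemma poincare s : 0 <= s -> exists2 c, 0 < c & rayleigh s c.
Proof.
move=> s0.
pose m := fine (mu D).
have m0 : 0 < m := fine_muD_gt0 adm.
have M0 : 0 < M by apply: lt_le_trans (adm_M1 adm).
(* Off the diagonal [1 <= M^(n+1) fker 0], and [fker 0 <= M^(2s) fker s]. *)
pose c := m / (M ^+ n.+1 * M `^ (2 * s)).
have c0 : 0 < c by rewrite divr_gt0// mulr_gt0 ?exprn_gt0 ?powR_gt0.
exists c => // u hu u0; have su := hu.1; have iu := sqint_L1 adm su.
have mu_ := su.1.
have h1 : (Q (fun _ _ => 1%R) u <= (M ^+ n.+1 * M `^ (2 * s))%:E * Q (fker s) u)%E.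
  rewrite -(kformZ adm) ?mulr_ge0 ?exprn_ge0 ?powR_ge0 ?(ltW M0)//.
  apply: (le_kform adm) => //.
  - by apply: mkernelZ; rewrite ?mulr_ge0 ?exprn_ge0 ?powR_ge0 ?(ltW M0).
  - move=> x y Dx Dy; have [->|xy] := eqVneq x y; first by rewrite subrr expr0n !mul0r.
    rewrite ler_wpM2l ?sqr_ge0//.
    have r0 := rho_gt0 adm xy.
    apply: (@le_trans _ _ (M ^+ n.+1 * fker 0 x y)).
      rewrite (fker0E adm) -expr_div_n exprn_ege1// ler_pdivlMr// mul1r.
      exact: (rho_le adm).
    by rewrite -mulrA ler_wpM2l ?exprn_ge0 ?(ltW M0)// (fker0_le adm).
have m1 : mkernel D (fun _ _ : T => 1 : R) by split; [exact: measurable_cst|move=> x y; exact: ler01].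
have i2 := sqint_integrable su.
have h2 : Q (fun _ _ => 1) u = (2 * m * dotp u u)%:E.
  rewrite (kform_fubini adm)//.
  have inner x : (\int[mu]_(y in D) ((u x - u y) ^+ 2 * 1)%:E)%E =
      (m * u x ^+ 2 + dotp u u)%:E.
    have ix2 := integrable_cst adm (u x ^+ 2).
    have iux := integrableZ_EFin mD (2 * u x) iu.
    rewrite (eq_integral (fun y => (u x ^+ 2 - 2 * u x * u y + u y ^+ 2)%:E)); last first.
      by move=> y _; congr EFin; ring.
    rewrite (Rintegral_fineK mD); last first.
      by apply: integrableD_EFin => //; exact: integrableB_EFin.
    rewrite RintegralD//; last exact: integrableB_EFin.
    rewrite RintegralB// Rintegral_cst// RintegralZl// u0 mulr0 subr0.
    by rewrite /dotp; under [in RHS]eq_Rintegral do rewrite -expr2; rewrite mulrC.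
  under eq_integral do rewrite inner.
  have ic := integrable_cst adm (dotp u u).
  have im := integrableZ_EFin mD m i2.
  rewrite (Rintegral_fineK mD); last exact: integrableD_EFin.
  rewrite RintegralD// RintegralZl// Rintegral_cst// -/m; congr EFin.
  have -> : \int[mu]_(x in D) (u x ^+ 2) = dotp u u by apply: eq_Rintegral => x _; rewrite expr2.
  by ring.
move: h1; rewrite h2 -(energy_kform hu) -EFinM lee_fin => h1.
rewrite /c mulrAC ler_pdivrMr ?mulr_gt0 ?exprn_gt0 ?powR_gt0//; lra.
Qed.

Lemma sqr_norm_le_geometric (a b : R) j : 0 <= b -> a ^+ 2 <= b ^+ 2 * (16^-1) ^+ j ->
  `|a| <= b * (4^-1) ^+ j.
Proof.
move=> b0 ab; rewrite -[leRHS]ger0_norm ?mulr_ge0 ?exprn_ge0//.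
rewrite -ler_sqr ?nnegrE// !real_normK ?num_real// exprMn -exprM mulnC exprM.
by have -> : (4^-1) ^+ 2 = 16^-1 :> R by field.
Qed.

Lemma L2_limit (u : nat -> T -> R) (v : T -> R) : (forall j, sqint mu D (u j)) ->
  sqint mu D v ->
  (forall j, (\int[mu]_(x in D) ((u j x - v x) ^+ 2)%:E <= ((16^-1) ^+ j)%:E)%E) ->
  (forall j, dotp (u j) (u j) = 1) -> (forall j, \int[mu]_(x in D) u j x = 0) ->
  dotp v v = 1 /\ \int[mu]_(x in D) v x = 0.
Proof.
move=> su sv uv u1 u0.
pose w j x := u j x - v x.
have sw j : sqint mu D (w j) by exact: sqintB.
have w16 j : \int[mu]_(x in D) (w j x ^+ 2) <= (16^-1) ^+ j.
  by rewrite -lee_fin -(Rintegral_fineK mD (sqint_integrable (sw j))); exact: uv.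
have dE (f : T -> R) : dotp f f = \int[mu]_(x in D) (f x ^+ 2).
  by apply: eq_Rintegral => x _; rewrite expr2.
split.
  (* By Cauchy-Schwarz the rate [16^-j] becomes [4^-j]; the 3 is 2 for the cross term and 1 for the
     square. *)
  apply/eqP; rewrite -subr_eq0; apply/eqP; apply: (@norm_le_geometric_eq0 _ _ 3) => j.
  have vE : v = (fun x => u j x + (-1) * w j x) by apply/funext => x; rewrite /w; ring.
  have -> : dotp v v - 1 = - (2 * dotp (u j) (w j)) + dotp (w j) (w j).
    rewrite [in LHS]vE dotp_lin// u1; ring.
  have h1 : `|dotp (u j) (w j)| <= 1 * (4^-1) ^+ j.
    apply: sqr_norm_le_geometric => //.
    apply: (le_trans (Rintegral_cauchy_schwarz mD (su j) (sw j))).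
    by rewrite -!dE u1 expr1n ler_wpM2l// dE.
  have h2 : `|dotp (w j) (w j)| <= (4^-1) ^+ j.
    rewrite ger0_norm ?dotp_ge0// dE; apply: (le_trans (w16 j)).
    by apply: lerXn2r; rewrite ?nnegrE//; lra.
  apply: (le_trans (ler_normD _ _)); rewrite normrN normrM ger0_norm//; lra.
have m0 : 0 <= fine (mu D) by exact: fine_ge0.
(* [1 + mu(D)] is a convenient upper bound of the square root of [mu(D)]. *)
apply: (@norm_le_geometric_eq0 _ _ (1 + fine (mu D))) => j.
have -> : \int[mu]_(x in D) v x = - \int[mu]_(x in D) (1 * w j x).
  transitivity (- \int[mu]_(x in D) w j x).
    by rewrite RintegralB ?u0 ?sub0r ?opprK//; exact: (sqint_L1 adm).
  by congr (- _); apply: eq_Rintegral => x _; rewrite mul1r.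
rewrite normrN; apply: sqr_norm_le_geometric; first by rewrite addr_ge0.
apply: (le_trans (Rintegral_cauchy_schwarz mD (sqint_cst adm 1) (sw j))).
under [X in X * _]eq_Rintegral do rewrite expr1n.
rewrite Rintegral_cst// mul1r; apply: ler_pM => //.
  by apply: Rintegral_ge0 => x _; exact: sqr_ge0.
by have := sqr_ge0 (fine (mu D)); nra.
Qed.

(** A centred Lipschitz function: its squared differences lower [rho ^- n.+2] to [rho ^- n], and a
    ball of radius [M + 1] contains [D]. It makes the set of Rayleigh quotients nonempty at every
    order in [0, 1/2]. *)
Lemma nontrivial_hspace : exists f : T -> R,
  [/\ sqint mu D f, (Q (fker 2^-1) f < +oo)%E, \int[mu]_(x in D) f x = 0 & 0 < dotp f f].
Proof.
have [g [mg glip gne]] := rho_lip adm.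
have [C HC] := rho_pow_int adm.
have [x0 Dx0] : D !=set0.
  apply/set0P/eqP => D0; have := adm_gt0 adm.
  have -> : mu D = mu set0 := congr1 (fun A => mu A) D0.
  by rewrite measure0 ltxx.
have M0 : 0 < M by apply: lt_le_trans (adm_M1 adm).
have sg : sqint mu D g.
  apply: (@le_sqint _ _ _ _ _ mD _ (fun=> (`|g x0| + M) ^+ 2)) => //; last exact: (integrable_cst adm).
  move=> x Dx; rewrite -(real_normK (num_real (g x))).
  apply: lerXn2r; rewrite ?nnegrE ?addr_ge0 ?(ltW M0)//.
  have -> : g x = g x0 + (g x - g x0) by ring.
  apply: (le_trans (ler_normD _ _)); rewrite lerD2l.
  by apply: (le_trans (glip _ _ Dx Dx0)); exact: (rho_le adm).
have fing : (Q (fker 2^-1) g < +oo)%E.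
  rewrite (kform_fubini adm)//.
  apply: (@le_lt_trans _ _ (\int[mu]_(x in D) (C * (M + 1))%:E)%E); last first.
    rewrite integral_cst// lte_mul_pinfty ?(adm_lty adm)// lee_fin.
    have M1 : 0 < M + 1 by rewrite addr_gt0.
    rewrite -lee_fin; apply: le_trans (HC _ _ M1 Dx0).
    by apply: integral_ge0 => y _; rewrite lee_fin invr_ge0 exprn_ge0// (rho_ge0 adm).
  have mgk := measurable_kformE adm (mfker 2^-1) mg.
  have gk0 x y : 0 <= (g x - g y) ^+ 2 * fker 2^-1 x y.
    by exact: (mulr_ge0 (sqr_ge0 _) (fker_ge0 _ _ _ _ _)).
  apply: ge0_le_integral => //.
  - by move=> x _; apply: integral_ge0 => y _; rewrite lee_fin.
  - apply: (@measurable_fubini_on _ _ _ mu D mD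
      (fun z => ((g z.1 - g z.2) ^+ 2 * fker 2^-1 z.1 z.2)%:E)) => //.
    by move=> z _; rewrite lee_fin.
  move=> x Dx; have M1 : 0 < M + 1 by rewrite addr_gt0.
  apply: le_trans (HC _ _ M1 Dx).
  have -> : D `&` [set y | rho x y < M + 1] = D.
    apply/setIidPl => y Dy /=; apply: (le_lt_trans (rho_le adm Dx Dy)).
    by rewrite ltrDl.
  have mrho := measurable_rho1 adm x.
  apply: ge0_le_integral => //.
  - by move=> y _; rewrite lee_fin.
  - apply/measurable_EFinP/measurable_funM.
      by apply: measurable_funX; apply: measurable_funB.
    apply: measurable_fun_inv_ge0; first by move=> y _; exact: powR_ge0.
    exact: (measurableT_comp (measurable_powR _)).
  - apply/measurable_EFinP/measurable_fun_inv_ge0; last exact: measurable_funX.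
    by move=> y _; rewrite exprn_ge0// (rho_ge0 adm).
  move=> y Dy; rewrite lee_fin.
  have [->|xy] := eqVneq x y.
    by rewrite subrr expr0n mul0r invr_ge0 exprn_ge0// (rho_ge0 adm).
  have r0 := rho_gt0 adm xy.
  have rE : rho x y ^- n.+2 = rho x y ^- 2 * rho x y ^- n.
    by rewrite -invfM -exprD add2n.
  rewrite (fker_halfE adm) rE mulrA ler_piMl ?invr_ge0 ?exprn_ge0 ?(ltW r0)//.
  rewrite ler_pdivrMr ?exprn_gt0// mul1r -(real_normK (num_real (g x - g y))).
  by apply: lerXn2r; rewrite ?nnegrE ?(ltW r0)// glip.
pose f x := g x + - avg g.
have sf : sqint mu D f by apply: sqintB => //; exact: (sqint_cst adm).
exists f; split => //.
- have -> : Q (fker 2^-1) f = Q (fker 2^-1) g; last by [].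
  by apply: eq_integral => z _; rewrite /f; congr (_ * _)%:E; congr (_ ^+ 2); ring.
- exact: Rintegral_center.
- apply: dotp_gt0 => // nf; apply: (gne (avg g)).
  apply: negligibleS nf => x [Dx /= gx]; split => //=.
  by rewrite /f subr_eq0.
Qed.

(** The direct method. Compactness is used at order 0, where a minimizing sequence of order [s] is
    bounded by [kform_fker0_le]; semicontinuity is then applied at order [s] itself. *)
Lemma rayleigh_attained s : 0 <= s -> s <= 2^-1 -> exists m u,
  [/\ 0 < m, rayleigh s m, hspace s u, \int[mu]_(x in D) u x = 0 & dotp u u = 1 /\ energy s u u <= m].
Proof.
move=> s0 s1.
have [f [sf ff f0 fpos]] := nontrivial_hspace.
have normalize u : hspace s u -> \int[mu]_(x in D) u x = 0 -> 0 < dotp u u ->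
    exists v, [/\ hspace s v, \int[mu]_(x in D) v x = 0, dotp v v = 1 &
      energy s v v = energy s u u / dotp u u].
  move=> hu u0 upos; pose c := (Num.sqrt (dotp u u))^-1.
  have c2 : c ^+ 2 = (dotp u u)^-1 by rewrite /c exprVn sqr_sqrtr// ltW.
  exists (fun x => c * u x); split; first exact: hspaceZ.
  - by rewrite RintegralZl// ?u0 ?mulr0//; exact: (sqint_L1 adm hu.1).
  - by rewrite dotpZ ?c2 ?mulVf ?gt_eqF//; exact: hu.1.
  - by rewrite energyZ// c2 mulrC.
have hf : hspace s f by split; [exact: sf|exact: (kform_half_lty adm s0 s1 sf.1)].
pose S := [set e | exists u, [/\ hspace s u, \int[mu]_(x in D) u x = 0, dotp u u = 1 & energy s u u = e]].
have [c c0 Hc] := poincare s0.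
have Slb : lbound S c.
  by move=> _ [u [hu u0 u1 <-]]; have := Hc u hu u0; rewrite u1 mulr1.
have Sne : S !=set0.
  have [v [hv v0 v1 _]] := normalize f hf f0 fpos.
  by exists (energy s v v), v.
have hinf : has_inf S by split => //; exists c.
pose m := inf S.
have m0 : 0 < m by apply: lt_le_trans c0 _; exact: lb_le_inf.
have Hm : rayleigh s m.
  move=> u hu u0; have := dotp_ge0 u; rewrite le_eqVlt => /predU1P[<-|upos].
    by rewrite mulr0 energy_ge0.
  have [v [hv v0 v1 vE]] := normalize u hu u0 upos.
  rewrite -ler_pdivlMr// -vE; apply: ge_inf; first by exists c.
  by exists v.
have /choice[u Hu] j : exists u, [/\ hspace s u, \int[mu]_(x in D) u x = 0, dotp u u = 1 &
    energy s u u <= m + j.+1%:R^-1].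
  have jp : (0 : R) < j.+1%:R^-1 by rewrite invr_gt0.
  have [_ [u [hu u0 u1 <-]] Eu] := inf_adherent jp hinf.
  by exists u; split => //; exact: ltW.
have su j : sqint mu D (u j) by case: (Hu j) => -[].
have dE (g : T -> R) : dotp g g = \int[mu]_(x in D) (g x ^+ 2).
  by apply: eq_Rintegral => x _; rewrite expr2.
pose B := 1 + M `^ (2 * s) * (2 * (m + 1)).
have M0 : 0 <= M `^ (2 * s) by exact: powR_ge0.
have B0 : 0 <= B by rewrite addr_ge0// mulr_ge0// mulr_ge0// addr_ge0// ltW.
have [|j||phi [v [phiS sv uv]]] := @compact_embedding _ _ _ mu n D rho M adm u B B0.
- exact: su.
- case: (Hu j) => _ _ u1 _; rewrite (Rintegral_fineK mD (sqint_integrable (su j))) -dE u1.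
  by rewrite lee_fin /B lerDl mulr_ge0// mulr_ge0// addr_ge0// ltW.
- move=> j; case: (Hu j) => hu _ u1 Eu.
  apply: (le_trans (kform_fker0_le adm s0 (su j).1)).
  rewrite -(energy_kform hu) -EFinM lee_fin /B.
  apply: (@le_trans _ _ (M `^ (2 * s) * (2 * (m + 1)))); last by rewrite lerDr.
  rewrite ler_wpM2l// ler_wpM2l//; apply: (le_trans Eu); rewrite lerD2l.
  by rewrite invf_le1// ler1n.
have phij j : (j <= phi j)%N.
  by elim: j => // j IH; apply: leq_ltn_trans IH _; exact: phiS.
have [v1 v0] := L2_limit (fun j => su (phi j)) sv uv
  (fun j => let: And4 _ _ h _ := Hu (phi j) in h) (fun j => let: And4 _ h _ _ := Hu (phi j) in h).
have Qv : (Q (fker s) v <= (2 * m)%:E)%E.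
  apply: (kform_lsc adm (mfker s) _ (fun j => su (phi j)) sv uv); first by rewrite mulr_ge0// ltW.
  move=> e e0; have e20 : 0 < e / 2 by rewrite divr_gt0.
  have /cvgrPdist_lt/(_ _ e20)[N _ HN] := @cvg_harmonic R.
  exists N => j Nj; case: (Hu (phi j)) => hu _ _ Eu.
  rewrite -(energy_kform hu) lee_fin.
  have := HN (phi j) (leq_trans Nj (phij j)); rewrite /= sub0r normrN => h.
  have := le_lt_trans (ler_norm _) h; rewrite /harmonic /= => h'.
  move: ((phi j).+1%:R^-1) Eu h' => r Eu h'; lra.
have hv : hspace s v by split; [exact: sv|exact: le_lt_trans Qv (ltry _)].
exists m, v; split => //; split => //.
by move: Qv; rewrite -(energy_kform hv) lee_fin ler_pM2l.
Qed.

(** The minimum of the Rayleigh quotient is an eigenvalue, and any positive eigenvalue is the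
    quotient of its eigenfunction, which has mean zero. Hence the infimum of the positive
    eigenvalues is attained and equals this minimum. *)
Lemma first_eigenP s : 0 <= s -> s <= 2^-1 ->
  [/\ 0 < first_eigen s, rayleigh s (first_eigen s) & exists u,
    [/\ hspace s u, \int[mu]_(x in D) u x = 0, dotp u u = 1 & energy s u u <= first_eigen s]].
Proof.
move=> s0 s1; have [m [u [m0 Hm hu u0 [u1 Eu]]]] := rayleigh_attained s0 s1.
suff -> : first_eigen s = m by split => //; exists u.
have mS : [set lam | 0 < lam /\ exists u, is_eigen s lam u] m.
  split => //; exists u; apply: minimizer_is_eigen => //; first by rewrite u1.
  by rewrite u1 mulr1.
have mlb : lbound [set lam | 0 < lam /\ exists u, is_eigen s lam u] m.
  move=> lam [l0 [w Hw]]; have [w0 Ew] := eigen_mean l0 Hw.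
  case: Hw => hw nw _; have wpos := dotp_gt0 hw.1 nw.
  by rewrite -(ler_pM2r wpos) -Ew; exact: Hm.
apply/eqP; rewrite eq_le; apply/andP; split.
  by apply: ge_inf => //; exists m.
by apply: lb_le_inf => //; exists m.
Qed.

End spectral.

(** * The limit of small orders *)

(** In the application [a] and [l] are the eigenvalues of order [s] and 0, [E] is the energy of the
    trial function, [V] its squared norm, [q] what centring takes off [V], and [t] the accuracy of
    the approximation. *)
Lemma perturbed_quotient (R : realFieldType) (E V q l a t : R) : 0 <= a -> 0 <= t ->
  a * (V - q) <= E -> 2 * E <= (1 + t) * (2 * l) + (t ^+ 2 + t) + t ->
  t ^+ 2 <= t -> 1 - 2 * t <= V -> q <= t ^+ 2 -> a * (1 - 3 * t) <= (1 + t) * l + 2 * t.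
Proof.
move=> a0 t0 H HE t2 HV Hq.
have h : a * (1 - 3 * t) <= a * (V - q) by apply: ler_wpM2l => //; lra.
move: (le_trans h H); move: (a * (1 - 3 * t)) => x {H h}; lra.
Qed.

(** The hypothesis on [t (4 l + 3 e + 2)] is a rearrangement of
    [(1 + t) l + 2 t <= (l + e) (1 - 3 t)]. *)
Lemma small_perturbation (R : realFieldType) (l e a t : R) : 0 < l -> 0 < e -> 0 < t ->
  t * (4 * l + 3 * e + 2) <= e -> a * (1 - 3 * t) <= (1 + t) * l + 2 * t -> a <= l + e.
Proof.
move=> l0 e0 t0 te h.
have t13 : 0 < 1 - 3 * t.
  have : t * (3 * e) < e by apply: lt_le_trans te; rewrite ltr_pM2l//; lra.
  by rewrite mulrA [t * 3]mulrC gtr_pMl// => ?; lra.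
rewrite -(ler_pM2r t13); apply: (le_trans h).
rewrite -subr_ge0 in te; rewrite -subr_ge0.
have -> : (l + e) * (1 - 3 * t) - ((1 + t) * l + 2 * t) = e - t * (4 * l + 3 * e + 2) by ring.
exact: te.
Qed.

Lemma quotient_dist (R : realFieldType) (l e a b : R) : 0 < e -> 0 <= a ->
  a * (l + 1) = e -> l <= (1 + a) * b -> b <= l + e -> `|l - b| <= e.
Proof.
move=> e0 a0 ae h bl; rewrite ler_distlC bl andbT lerBlDr.
have [lb|lb] := leP l b; first by apply: (le_trans lb); rewrite lerDl ltW.
apply: (le_trans h); rewrite mulrDl mul1r lerD2l -ae; apply: ler_wpM2l => //.
by apply: ltW; rewrite (lt_trans lb)// ltrDl.
Qed.

Lemma product_perturbation (R : realFieldType) (l e a x : R) : 0 <= a -> a <= 1 ->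
  a * (l + 2) <= e / 2 -> x <= (1 + a) * (l + a) -> 2 * x <= 2 * l + e.
Proof.
move=> a0 a1 h hx.
have a2 : a * a <= a by rewrite ler_piMl.
apply: (@le_trans _ _ (2 * (l + a * (l + 2)))); last by lra.
rewrite ler_pM2l//; apply: (le_trans hx).
have -> : (1 + a) * (l + a) = l + a * (l + 1) + a * a by ring.
have -> : l + a * (l + 2) = l + a * (l + 1) + a by ring.
by rewrite lerD2l.
Qed.

Section small_order_limit.
Context d (T : measurableType d) (R : realType).
Variable mu : {sigma_finite_measure set T -> \bar R}.
Variables (n : nat) (D : set T) (rho : T -> T -> R) (M : R).
Hypothesis adm : admissible mu n D rho M.

Let mD := adm_mD adm.
Let mDD : measurable (D `*` D). Proof. exact: measurableX. Qed.
Local Hint Resolve mD mDD : core.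

Local Notation fker := (fker n rho).
Local Notation Q := (kform mu D).
Local Notation hspace := (hspace mu n D rho).
Local Notation energy := (energy mu n D rho).
Local Notation ip := (dotp mu D).
Local Notation mean := (avg mu D).
Local Notation lam := (first_eigen mu n D rho).
Local Notation is_eigen := (is_eigen mu n D rho).

Let mfker s : mkernel D (fker s). Proof. exact: (mkernel_fker adm). Qed.
Local Hint Resolve mfker : core.

Let half_ge0 : (0 : R) <= 2^-1. Proof. by rewrite invr_ge0. Qed.
Local Hint Resolve half_ge0 : core.

(* Unification would otherwise unfold the infimum into - sup (-S). *)
Local Opaque first_eigen.

Lemma hspace0 s u : 0 <= s -> hspace s u -> hspace 0 u.
Proof.
move=> s0 [su fu]; split; first exact: su.
apply: (le_lt_trans (kform_fker0_le adm s0 su.1)).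
by rewrite lte_mul_pinfty// lee_fin powR_ge0.
Qed.

Lemma energy0_le s u : 0 <= s -> hspace s u -> energy 0 u u <= M `^ (2 * s) * energy s u u.
Proof.
move=> s0 hu; have h0 := hspace0 s0 hu.
have := kform_fker0_le adm s0 hu.1.1.
rewrite -(energy_kform adm hu) -(energy_kform adm h0) -EFinM lee_fin.
by move: (energy 0 u u) (energy s u u) (M `^ (2 * s)) => a b c; rewrite mulrCA ler_pM2l.
Qed.

Lemma first_eigen0_le s : 0 <= s -> s <= 2^-1 -> lam 0 <= M `^ (2 * s) * lam s.
Proof.
move=> s0 s1; have [_ _ [u [hu u0 u1 Eu]]] := first_eigenP adm s0 s1.
have [_ H0 _] := first_eigenP adm (lexx 0) half_ge0.
have := H0 u (hspace0 s0 hu) u0; rewrite u1 mulr1 => /le_trans; apply.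
by apply: (le_trans (energy0_le s0 hu)); rewrite ler_wpM2l// powR_ge0.
Qed.

Lemma dotp_center v : sqint mu D v ->
  ip (fun x => v x + - mean v) (fun x => v x + - mean v) =
  ip v v - (\int[mu]_(x in D) v x) ^+ 2 / fine (mu D).
Proof.
move=> sv; have m0 := fine_muD_gt0 adm.
have c1 := sqint_cst adm 1.
have -> : (fun x => v x + - mean v) = (fun x => v x + - mean v * 1).
  by apply/funext => x; rewrite mulr1.
rewrite (dotp_lin adm)//.
have -> : ip v (fun=> 1) = \int[mu]_(x in D) v x.
  by apply: eq_Rintegral => x _; rewrite mulr1.
have -> : ip (fun=> 1) (fun=> 1) = fine (mu D).
  by rewrite /dotp; under eq_Rintegral do rewrite mulr1; rewrite Rintegral_cst// mul1r.
by rewrite /avg; field; rewrite gt_eqF.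
Qed.

Lemma first_eigen_limsup e : 0 < e -> exists s0, [/\ 0 < s0, s0 <= 2^-1 &
  forall s, 0 <= s -> s <= s0 -> lam s <= lam 0 + e].
Proof.
move=> e0; have [l0 H0 [u [hu u0 u1 Eu]]] := first_eigenP adm (lexx 0) half_ge0.
set l := lam 0 in l0 H0 Eu *.
have c0 : 0 < 4 * l + 3 * e + 2 by lra.
pose dl := Num.min 1 (e / (4 * l + 3 * e + 2)).
have dl0 : 0 < dl by rewrite lt_min ltr01 divr_gt0.
have dl1 : dl <= 1 by rewrite ge_min lexx.
have dle : dl * (4 * l + 3 * e + 2) <= e.
  by rewrite -ler_pdivlMr// ge_min lexx orbT.
have dl2 : 0 < dl ^+ 2 by rewrite exprn_gt0.
(* Accuracy [dl ^+ 2] and not [dl], since the weighted triangle inequality multiplies it by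
   [1 + dl^-1]. *)
have [v [sv fv Qvu vu2]] := smooth_approximation adm hu.1 hu.2 dl2.
have [s0 [s00 s01 Hs0]] := kform_limsup adm sv.1 fv dl0.
have mv := sv.1; have su := hu.1; have mu_ := su.1.
have Quv : (Q (fker 0) (fun x => (u x - v x)%R) <= (dl ^+ 2)%:E)%E.
  apply: le_trans Qvu; rewrite le_eqVlt; apply/orP; left; apply/eqP.
  by apply: eq_integral => z _; congr (_ * _)%:E; rewrite -sqrrN; congr (_ ^+ 2); ring.
have Qv0 : (Q (fker 0) v <= ((1 + dl) * (2 * l) + (1 + dl^-1) * dl ^+ 2)%:E)%E.
  apply: (le_trans (kform_weighted_triangle adm (mfker 0) dl0 mu_ mv)).
  rewrite [leRHS]EFinD; apply: leeD; rewrite [leRHS]EFinM; apply: lee_wpmul2l => //.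
  - by rewrite lee_fin addr_ge0// ltW.
  - by rewrite -(energy_kform adm hu) lee_fin ler_pM2l.
  - by rewrite lee_fin addr_ge0// invr_ge0 ltW.
have m0 := fine_muD_gt0 adm.
pose z x := u x - v x.
have sz : sqint mu D z by exact: sqintB.
have dE (f : T -> R) : ip f f = \int[mu]_(x in D) (f x ^+ 2).
  by apply: eq_Rintegral => x _; rewrite expr2.
have z2 : ip z z <= dl ^+ 2.
  by rewrite dE -lee_fin -(Rintegral_fineK mD (sqint_integrable sz)).
have vE : v = (fun x => u x + (-1) * z x) by apply/funext => x; rewrite /z; ring.
have uz : ip u z <= dl.
  have h : (ip u z) ^+ 2 <= dl ^+ 2.
    apply: (le_trans (Rintegral_cauchy_schwarz mD su sz)).
    by rewrite -!dE u1 mul1r.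
  apply: (le_trans (ler_norm _)).
  by rewrite -[leRHS]ger0_norm ?(ltW dl0)// -ler_sqr ?nnegrE// !real_normK ?num_real.
have vv : 1 - 2 * dl <= ip v v.
  rewrite [X in ip X X]vE (dotp_lin adm)// u1.
  have := dotp_ge0 mu D z; lra.
(* As [u] has mean zero, the integral of [v] is minus that of [u - v], which is small. *)
have vm : (\int[mu]_(x in D) v x) ^+ 2 / fine (mu D) <= dl ^+ 2.
  rewrite ler_pdivrMr//.
  have -> : \int[mu]_(x in D) v x = - \int[mu]_(x in D) (1 * z x).
    transitivity (- \int[mu]_(x in D) z x); last first.
      by congr (- _); apply: eq_Rintegral => x _; rewrite mul1r.
    by rewrite RintegralB ?u0 ?sub0r ?opprK//; exact: (sqint_L1 adm).
  rewrite sqrrN; apply: (le_trans (Rintegral_cauchy_schwarz mD (sqint_cst adm 1) sz)).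
  under [X in X * _]eq_Rintegral do rewrite expr1n.
  by rewrite Rintegral_cst// mul1r -dE mulrC ler_pM2r.
exists s0; split => // s sge0 ss0.
have s1 : s <= 2^-1 := le_trans ss0 s01.
have [ls0 Hs _] := first_eigenP adm sge0 s1.
have hv : hspace s v by split; [exact: sv|exact: (kform_half_lty adm)].
have hw := hspace_addc adm (- mean v) hv.
have := Hs _ hw (Rintegral_center adm sv).
rewrite energy_addc energyC energy_addc dotp_center// => H.
have Es : 2 * energy s v v <= (1 + dl) * (2 * l) + (1 + dl^-1) * dl ^+ 2 + dl.
  rewrite -lee_fin (energy_kform adm hv); apply: (le_trans (Hs0 s sge0 ss0)).
  by rewrite [leRHS]EFinD; apply: leeD.
have dlE : (1 + dl^-1) * dl ^+ 2 = dl ^+ 2 + dl by field; rewrite gt_eqF.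
rewrite dlE in Es.
have d3 : dl ^+ 2 <= dl by rewrite expr2 ler_piMl// ltW.
apply: (small_perturbation l0 e0 dl0 dle).
exact: (perturbed_quotient (ltW ls0) (ltW dl0) H Es d3 vv vm).
Qed.

Lemma first_eigen_near e : 0 < e -> exists s0, [/\ 0 < s0, s0 <= 2^-1 &
  forall s, 0 <= s -> s <= s0 -> `|lam 0 - lam s| <= e].
Proof.
move=> e0; have [l0 _ _] := first_eigenP adm (lexx 0) half_ge0.
have [s0 [s00 s01 Hs0]] := first_eigen_limsup e0.
have e10 : 0 < e / (lam 0 + 1) by rewrite divr_gt0// addr_gt0.
have [s2 s20 Hs2] := powR_small_exponent (adm_M1 adm) e10.
exists (Num.min s0 s2); split; first by rewrite lt_min s00.
  by rewrite ge_min s01.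
move=> s sge0; rewrite le_min => /andP[ss0 ss2].
have s1 : s <= 2^-1 := le_trans ss0 s01.
have [ls0 _ _] := first_eigenP adm sge0 s1.
have h1 := Hs0 s sge0 ss0.
have h2 := first_eigen0_le sge0 s1; have h3 := Hs2 s sge0 ss2.
have ae := divfK (lt0r_neq0 (addr_gt0 l0 ltr01)) e.
apply: (quotient_dist e0 (ltW e10) ae _ h1).
exact: le_trans h2 (ler_wpM2r (ltW ls0) h3).
Qed.

Lemma first_eigen_cvg : lam s @[s --> 0^'+] --> lam 0.
Proof.
apply/cvgrPdist_le => e e0.
have [s0 [s00 _ Hs0]] := first_eigen_near e0.
near=> s; apply: Hs0; first by apply: ltW; near: s; exact: nbhs_right_gt.
by near: s; exact: nbhs_right_le.
Unshelve. all: by end_near. Qed.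

(** The limit has norm 1, mean zero and energy of order 0 at most [lam 0], so [minimizer_is_eigen]
    applies. Semicontinuity is used at order 0 throughout, the varying orders entering only through
    the bounds [Q0], whose right-hand sides tend to [2 lam 0]. *)
Lemma eigenfunctions_converge (sk : nat -> R) (xi : nat -> T -> R) :
  (forall k, 0 < sk k) -> sk @ \oo --> 0 ->
  (forall k, is_eigen (sk k) (lam (sk k)) (xi k)) ->
  (forall k, (\int[mu]_(x in D) ((xi k x) ^+ 2)%:E = 1)%E) ->
  exists (phi : nat -> nat) (v : T -> R),
    [/\ (forall i j, (i < j)%N -> (phi i < phi j)%N), is_eigen 0 (lam 0) v &
     (fun k => (\int[mu]_(x in D) ((xi (phi k) x - v x) ^+ 2)%:E)%E) @ \oo --> 0%E].
Proof.
move=> sk0 skc Hxi xi1.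
have [l0 H0 _] := first_eigenP adm (lexx 0) half_ge0.
have eventually_le s : 0 < s -> exists N, forall k, (N <= k)%N -> sk k <= s.
  move=> s0; have /cvgrPdist_lt/(_ _ s0)[N _ HN] := skc.
  exists N => k Nk; have := HN k Nk; rewrite /= sub0r normrN => h.
  by apply: ltW; apply: le_lt_trans (ler_norm _) h.
have [s1 [s10 s1h Hs1]] := first_eigen_near ltr01.
have [k0 Hk0] := eventually_le _ s10.
(* The first [k0] terms are dropped so that all orders are at most 1/2 and all eigenvalues within 1
   of [lam 0]. *)
pose u k := xi (k0 + k)%N; pose s k := sk (k0 + k)%N.
have ss1 k : s k <= s1 by apply: Hk0; exact: leq_addr.
have sh k : s k <= 2^-1 := le_trans (ss1 k) s1h.
have sge0 k : 0 <= s k := ltW (sk0 _).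
have hu k : hspace (s k) (u k) by have [] := Hxi (k0 + k)%N.
have su k : sqint mu D (u k) := (hu k).1.
have dE (f : T -> R) : ip f f = \int[mu]_(x in D) (f x ^+ 2).
  by apply: eq_Rintegral => x _; rewrite expr2.
have u1 k : ip (u k) (u k) = 1 by rewrite dE /Rintegral xi1.
have um k : \int[mu]_(x in D) u k x = 0 /\ energy (s k) (u k) (u k) = lam (s k).
  have [ls0 _ _] := first_eigenP adm (sge0 k) (sh k).
  have [m0 E] := eigen_mean adm ls0 (Hxi (k0 + k)%N).
  by split => //; rewrite E -[xi _]/(u k) u1 mulr1.
have Q0 k : (Q (fker 0) (u k) <= (2 * (M `^ (2 * s k) * lam (s k)))%:E)%E.
  rewrite -(energy_kform adm (hspace0 (sge0 k) (hu k))) lee_fin ler_pM2l//.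
  by rewrite -(um k).2; exact: energy0_le.
have M0 : 0 <= M by apply: le_trans (adm_M1 adm).
(* As [2 s k <= 1] and [1 <= M], the factor [M^(2 s k)] is at most [M]. *)
pose B := 1 + 2 * (M * (lam 0 + 1)).
have B10 : 0 <= 2 * (M * (lam 0 + 1)) by rewrite mulr_ge0// mulr_ge0// addr_ge0// ltW.
have B0 : 0 <= B by rewrite addr_ge0.
have [||phi [v [phiS sv uv]]] := @compact_embedding _ _ _ mu n D rho M adm u B B0 su.
- by move=> k; rewrite xi1 lee_fin /B lerDl.
- move=> k; apply: (le_trans (Q0 k)); rewrite lee_fin /B.
  apply: (@le_trans _ _ (2 * (M * (lam 0 + 1)))); last by rewrite lerDr.
  have [ls0 _ _] := first_eigenP adm (sge0 k) (sh k).
  rewrite ler_pM2l//; apply: ler_pM; rewrite ?powR_ge0 ?(ltW ls0)//.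
    rewrite -[leRHS]powRr1//; apply: ler_powR; first exact: adm_M1 adm.
    by rewrite -ler_pdivlMl// mulr1; exact: sh.
  by have := Hs1 _ (sge0 k) (ss1 k); rewrite ler_distlC => /andP[].
have phij j : (j <= phi j)%N.
  by elim: j => // j IH; apply: leq_ltn_trans IH _; exact: phiS.
have [v1 v0] := L2_limit adm (fun j => su (phi j)) sv uv
  (fun j => u1 (phi j)) (fun j => (um (phi j)).1).
have Qv : (Q (fker 0) v <= (2 * lam 0)%:E)%E.
  apply: (kform_lsc adm (mfker 0) _ (fun j => su (phi j)) sv uv); first by rewrite mulr_ge0// ltW.
  move=> e e0.
  (* The common tolerance for [lam (s k)] and for [M^(2 s k)], fitted to [product_perturbation]. *)
  pose a := Num.min 1 (e / 2 / (lam 0 + 2)).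
  have l20 : 0 < lam 0 + 2 by rewrite addr_gt0.
  have a0 : 0 < a by rewrite lt_min ltr01 !divr_gt0.
  have a1 : a <= 1 by rewrite ge_min lexx.
  have ae : a * (lam 0 + 2) <= e / 2 by rewrite -ler_pdivlMr// ge_min lexx orbT.
  have [s2 [s20 _ Hs2]] := first_eigen_near a0.
  have [s3 s30 Hs3] := powR_small_exponent (adm_M1 adm) a0.
  have s230 : 0 < Num.min s2 s3 by rewrite lt_min s20.
  have [N HN] := eventually_le _ s230.
  exists N => j Nj; apply: (le_trans (Q0 _)); rewrite lee_fin.
  have : s (phi j) <= Num.min s2 s3.
    by apply: HN; rewrite (leq_trans Nj)// (leq_trans (phij j))// leq_addl.
  rewrite le_min => /andP[ja jb].
  have h1 := Hs2 _ (sge0 _) ja; have h2 := Hs3 _ (sge0 _) jb.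
  rewrite ler_distlC in h1; have /andP[_ h1'] := h1.
  have [ls0 _ _] := first_eigenP adm (sge0 (phi j)) (sh (phi j)).
  apply: (product_perturbation (ltW a0) a1 ae).
  by apply: ler_pM; rewrite ?powR_ge0 ?(ltW ls0).
have hv : hspace 0 v.
  split; first exact: sv.
  apply: le_lt_trans Qv _; exact: ltry.
exists (fun k => k0 + phi k)%N, v; split.
- by move=> i j ij; rewrite ltn_add2l phiS.
- apply: (minimizer_is_eigen adm H0) => //; first by rewrite v1.
  by rewrite v1 mulr1; move: Qv; rewrite -(energy_kform adm hv) lee_fin ler_pM2l.
- apply: (@squeeze_cvge _ _ _ _ (cst 0%E) _ (fun k => ((16^-1 : R) ^+ k)%:E)).
  + by apply: nearW => k /=; rewrite uv andbT; apply: integral_ge0 => x _; rewrite lee_fin sqr_ge0.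
  + exact: cvg_cst.
  + apply: cvg_EFin; first exact: nearW.
    by apply: cvg_expr; rewrite ger0_norm; lra.
Qed.

End small_order_limit.

(** * Lebesgue measure on R^(n+1) *)

Section coordinates.
Variable R : realType.

Local Notation X n := (projT2 (RN R n)).
Local Notation coord := (@Defs.coord R).
Local Notation to_vec := (@to_vec R _).
Local Notation leb n := (lebN R n).

Fixpoint of_coord (n : nat) (c : nat -> R) : X n :=
  match n return X n with
  | 0 => c 0%N
  | n'.+1 => (of_coord n' c, c n'.+1)
  end.

Lemma coord_of_coord n c i : (i <= n)%N -> coord (of_coord n c) i = c i.
Proof.
elim: n => [|n IH] /=; first by rewrite leqn0 => /eqP ->.
by rewrite leq_eqVlt ltnS; case: eqP => [->//|_] /=; exact: IH.
Qed.

Lemma coord_inj n (x y : X n) : (forall i, (i <= n)%N -> coord x i = coord y i) -> x = y.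
Proof.
elim: n x y => [x y /(_ 0%N (leqnn _))//|n IH [x1 x2] [y1 y2] H].
have := H n.+1 (leqnn _); rewrite /= eqxx => ->.
congr pair; apply: IH => i ilen.
by have := H i (leqW ilen); rewrite /= ltn_eqF.
Qed.

Lemma measurable_coord n i : measurable_fun setT (fun x : X n => coord x i).
Proof.
elim: n => [|n IH] /=; first exact: measurable_id.
case: eqP => _; first exact: measurable_snd.
exact: (measurableT_comp IH measurable_fst).
Qed.

Definition of_vec n (v : 'rV[R]_n.+1) : X n := of_coord n (fun i => v ord0 (inord i)).

Lemma to_vecK n (x : X n) : of_vec (to_vec x) = x.
Proof.
apply: coord_inj => i ilen; rewrite coord_of_coord// mxE.
by rewrite inordK.
Qed.

Lemma of_vecK n (v : 'rV[R]_n.+1) : to_vec (of_vec v) = v.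
Proof.
apply/rowP => i; rewrite mxE coord_of_coord; last by rewrite -ltnS.
by rewrite inord_val.
Qed.

(** The topology of row vectors is given by the sup norm, so balls are boxes and their measure is a
    product of lengths. *)
Lemma ball_to_vec n (c : 'rV[R]_n.+1) (h : R) : 0 < h -> to_vec @^-1` ball c h =
  [set x | forall i, (i <= n)%N -> `|c ord0 (inord i) - coord x i| < h].
Proof.
move=> h0; apply/seteqP; split => x /=.
  move=> [_ H] i ilen; have := H ord0 (inord i).
  by rewrite /ball /= mxE inordK.
move=> H; split=> // i j; rewrite /ball/= mxE (ord1 i).
by have := H j (ltn_ord j); rewrite inord_val.
Qed.

Lemma measurable_lebesgue_ball (c h : R) : 0 <= h ->
  measurable ([set x | `|c - x| < h] : set (measurableTypeR R)) /\
  lebesgue_measure ([set x | `|c - x| < h] : set (measurableTypeR R)) = (2 * h)%:E.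
Proof.
move=> h0; have -> : [set x | `|c - x| < h] = ball c h by [].
split; first exact: measurable_ball.
by rewrite lebesgue_measure_ball// mulr_natl.
Qed.

Lemma box_measure n (c : nat -> R) (h : R) : 0 <= h ->
  measurable [set x : X n | forall i, (i <= n)%N -> `|c i - coord x i| < h] /\
  leb n [set x : X n | forall i, (i <= n)%N -> `|c i - coord x i| < h] = ((2 * h) ^+ n.+1)%:E.
Proof.
move=> h0; elim: n => [|n [mIH IH]].
  have -> : [set x : X 0 | forall i, (i <= 0)%N -> `|c i - coord x i| < h] =
      [set x | `|c 0%N - x| < h].
    apply/seteqP; split => x /=; first by move/(_ 0%N (leqnn _)).
    by move=> H i; rewrite leqn0 => /eqP ->.
  by rewrite expr1; exact: measurable_lebesgue_ball.
have -> : [set x : X n.+1 | forall i, (i <= n.+1)%N -> `|c i - coord x i| < h] =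
    [set x : X n | forall i, (i <= n)%N -> `|c i - coord x i| < h] `*`
    [set x | `|c n.+1 - x| < h].
  apply/seteqP; split => -[x y] /=.
    move=> H; split; last by have := H n.+1 (leqnn _); rewrite eqxx.
    by move=> i ilen; have := H i (leqW ilen); rewrite ltn_eqF.
  move=> [H1 H2] i; rewrite leq_eqVlt ltnS; case: eqP => [->//|_] /=; exact: H1.
have [m2 E2] := measurable_lebesgue_ball (c n.+1) h0.
split; first exact: measurableX.
rewrite /= /pmeasure product_measure1E// exprSr EFinM.
by congr (_ * _)%E.
Qed.

Lemma measurable_ball_to_vec n (c : 'rV[R]_n.+1) (h : R) : 0 < h ->
  measurable (to_vec @^-1` ball c h).
Proof.
move=> h0; rewrite ball_to_vec//.
by have [] := box_measure n (fun i => c ord0 (inord i)) (ltW h0).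
Qed.

Lemma lebN_ball n (c : 'rV[R]_n.+1) (h : R) : 0 < h ->
  leb n (to_vec @^-1` ball c h) = ((2 * h) ^+ n.+1)%:E.
Proof.
move=> h0; rewrite ball_to_vec//.
by have [] := box_measure n (fun i => c ord0 (inord i)) (ltW h0).
Qed.

(** An open set is a countable union of the cubes with rational centre and radius that it contains.
    A cube through [x] of radius below [e / 2] stays within [e] of [x]. *)
Lemma measurable_open_to_vec n (A : set 'rV[R]_n.+1) : open A -> measurable (to_vec @^-1` A).
Proof.
move=> oA.
pose F k : set (X n) := if (unpickle k : option ('rV[rat]_n.+1 * rat)) is Some qr then
   if `[< 0 < qr.2 /\ ball (map_mx ratr qr.1 : 'rV[R]_n.+1) (ratr qr.2 : R) `<=` A >] then
     to_vec @^-1` ball (map_mx ratr qr.1 : 'rV[R]_n.+1) (ratr qr.2 : R) else set0 else set0.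
have -> : to_vec @^-1` A = \bigcup_k F k.
  apply/seteqP; split => x /=; last first.
    move=> [k _]; rewrite /F; case: unpickle => //= -[q r] /=.
    by case: asboolP => // -[_ qrA] /qrA.
  move=> Ax; have /nbhs_ballP[e /= e0 eA] : nbhs (to_vec x) A by exact: open_nbhs_nbhs.
  have [r r0 re] : exists2 r : rat, 0 < r & (ratr r : R) < e / 2.
    have e20 : 0 < e / 2 by rewrite divr_gt0.
    have [r] := rat_in_itvoo e20; rewrite in_itv /= => /andP[r0 r1].
    by exists r => //; rewrite -(ltr0q R).
  have r0' : (0 : R) < ratr r by rewrite ltr0q.
  have /choice[q Hq] (i : 'I_n.+1) : exists q : rat,
      `|ratr q - to_vec x ord0 i| < (ratr r : R).
    have [|q] := @rat_in_itvoo R (to_vec x ord0 i - ratr r) (to_vec x ord0 i + ratr r).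
      by rewrite ltrBlDr -addrA ltrDl addr_gt0.
    by rewrite in_itv /= -ltr_distl => h; exists q.
  exists (pickle (\row_i q i, r)) => //; rewrite /F pickleK /=.
  case: asboolP => [_|[]].
    by split => // i j; rewrite !mxE; have := Hq j; rewrite mxE.
  split => // y [_ yq]; apply: eA; split => // i j; rewrite (ord1 i) /ball /=.
  have := yq ord0 j; have := Hq j; rewrite /ball /= !mxE => h1 h2.
  have -> : coord x j - y ord0 j = (ratr (q j) - y ord0 j) - (ratr (q j) - coord x j) by ring.
  apply: (le_lt_trans (ler_normB _ _)); lra.
apply: bigcup_measurable => k _; rewrite /F; case: unpickle => [[q r]|]//.
case: asboolP => [[r0 _]|_] //; apply: measurable_ball_to_vec.
by rewrite ltr0q.
Qed.

End coordinates.

(** * The Euclidean norm of row vectors *)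

Section euclidean_norm.
Variable R : realType.
Implicit Types m : nat.

Lemma eucl_ge0 m (v : 'rV[R]_m) : 0 <= eucl v.
Proof. exact: sqrtr_ge0. Qed.

Lemma eucl_sqr m (v : 'rV[R]_m) : eucl v ^+ 2 = \sum_i (v ord0 i) ^+ 2.
Proof. by rewrite sqr_sqrtr// sumr_ge0// => i _; rewrite sqr_ge0. Qed.

Lemma euclN m (v : 'rV[R]_m) : eucl (- v) = eucl v.
Proof. by congr Num.sqrt; apply: eq_bigr => i _; rewrite mxE sqrrN. Qed.

Lemma coord_le_eucl m (v : 'rV[R]_m) i : `|v ord0 i| <= eucl v.
Proof.
rewrite -[leRHS]ger0_norm ?eucl_ge0// -ler_sqr ?nnegrE// !real_normK ?num_real//.
rewrite eucl_sqr (bigD1 i)//= lerDl sumr_ge0// => j _; exact: sqr_ge0.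
Qed.

Lemma eucl_eq0 m (v : 'rV[R]_m) : (eucl v == 0) = (v == 0).
Proof.
apply/eqP/eqP => [v0|->]; last first.
  by rewrite /eucl big1 ?sqrtr0// => i _; rewrite mxE expr0n.
apply/rowP => i; rewrite mxE; apply/eqP; rewrite -normr_le0 -v0.
exact: coord_le_eucl.
Qed.

Lemma sum_cauchy_schwarz m (u v : 'rV[R]_m) :
  (\sum_i u ord0 i * v ord0 i) ^+ 2 <= (\sum_i (u ord0 i) ^+ 2) * \sum_i (v ord0 i) ^+ 2.
Proof.
apply: ge0_discriminant; first by apply: sumr_ge0 => i _; exact: sqr_ge0.
move=> t; rewrite !mulr_sumr -sumrB -big_split/=; apply: sumr_ge0 => i _.
have -> : v ord0 i ^+ 2 - 2 * t * (u ord0 i * v ord0 i) + t ^+ 2 * u ord0 i ^+ 2 =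
  (v ord0 i - t * u ord0 i) ^+ 2 by ring.
exact: sqr_ge0.
Qed.

Lemma euclD m (u v : 'rV[R]_m) : eucl (u + v) <= eucl u + eucl v.
Proof.
have u0 := eucl_ge0 u; have v0 := eucl_ge0 v.
rewrite -[leRHS]ger0_norm ?addr_ge0// -[leLHS]ger0_norm ?eucl_ge0//.
rewrite -ler_sqr ?nnegrE// !real_normK ?num_real// eucl_sqr.
under eq_bigr do rewrite mxE sqrrD.
rewrite !big_split/= -eucl_sqr -eucl_sqr sqrrD lerD2r lerD2l.
rewrite -mulr2n -[leLHS]mulr_natr -[leRHS]mulr_natr.
rewrite ler_wpM2r//; apply: (le_trans (ler_norm _)).
rewrite -[leRHS]ger0_norm ?mulr_ge0// -ler_sqr ?nnegrE// !real_normK ?num_real//.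
by rewrite exprMn !eucl_sqr; exact: sum_cauchy_schwarz.
Qed.

Lemma eucl_le_sup m (v : 'rV[R]_m) (h : R) : 0 <= h ->
  (forall i, `|v ord0 i| <= h) -> eucl v <= m%:R * h.
Proof.
move=> h0 vh; have mh0 : 0 <= m%:R * h by rewrite mulr_ge0.
rewrite -[leRHS]ger0_norm// -[leLHS]ger0_norm ?eucl_ge0//.
rewrite -ler_sqr ?nnegrE// !real_normK ?num_real// eucl_sqr.
apply: (@le_trans _ _ (\sum_(i < m) h ^+ 2)).
  apply: ler_sum => i _; rewrite -(real_normK (num_real (v ord0 i))).
  by apply: lerXn2r; rewrite ?nnegrE.
rewrite sumr_const card_ord -[leLHS]mulr_natl exprMn ler_wpM2r ?sqr_ge0//.
by rewrite -natrX ler_nat; case: m {v vh mh0} => // m; rewrite expnS expn1 leq_pmulr.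
Qed.

Lemma eucl_ball m (c v : 'rV[R]_m) h : ball c h v -> eucl (c - v) <= m%:R * h.
Proof.
move=> [h0 cv]; apply: eucl_le_sup; first exact: ltW.
by move=> i; rewrite !mxE; apply: ltW; exact: cv.
Qed.

Lemma eucl_rotation m (Q : 'M[R]_m) (v : 'rV[R]_m) : Q^T *m Q = 1%:M ->
  eucl (v *m Q) = eucl v.
Proof.
move=> /mulmx1C QQ; congr Num.sqrt.
have E (u : 'rV[R]_m) : \sum_i u ord0 i ^+ 2 = (u *m u^T) ord0 ord0.
  by rewrite mxE; apply: eq_bigr => i _; rewrite mxE expr2.
by rewrite !E trmx_mul mulmxA -(mulmxA v) QQ mulmx1.
Qed.

Lemma eucl_widen n (v : 'rV[R]_n.+1) :
  eucl (\row_(i < n) v ord0 (widen_ord (leqnSn n) i)) <= eucl v.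
Proof.
rewrite ler_wsqrtr// big_ord_recr/=.
under eq_bigr do rewrite mxE.
by rewrite lerDl sqr_ge0.
Qed.

End euclidean_norm.

(** * R^(n+1) as a metric measure space *)

Section euclidean_space.
Variable R : realType.
Variable n : nat.

Local Notation X := (projT2 (RN R n)).
Local Notation to_vec := (@to_vec R n).
Local Notation leb := (lebN R n).

Definition rn_dist (x y : X) : R := eucl (to_vec x - to_vec y).

Lemma rn_dist_ge0 x y : 0 <= rn_dist x y. Proof. exact: eucl_ge0. Qed.

Lemma rn_distC x y : rn_dist x y = rn_dist y x.
Proof. by rewrite /rn_dist -euclN opprB. Qed.

Lemma rn_dist_tri x y z : rn_dist x z <= rn_dist x y + rn_dist y z.
Proof.
rewrite /rn_dist; have -> : to_vec x - to_vec z = (to_vec x - to_vec y) + (to_vec y - to_vec z).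
  by rewrite addrA subrK.
exact: euclD.
Qed.

Lemma rn_dist_eq0 x y : (rn_dist x y == 0) = (x == y).
Proof.
rewrite /rn_dist eucl_eq0 subr_eq0; apply/eqP/eqP => [E|->//].
by rewrite -(to_vecK x) E to_vecK.
Qed.

Lemma measurable_rn_dist : measurable_fun setT (fun z : X * X => rn_dist z.1 z.2).
Proof.
have mc (i : 'I_n.+1) : measurable_fun setT (fun z : X * X => to_vec z.1 ord0 i - to_vec z.2 ord0 i).
  apply: measurable_funB.
    apply: (@eq_measurable_fun _ _ _ _ _ (fun z : X * X => Defs.coord z.1 i)).
      by move=> z _; rewrite mxE.
    exact: (measurableT_comp (@measurable_coord R n i) measurable_fst).
  apply: (@eq_measurable_fun _ _ _ _ _ (fun z : X * X => Defs.coord z.2 i)).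
    by move=> z _; rewrite mxE.
  exact: (measurableT_comp (@measurable_coord R n i) measurable_snd).
apply: (@eq_measurable_fun _ _ _ _ _ (fun z : X * X =>
    (\sum_(i < n.+1) (to_vec z.1 ord0 i - to_vec z.2 ord0 i) ^+ 2) `^ (2^-1))).
  move=> z _; rewrite powR12_sqrt; last by apply: sumr_ge0 => i _; exact: sqr_ge0.
  by rewrite /rn_dist /eucl; congr Num.sqrt; apply: eq_bigr => i _; rewrite !mxE.
apply: (measurableT_comp (measurable_powR _)).
by apply: measurable_sum => i; exact: measurable_funX.
Qed.

(** Dyadic decomposition: the shell between the radii [r j.+1] and [r j] lies in a cube of side
    [2 r j], where the integrand is replaced by its value at [r j.+1]. The contributions are
    proportional to [2^-j], and their sum is exactly [4^(n+1) t]. *)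
Lemma rn_dist_pow_int (D : set X) (t : R) x : measurable D -> 0 < t ->
  (\int[leb]_(y in D `&` [set y | (rn_dist x y < t)%R]) (rn_dist x y ^- n)%:E <=
   (4 ^+ n.+1 * t)%:E)%E.
Proof.
move=> mD t0.
pose r j : R := t * (2^-1) ^+ j.
have r0 j : 0 < r j by rewrite mulr_gt0// exprn_gt0.
pose Bj j := to_vec @^-1` ball (to_vec x) (r j).
pose f j (y : X) : \bar R := (((r j.+1) ^- n) * \1_(Bj j) y)%:E.
have mB j : measurable (Bj j) by exact: measurable_ball_to_vec.
have f0 j y : (0 <= f j y)%E.
  by rewrite lee_fin mulr_ge0// invr_ge0 exprn_ge0// ltW.
have mf j : measurable_fun setT (f j).
  apply/measurable_EFinP; apply: measurable_funM; first exact: measurable_cst.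
  exact: measurable_indic.
have mr : measurable_fun setT (rn_dist x).
  exact: (measurableT_comp measurable_rn_dist (pair1_measurable x)).
have mS : measurable [set y | (rn_dist x y < t)%R].
  have := mr measurableT _ (measurable_itv `]-oo, t[).
  by rewrite setTI; congr measurable; apply/seteqP; split => y /=; rewrite in_itv.
have mrn : measurable_fun setT (fun y => (rn_dist x y ^- n)%:E).
  apply/measurable_EFinP/measurable_fun_inv_ge0; last exact: measurable_funX.
  by move=> y _; rewrite exprn_ge0// rn_dist_ge0.
apply: (@le_trans _ _ (\int[leb]_(y in D `&` [set y | (rn_dist x y < t)%R]) (\sum_(j <oo) f j y))%E).
  apply: ge0_le_integral => //.
  - exact: measurableI.
  - by move=> y _; rewrite lee_fin invr_ge0 exprn_ge0// rn_dist_ge0.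
  - exact: measurable_funTS.
  - by apply: measurable_funTS; exact: ge0_emeasurable_sum.
  move=> y [_ /= xyt].
  have [j yB yr] : exists2 j, Bj j y & (rn_dist x y ^- n <= r j.+1 ^- n)%R.
    (* At [y = x] the integrand is 0 by convention, except for [n = 0], where it is 1. *)
    have [xy|xy] := eqVneq x y.
      exists 0%N; first by rewrite /Bj xy; exact: ballxx.
      move: (rn_dist_eq0 x y); rewrite xy eqxx => /eqP ->.
      case: n => [|k]; first by rewrite !expr0.
      rewrite expr0n/= invr0 invr_ge0 exprn_ge0// ltW//.
    have e0 : 0 < rn_dist x y by rewrite lt_def rn_dist_ge0 rn_dist_eq0 xy.
    have [j rj] : exists j, r j <= rn_dist x y.
      have cv : r @ \oo --> 0.
        rewrite -[X in _ --> X](mulr0 t); apply: cvgM; first exact: cvg_cst.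
        by apply: cvg_expr; rewrite ger0_norm; lra.
      have /cvgrPdist_lt/(_ _ e0)[N _ HN] := cv.
      exists N; have := HN N (leqnn N); rewrite /= sub0r normrN => h.
      exact: ltW (le_lt_trans (ler_norm _) h).
    (* The least index whose radius is at most the distance; it is not 0, since [r 0 = t] exceeds
       the distance. *)
    have [k] := ex_minnP (ex_intro (fun j => r j <= rn_dist x y) j rj).
    case: k => [|k] rk kmin.
      by move: rk; rewrite /r expr0 mulr1 leNgt xyt.
    exists k.
      rewrite /Bj /=; split => // a i; rewrite (ord1 a) /ball /=.
      have := coord_le_eucl (to_vec x - to_vec y) i; rewrite !mxE => h.
      apply: (le_lt_trans h); rewrite ltNge; apply/negP => /kmin.
      by rewrite ltnn.
    rewrite lef_pV2 ?posrE ?exprn_gt0//.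
    by apply: lerXn2r; rewrite ?nnegrE ?(ltW (r0 _)) ?rn_dist_ge0.
  rewrite (nneseriesD1 (n := j))//; apply: (@le_trans _ _ (f j y)).
    by rewrite /f lee_fin indicE mem_set ?mulr1.
  by rewrite leeDl// nneseries_ge0.
apply: (@le_trans _ _ (\int[leb]_y (\sum_(j <oo) f j y))%E).
  apply: ge0_subset_integral => //.
  - exact: measurableI.
  - exact: ge0_emeasurable_sum.
  - by move=> y _; exact: nneseries_ge0.
rewrite integral_nneseries//.
have If j : (\int[leb]_y f j y = (2 ^+ n * 2 ^+ n.+1 * t * (2^-1) ^+ j)%:E)%E.
  rewrite /f; under eq_integral do rewrite EFinM.
  rewrite ge0_integralZl_EFin//.
  - rewrite integral_indic// setIT.
    transitivity ((r j.+1 ^- n)%:E * ((2 * r j) ^+ n.+1)%:E)%E.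
      by congr (_ * _)%E; exact: lebN_ball.
    rewrite -EFinM; congr EFin.
    have -> : r j = 2 * r j.+1 by rewrite /r exprS; field.
    have -> : 2 ^+ n * 2 ^+ n.+1 * t * 2^-1 ^+ j = 2 ^+ n * 2 ^+ n.+1 * 2 * r j.+1.
      by rewrite /r [2^-1 ^+ j.+1]exprS; field.
    move: (r j.+1) (r0 j.+1) => q q0.
    have qn0 : q ^+ n != 0 by rewrite expf_neq0// gt_eqF.
    by rewrite !exprMn !exprS; field.
  - apply/measurable_EFinP; exact: measurable_indic.
  - by rewrite invr_ge0 exprn_ge0// ltW.
under eq_eseriesr do rewrite If.
set c := 2 ^+ n * 2 ^+ n.+1 * t.
have hlt : `|2^-1 : R| < 1 by rewrite ger0_norm; lra.
rewrite (_ : (fun m => _) = EFin \o series (geometric c 2^-1)); last first.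
  by apply/funext => m /=; rewrite /series/= sumEFin.
rewrite EFin_lim; last exact: is_cvg_geometric_series.
rewrite (cvg_lim _ (@cvg_geometric_series R c 2^-1 hlt))// lee_fin /c.
have -> : (4 : R) ^+ n.+1 = 2 ^+ n.+1 * 2 ^+ n.+1.
  by rewrite -exprMn; congr (_ ^+ _); ring.
by rewrite !exprS le_eqVlt; apply/orP; left; apply/eqP; field.
Qed.

End euclidean_space.

(** * Interior cones of Lipschitz sets *)

Section lipschitz_geometry.
Variable R : realType.
Variable n : nat.

Local Notation X := (projT2 (RN R n)).
Local Notation V := 'rV[R]_n.+1.
Local Notation to_vec := (@to_vec R n).
Local Notation leb := (lebN R n).
Local Notation N := (n.+1%:R : R).

Lemma bdryE (O : set V) : open O -> bdry O = closure O `\` O.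
Proof. by move=> oO; rewrite /bdry (proj1 (interior_id O) oO). Qed.

(* The trace of O on the segment is open and, as the segment avoids the boundary,
   also closed. *)
Lemma segment_in (O : set V) (x h : V) : open O -> O x ->
  (forall t : R, 0 <= t <= 1 -> ~ bdry O (x + t *: h)) -> O (x + h).
Proof.
move=> oO Ox Hb.
pose g (t : R) : V := x + t *: h.
have cg : continuous g.
  move=> t; apply: cvgD; first exact: cvg_cst.
  by apply: cvgZr_tmp; exact: cvg_id.
pose B := `[0, 1]%classic `&` g @^-1` O.
have BE : B = `[(0 : R), 1]%classic.
  apply: (segment_connected).
  - exists 0; split => /=; first by rewrite in_itv /= lexx ler01.
    by rewrite /g scale0r addr0.
  - by exists (g @^-1` O) => //; apply: open_comp => // t _; exact: cg.
  - exists (g @^-1` closure O).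
      by apply: preimage_closed; [move=> t _; exact: cg|exact: closed_closure].
    apply/seteqP; split => t [t01 Ot]; split => //; first exact: subset_closure.
    apply: contrapT => nO; move: t01; rewrite /= in_itv /= => t01; apply: (Hb t t01).
    by rewrite bdryE.
have : B 1 by rewrite BE /= in_itv /= ler01 lexx.
by move=> [_]; rewrite /g /= scale1r.
Qed.

(* [ball] is the ball of the sup norm, hence a cube. *)
Definition has_cubes (O : set V) (x v : V) (eta : R) :=
  forall t : R, 0 < t -> t <= 1 -> ball (x + t *: v) (t * eta) `<=` O.

Lemma ball_coord (x y : V) (e : R) : 0 < e -> ball x e y <-> forall i, `|x ord0 i - y ord0 i| < e.
Proof.
move=> e0; split => [[_ H] i|H]; first exact: H.
by split => // a i; rewrite (ord1 a); exact: H.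
Qed.

Lemma cubes_interior (O : set V) p : open O -> O p ->
  exists (r : R) (v : V) (eta : R) (i : 'I_n.+1), [/\ 0 < r, 0 < eta, 2 * eta <= `|v ord0 i| &
    forall x, O x -> ball p r x -> has_cubes O x v eta].
Proof.
move=> oO Op; have /nbhs_ballP[e /= e0 eO] : nbhs p O by exact: open_nbhs_nbhs.
pose r := e / 4; have r0 : 0 < r by rewrite divr_gt0.
exists r, (const_mx (2 * r)), r, ord0; split => //.
  by rewrite mxE ger0_norm// mulr_ge0// ltW.
move=> x _ px t t0 t1 y xy; apply: eO.
have te0 : 0 < t * r by rewrite mulr_gt0.
move/(ball_coord _ _ r0) : px => px; move/(ball_coord _ _ te0) : xy => xy.
apply/(ball_coord _ _ e0) => i; have := px i; have := xy i; rewrite !mxE => h1 h2.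
have -> : p ord0 i - y ord0 i = (p ord0 i - x ord0 i) + ((x ord0 i + t * (2 * r)) - y ord0 i) - t * (2 * r).
  by ring.
apply: (le_lt_trans (ler_normB _ _)); rewrite (ger0_norm (_ : 0 <= t * (2 * r))); last first.
  by rewrite !mulr_ge0// ltW.
apply: (@le_lt_trans _ _ (`|p ord0 i - x ord0 i| + `|x ord0 i + t * (2 * r) - y ord0 i| + t * (2 * r))).
  by rewrite lerD2r ler_normD.
have tr : t * r <= r by rewrite ler_piMl// ltW.
have -> : e = 4 * r by rewrite /r; field.
lra.
Qed.

(* In coordinates where the boundary is the graph of an L-Lipschitz function, a
   vertical cone with slope larger than L stays on the side of its apex. *)
Lemma cubes_boundary (O : set V) p : open O -> bdry O p -> lipschitz_set O ->
  exists (r : R) (v : V) (eta : R) (i : 'I_n.+1), [/\ 0 < r, 0 < eta, 2 * eta <= `|v ord0 i| &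
    forall x, O x -> ball p r x -> has_cubes O x v eta \/ has_cubes O x (- v) eta].
Proof.
move=> oO bp lO; have [U [Q [g [Up [QQ _] [L0 gL0] HU]]]] := lO p bp.
(* [L0] comes without a sign. *)
pose L := `|L0|.
have L_ge0 : 0 <= L by exact: normr_ge0.
have gL a b : `|g a - g b| <= L * eucl (a - b).
  by apply: (le_trans (gL0 a b)); rewrite ler_wpM2r ?eucl_ge0// ler_norm.
move/nbhs_ballP : Up => [e /= e0 eU].
have [r r0 re] : exists2 r, 0 < r & e = 4 * r.
  by exists (e / 4); [rewrite divr_gt0|field].
(* The unit vector that is vertical in the rotated coordinates. *)
have [w wQ] : exists w : V, w *m Q = delta_mx ord0 ord_max.
  by exists (delta_mx ord0 ord_max *m Q^T); rewrite -mulmxA QQ mulmx1.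
have w1 : eucl w = 1.
  rewrite -(eucl_rotation _ QQ) wQ /eucl (bigD1 ord_max)//= mxE !eqxx expr1n big1 ?addr0 ?sqrtr1//.
  by move=> i; rewrite mxE => /negbTE ->; rewrite andbF expr0n.
have [i wi] : exists i, w ord0 i != 0.
  apply: contrapT => /forallNP H; have : w = 0.
    by apply/rowP => i; rewrite mxE; apply/eqP/negPn/negP; exact: H.
  by move/eqP; rewrite -eucl_eq0 w1 oner_eq0.
have wi0 : 0 < `|w ord0 i| by rewrite normr_gt0.
have N0 : 0 < N by [].
have NL0 : 0 < 2 * N * (1 + L) by rewrite mulr_gt0// ltr_wpDr.
(* The three upper bounds serve, in this order, to separate the cubes, to keep the cone steeper than
   the graph, and to remain inside [U]. *)
have [eta [eta0 eta1 eta2 eta3]] : exists eta, [/\ 0 < eta, 2 * eta <= r * `|w ord0 i|,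
    N * eta * (1 + L) * 2 <= r & eta <= r].
  pose eta := Num.min (r * `|w ord0 i| / 2) (Num.min (r / (2 * N * (1 + L))) r).
  exists eta; split.
  - by rewrite !lt_min r0 !divr_gt0// mulr_gt0.
  - by rewrite mulrC -ler_pdivlMr// ge_min lexx.
  - have -> : N * eta * (1 + L) * 2 = eta * (2 * N * (1 + L)) by ring.
    by rewrite -ler_pdivlMr// !ge_min lexx !orbT.
  - by rewrite !ge_min lexx !orbT.
exists r, (r *: w), eta, i; split => //; first by rewrite mxE normrM (gtr0_norm r0).
(* The signed height over the graph: within [U] it vanishes exactly on the boundary. *)
pose hgt (y : V) := (y *m Q) ord0 ord_max -
  g (\row_(i < n) (y *m Q) ord0 (widen_ord (leqnSn n) i)).
move=> x Ox px.
have pxc := (ball_coord _ _ r0).1 px.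
have inU (y : V) : (forall i, `|p ord0 i - y ord0 i| < e) -> U y.
  by move=> H; apply: eU; apply/(ball_coord _ _ e0).
have nbd (y : V) : (forall i, `|p ord0 i - y ord0 i| < e) -> hgt y != 0 -> ~ bdry O y.
  move=> /inU Uy hy /(HU y Uy) /= E; move: hy.
  by rewrite /hgt E subrr eqxx.
have hx : hgt x != 0.
  apply/eqP => hx0; have xU : U x.
    by apply: inU => k; apply: (lt_trans (pxc k)); lra.
  have : bdry O x by apply/(HU x xU) => /=; apply/eqP; rewrite -subr_eq0; apply/eqP.
  by rewrite bdryE// => -[].
(* [lipschitz_set] does not prescribe on which side of the graph [O] lies, so the cone opens upwards
   or downwards according to the sign [sg] of the height of the apex. *)
have cone (sg : R) (t : R) (y : V) : `|sg| = 1 -> 0 < t -> t <= 1 ->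
    0 < sg * hgt x -> ball (x + t *: (sg *: (r *: w))) (t * eta) y -> O y.
  move=> sg1 t0 t1 sgx xy.
  have te0 : 0 < t * eta by rewrite mulr_gt0.
  have [h yE] : exists h, y = x + h by exists (y - x); rewrite addrC subrK.
  have [err hE] : exists err, h = t *: (sg *: (r *: w)) + err.
    by exists (h - t *: (sg *: (r *: w))); rewrite addrC subrK.
  have errc k : `|err ord0 k| <= t * eta.
    have := (ball_coord _ _ te0).1 xy k; rewrite yE hE !mxE => /ltW.
    by rewrite -normrN; congr (`|_| <= _); ring.
  have hc k : `|h ord0 k| <= t * r + t * eta.
    rewrite hE mxE; apply: (le_trans (ler_normD _ _)); apply: lerD => //.
    rewrite !mxE !normrM sg1 mul1r (gtr0_norm t0) (gtr0_norm r0) ler_pM2l// ler_piMr ?(ltW r0)//.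
    by rewrite -w1 coord_le_eucl.
  have errE : eucl (err *m Q) <= N * (t * eta).
    by rewrite (eucl_rotation _ QQ); apply: eucl_le_sup => //; exact: ltW.
  have hQ k : (h *m Q) ord0 k = (err *m Q) ord0 k + t * (sg * (r * (ord_max == k)%:R)).
    rewrite hE addrC.
    by rewrite mulmxDl -!scalemxAl wQ !mxE eqxx /= [k == _]eq_sym.
  rewrite yE; apply: segment_in => // th /andP[th0 th1].
  have thr : th * (t * r + t * eta) <= 2 * r.
    have t1r : t * r <= r by rewrite ler_piMl// ltW.
    have t1e : t * eta <= r by apply: le_trans eta3; rewrite ler_piMl// ltW.
    apply: (@le_trans _ _ (1 * (t * r + t * eta))); last lra.
    by rewrite ler_wpM2r// addr_ge0// mulr_ge0// ltW.
  apply: nbd.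
    move=> k; rewrite !mxE.
    have -> : p ord0 k - (x ord0 k + th * h ord0 k) = (p ord0 k - x ord0 k) - th * h ord0 k by ring.
    apply: (le_lt_trans (ler_normB _ _)); rewrite normrM (ger0_norm th0).
    have := pxc k; have : th * `|h ord0 k| <= 2 * r.
      by apply: le_trans thr; rewrite ler_wpM2l.
    lra.
  suff : 0 < sg * hgt (x + th *: h) by move=> pos; apply/eqP => E; rewrite E mulr0 ltxx in pos.
  pose y' := \row_(k < n) (x *m Q) ord0 (widen_ord (leqnSn n) k).
  pose h' := \row_(k < n) (h *m Q) ord0 (widen_ord (leqnSn n) k).
  have xhE : hgt (x + th *: h) = hgt x + th * (h *m Q) ord0 ord_max - (g (y' + th *: h') - g y').
    rewrite /hgt mulmxDl -scalemxAl.
    have -> : \row_(k < n) (x *m Q + th *: (h *m Q)) ord0 (widen_ord (leqnSn n) k) = y' + th *: h'.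
      by apply/rowP => k; rewrite !mxE.
    rewrite -/y' [(x *m Q + _) _ _]mxE [(th *: (h *m Q)) _ _]mxE; ring.
  have h'E : eucl h' <= N * (t * eta).
    apply: le_trans errE.
    have -> : h' = \row_(k < n) (err *m Q) ord0 (widen_ord (leqnSn n) k).
      apply/rowP => k; rewrite mxE [RHS]mxE hQ.
      by rewrite (_ : (ord_max == _) = false) ?mulr0 ?addr0//; apply/negbTE; rewrite -val_eqE /= gtn_eqF.
    exact: eucl_widen.
  have gd : `|g (y' + th *: h') - g y'| <= th * (L * (N * (t * eta))).
    apply: (le_trans (gL _ _)).
    have -> : y' + th *: h' - y' = th *: h' by rewrite addrC addrA addNr add0r.
    have -> : eucl (th *: h') = th * eucl h'.
      rewrite /eucl; under eq_bigr do rewrite mxE exprMn.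
      by rewrite -mulr_sumr sqrtrM ?sqr_ge0// sqrtr_sqr ger0_norm.
    by rewrite mulrCA ler_wpM2l// ler_wpM2l.
  have hN : sg * (h *m Q) ord0 ord_max >= t * r - N * (t * eta).
    rewrite hQ eqxx mulr1 mulrDr.
    have -> : sg * (t * (sg * r)) = t * r.
      have -> : sg * (t * (sg * r)) = sg ^+ 2 * (t * r) by ring.
      by rewrite -(real_normK (num_real sg)) sg1 expr1n mul1r.
    have : `|sg * (err *m Q) ord0 ord_max| <= N * (t * eta).
      by rewrite normrM sg1 mul1r; apply: le_trans errE; exact: coord_le_eucl.
    by rewrite ler_norml => /andP[]; lra.
  have gd' : - (th * (L * (N * (t * eta)))) <= - (sg * (g (y' + th *: h') - g y')).
    rewrite lerN2; apply: (le_trans (ler_norm _)).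
    by rewrite normrM sg1 mul1r.
  (* The vertical gain along the segment outweighs both the width of the cube and the variation of
     [g]. *)
  have slope : 0 <= t * r - N * (t * eta) - L * (N * (t * eta)).
    have -> : t * r - N * (t * eta) - L * (N * (t * eta)) = t * (r - N * eta * (1 + L)) by ring.
    rewrite mulr_ge0 ?(ltW t0)// subr_ge0; apply: le_trans eta2.
    by rewrite ler_peMr ?ler1n// !mulr_ge0 ?addr_ge0// ltW.
  have thN : th * (t * r - N * (t * eta)) <= sg * (th * (h *m Q) ord0 ord_max).
    by rewrite [leRHS]mulrCA ler_wpM2l.
  have ths : 0 <= th * (t * r - N * (t * eta) - L * (N * (t * eta))) by rewrite mulr_ge0.
  rewrite xhE; move: (hgt x) sgx => q sgx; rewrite mulrBr mulrDr; lra.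
have [hx0|hx0] := ltP 0 (hgt x).
  left => t t0 t1 y xy; apply: (cone 1 t y) => //; rewrite ?normr1 ?mul1r//.
  by rewrite scale1r.
right => t t0 t1 y xy; apply: (cone (-1) t y) => //; rewrite ?normrN ?normr1//.
  by rewrite mulN1r oppr_gt0 lt_neqAle hx.
by rewrite scaleN1r.
Qed.

Lemma compact_box (M : R) : compact [set v : V | forall i, `|v ord0 i| <= M].
Proof.
have := @rV_compact R^o n.+1 (fun=> `[- M, M]%classic) (fun=> @segment_compact R (- M) M).
congr compact; apply/seteqP; split => v /= H i; have := H i; by rewrite in_itv /= -ler_norml.
Qed.

End lipschitz_geometry.

(** * Bounded Lipschitz sets are admissible *)

Section admissible_lipschitz.
Variable R : realType.
Variable n : nat.

Local Notation X := (projT2 (RN R n)).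
Local Notation V := 'rV[R]_n.+1.
Local Notation to_vec := (@to_vec R n).
Local Notation leb := (lebN R n).
Local Notation N := (n.+1%:R : R).

(* The cubes of centre x + 4^-j v and radius 4^-j eta are disjoint and each of them
   contributes the same positive amount to the integral. *)
Lemma tker_cubes (v : V) (eta : R) (i : 'I_n.+1) (A : R) : 0 < eta ->
  2 * eta <= `|v ord0 i| -> exists2 d0 : R, 0 < d0 &
  forall (delta : R) (O : set V) (x : X), 0 < delta -> delta <= d0 ->
    measurable (to_vec @^-1` O) -> (leb (to_vec @^-1` O) < +oo)%E ->
    has_cubes O (to_vec x) v eta ->
    A <= \int[leb]_(y in to_vec @^-1` O) tker n (@rn_dist R n) delta x y.
Proof.
move=> eta0 veta.
have N0 : 0 < N by [].
(* [L * t j] bounds the distance from [x] to the points of the [j]-th cube; [N] compares the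
   Euclidean norm with the sup norm. *)
pose L := eucl v + N * eta.
have L0 : 0 < L by rewrite ltr_wpDl ?eucl_ge0// mulr_gt0.
pose c := (2 * eta / L) ^+ n.+1.
have c0 : 0 < c by rewrite exprn_gt0// divr_gt0// mulr_gt0.
have [J AJ] : exists J : nat, A <= J%:R * c.
  exists (Num.bound `|A / c|); rewrite -ler_pdivrMr//.
  by apply: (le_trans (ler_norm _)); exact: ltW (archi_boundP (normr_ge0 _)).
pose t j : R := (4^-1) ^+ j.
have t0 j : 0 < t j by rewrite exprn_gt0.
have t1 j : t j <= 1 by rewrite exprn_ile1//; lra.
have tle j k : (j <= k)%N -> t k <= t j.
  by move=> jk; apply: ler_wiXn2l => //; lra.
(* For [delta] up to this value the truncation does not spoil the lower bound of the kernel on the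
   first [J] cubes. *)
exists (L * t J); first by rewrite mulr_gt0.
move=> delta O x d0 dJ; set D := _ @^-1` O => mD Doo cubes.
pose Bj j := to_vec @^-1` ball (to_vec x + t j *: v) (t j * eta).
have te0 j : 0 < t j * eta by rewrite mulr_gt0.
have mB j : measurable (Bj j) by apply: measurable_ball_to_vec.
have BD j : Bj j `<=` D by move=> y; exact: cubes.
(* The [i]-th coordinate of [x - y] exceeds [t j |v i| / 2] in absolute value on cube [j], and is
   below [3 t k |v i| / 2] on cube [k]; the ratio 4 of the scales rules out both at once. *)
have tr j k y : (j < k)%N -> Bj j y -> Bj k y -> False.
  move=> jk /(ball_coord _ _ (te0 j))/(_ i) h1 /(ball_coord _ _ (te0 k))/(_ i) h2.
  move: h1 h2; rewrite 4!mxE => h1; rewrite !mxE => h2.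
  have t4 : 4 * t k <= t j.
    apply: (@le_trans _ _ (4 * t j.+1)); first by rewrite ler_pM2l// tle.
    by rewrite /t exprS mulrA mulfV ?pnatr_eq0// mul1r.
  have vi0 : 0 < `|v ord0 i| by apply: lt_le_trans veta; rewrite mulr_gt0.
  set q := Defs.coord x i - Defs.coord y i.
  have q1 : t j * `|v ord0 i| - t j * eta < `|q|.
    have h : `|t j * v ord0 i| <= `|q| + `|Defs.coord x i + t j * v ord0 i - Defs.coord y i|.
      have E : t j * v ord0 i = (Defs.coord x i + t j * v ord0 i - Defs.coord y i) - q by rewrite /q; ring.
      rewrite [in leLHS]E.
      by rewrite [leRHS]addrC; exact: ler_normB.
    rewrite normrM (gtr0_norm (t0 j)) in h; lra.
  have q2 : `|q| < t k * `|v ord0 i| + t k * eta.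
    have -> : q = (Defs.coord x i + t k * v ord0 i - Defs.coord y i) - t k * v ord0 i by rewrite /q; ring.
    apply: (le_lt_trans (ler_normB _ _)); rewrite normrM (gtr0_norm (t0 k)); lra.
  have := t0 k; have := t0 j; move: (t j) (t k) t4 q1 q2 => a b t4 q1 q2 a0 b0.
  have e1 : 2 * (a * eta) <= a * `|v ord0 i| by rewrite mulrCA ler_pM2l.
  have e2 : 2 * (b * eta) <= b * `|v ord0 i| by rewrite mulrCA ler_pM2l.
  have e3 : 4 * (b * `|v ord0 i|) <= a * `|v ord0 i| by rewrite mulrA ler_pM2r.
  have e4 : 0 < a * `|v ord0 i| by rewrite mulr_gt0.
  lra.
pose K := tker n (@rn_dist R n) delta x.
have K0 y : 0 <= K y by exact: tker_ge0.
have mK : measurable_fun setT K.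
  apply: measurable_fun_inv_ge0; first by move=> y _; rewrite exprn_ge0// le_max rn_dist_ge0.
  apply: measurable_funX; apply: measurable_maxr; last exact: measurable_cst.
  exact: (measurableT_comp (@measurable_rn_dist R n) (pair1_measurable x)).
pose f j y := (L * t j) ^- n.+1 * \1_(Bj j) y.
have Lt0 j : 0 < L * t j by rewrite mulr_gt0.
have f0 j y : 0 <= f j y.
  by rewrite mulr_ge0// invr_ge0 exprn_ge0// ltW.
have fK (j : 'I_J) y : Bj j y -> f j y <= K y.
  move=> Bjy; rewrite /f indicE mem_set// mulr1 /K /tker lef_pV2 ?posrE ?exprn_gt0//; last first.
    by rewrite lt_max d0 orbT.
  apply: lerXn2r; rewrite ?nnegrE ?le_max ?rn_dist_ge0 ?(ltW (Lt0 j))//.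
  rewrite ge_max; apply/andP; split; last first.
    by apply: (le_trans dJ); rewrite ler_pM2l// tle// ltnW.
  have -> : rn_dist x y = eucl ((to_vec x + t j *: v - to_vec y) - t j *: v).
    by rewrite /rn_dist; congr eucl; rewrite addrAC addrK.
  apply: (le_trans (euclD _ _)); rewrite euclN.
  have -> : eucl (t j *: v) = t j * eucl v.
    rewrite /eucl; under eq_bigr do rewrite mxE exprMn.
    by rewrite -mulr_sumr sqrtrM ?sqr_ge0// sqrtr_sqr gtr0_norm.
  rewrite /L addrC mulrDl [eucl v * _]mulrC lerD2l.
  apply: (le_trans (eucl_ball Bjy)).
  by rewrite le_eqVlt; apply/orP; left; apply/eqP; ring.
have sumK y : \sum_(j < J) f j y <= K y.
  have [[j Bjy]|nB] := pselect (exists j : 'I_J, Bj j y); last first.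
    rewrite big1// => j _; rewrite /f indicE memNset ?mulr0// => Bjy.
    by apply: nB; exists j.
  rewrite (bigD1 j)//= big1 ?addr0; first exact: fK.
  move=> k kj; rewrite /f indicE memNset ?mulr0// => Bky.
  have : (k != j :> nat) by [].
  by rewrite neq_ltn => /orP[] h; [exact: (tr _ _ _ h Bky Bjy)|exact: (tr _ _ _ h Bjy Bky)].
have mf j : measurable_fun setT (f j).
  by apply: measurable_funM; [exact: measurable_cst|exact: measurable_indic].
have If j : (\int[leb]_(y in D) (f j y)%:E = c%:E)%E.
  rewrite /f; under eq_integral do rewrite EFinM.
  rewrite ge0_integralZl_EFin//.
  - rewrite integral_indic// (setIidl (BD j)).
    transitivity (((L * t j) ^- n.+1)%:E * ((2 * (t j * eta)) ^+ n.+1)%:E)%E.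
      by congr (_ * _)%E; exact: lebN_ball.
    rewrite -EFinM /c; congr EFin.
    rewrite -exprVn -exprMn; congr (_ ^+ _); have := t0 j; move: (t j) => q q0.
    by field; rewrite !gt_eqF.
  - by apply/measurable_EFinP; apply: measurable_funTS; exact: measurable_indic.
  - by rewrite invr_ge0 exprn_ge0// ltW.
have IK : (A%:E <= \int[leb]_(y in D) (K y)%:E)%E.
  apply: (@le_trans _ _ (\int[leb]_(y in D) (\sum_(j < J) (f j y)%:E))%E); last first.
    apply: ge0_le_integral => //.
    - by move=> y _; apply: sume_ge0 => j _; rewrite lee_fin.
    - apply: measurable_funTS; apply: emeasurable_sum => j; exact/measurable_EFinP.
    - by apply: measurable_funTS; exact/measurable_EFinP.
    - by move=> y _; rewrite sumEFin lee_fin.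
  rewrite ge0_integral_sum//; last 2 first.
  - by move=> j; apply: measurable_funTS; exact/measurable_EFinP.
  - by move=> j y _; rewrite lee_fin.
  under eq_bigr do rewrite If.
  by rewrite sumEFin lee_fin sumr_const card_ord -[leRHS]mulr_natl.
have IKoo : (\int[leb]_(y in D) (K y)%:E < +oo)%E.
  apply: (@le_lt_trans _ _ (\int[leb]_(y in D) (delta ^- n.+1)%:E)%E).
    apply: ge0_le_integral => //.
    - by move=> y _; rewrite lee_fin.
    - by apply: measurable_funTS; exact/measurable_EFinP.
    - by move=> y _; rewrite lee_fin tker_le.
  by rewrite integral_cst// lte_mul_pinfty// lee_fin invr_ge0 exprn_ge0// ltW.
rewrite -lee_fin /Rintegral fineK// ge0_fin_numE//.
by apply: integral_ge0 => y _; rewrite lee_fin.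
Qed.

End admissible_lipschitz.

Section lipschitz_admissible.
Variable R : realType.
Variable n : nat.

Local Notation X := (projT2 (RN R n)).
Local Notation V := 'rV[R]_n.+1.
Local Notation to_vec := (@to_vec R n).
Local Notation leb := (lebN R n).

Variable O : set V.
Hypothesis oO : open O.
Variable M : R.
Hypothesis OM : forall x, O x -> eucl x <= M.

Lemma bounded_subset_box : O `<=` [set v : V | forall i, `|v ord0 i| <= M].
Proof. by move=> v Ov i; apply: le_trans (OM Ov); exact: coord_le_eucl. Qed.

Lemma compact_closure_bounded : compact (closure O).
Proof.
apply: (subclosed_compact (@closed_closure _ O) (@compact_box R n M)).
have cB : closed [set v : V | forall i, `|v ord0 i| <= M].
  exact: compact_closed (@compact_box R n M).
by move/closure_id : cB => ->; apply: closureS; exact: bounded_subset_box.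
Qed.

Lemma measurable_bounded : (leb (to_vec @^-1` O) < +oo)%E.
Proof.
have M0 : 0 < `|M| + 1 by rewrite ltr_pwDr.
apply: (@le_lt_trans _ _ (leb (to_vec @^-1` ball (0 : V) (`|M| + 1)))).
  apply: le_measure; rewrite ?inE; first exact: measurable_open_to_vec.
    exact: measurable_ball_to_vec.
  move=> x /= /bounded_subset_box /= H; apply/(ball_coord _ _ M0) => i.
  rewrite mxE sub0r normrN (le_lt_trans (H i))// (le_lt_trans (ler_norm M))//.
  by rewrite ltrDl.
apply: (@le_lt_trans _ _ ((2 * (`|M| + 1)) ^+ n.+1)%:E); last exact: ltry.
by rewrite le_eqVlt; apply/orP; left; apply/eqP; exact: lebN_ball.
Qed.

Lemma open_to_vec_gt0 (A : set V) : open A -> A !=set0 -> (0 < leb (to_vec @^-1` A))%E.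
Proof.
move=> oA [p Ap]; have /nbhs_ballP[e /= e0 eA] : nbhs p A by exact: open_nbhs_nbhs.
apply: (@lt_le_trans _ _ (leb (to_vec @^-1` ball p e))).
  apply: (@lt_le_trans _ _ ((2 * e) ^+ n.+1)%:E); first by rewrite lte_fin exprn_gt0// mulr_gt0.
  by rewrite le_eqVlt; apply/orP; left; apply/eqP/esym; exact: lebN_ball.
apply: le_measure; rewrite ?inE; first exact: measurable_ball_to_vec.
  exact: measurable_open_to_vec.
by move=> x /= /eA.
Qed.

Lemma net_bounded (eta : R) : 0 < eta ->
  exists s : seq X, forall x, (to_vec @^-1` O) x -> exists2 y, y \in s & rn_dist x y < eta.
Proof.
move=> eta0; have N0 : 0 < n.+1%:R :> R by [].
pose h := eta / (2 * n.+1%:R).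
have h0 : 0 < h by rewrite divr_gt0// mulr_gt0.
have := compact_closure_bounded; rewrite compact_cover.
move=> /(_ V (closure O) (fun p => (ball p h)^°)) [||F _ cF].
- by move=> p _; exact: open_interior.
- move=> p Op; exists p => //; exact: nbhsx_ballx.
exists [seq of_vec p | p <- finmap.enum_fset F] => x Ox.
have [p Fp px] := cF _ (subset_closure Ox).
exists (of_vec p); first by apply: map_f.
have := eucl_ball (interior_subset px).
rewrite /rn_dist of_vecK -euclN opprB => le.
apply: (le_lt_trans le).
have -> : n.+1%:R * h = eta / 2.
  by rewrite /h; move: (n.+1%:R : R) N0 => q q0; field; rewrite gt_eqF.
lra.
Qed.

(** Near a point of the closure one cone or its opposite serves all points of [O], which gives a
    local threshold for [delta]; compactness of the closure makes it uniform. The predicate [good]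
    is vacuous off [O], so the covering can run over the closure. *)
Lemma tker_unbounded_lipschitz (A : R) : lipschitz_set O -> exists2 d0 : R, 0 < d0 &
  forall delta : R, 0 < delta -> delta <= d0 -> forall x, (to_vec @^-1` O) x ->
    A <= \int[leb]_(y in to_vec @^-1` O) tker n (@rn_dist R n) delta x y.
Proof.
move=> lO.
have mO := measurable_open_to_vec oO; have Ooo := measurable_bounded.
pose good (delta : R) (v : V) := O v ->
  A <= \int[leb]_(y in to_vec @^-1` O) tker n (@rn_dist R n) delta (of_vec v) y.
have [d0 d00 Hd] : exists2 d0 : R, 0 < d0 & forall delta, 0 < delta -> delta <= d0 ->
    forall v, closure O v -> good delta v.
  have : \forall delta \near 0^'+, closure O `<=` good delta.
    have := compact_closure_bounded => /compact_near_coveringP; apply.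
    move=> p cp.
    have [r [v [eta [i [r0 eta0 veta H]]]]] : exists (r : R) (v : V) (eta : R) (i : 'I_n.+1),
        [/\ 0 < r, 0 < eta, 2 * eta <= `|v ord0 i| &
        forall x, O x -> ball p r x -> has_cubes O x v eta \/ has_cubes O x (- v) eta].
      have [Op|nOp] := pselect (O p).
        have [r [v [eta [i [r0 eta0 veta H]]]]] := cubes_interior oO Op.
        by exists r, v, eta, i; split => // x Ox px; left; exact: H.
      by apply: cubes_boundary => //; rewrite bdryE.
    have [d1 d10 H1] := tker_cubes A eta0 veta.
    have vetaN : 2 * eta <= `|(- v) ord0 i| by rewrite mxE normrN.
    have [d2 d20 H2] := tker_cubes A eta0 vetaN.
    have d12 : 0 < Num.min d1 d2 by rewrite lt_min d10.
    exists (ball p r, [set delta | 0 < delta /\ delta <= Num.min d1 d2]).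
      split => /=; first exact: nbhsx_ballx.
      by near=> d; split; near: d; [exact: nbhs_right_gt|exact: nbhs_right_le].
    move=> [x delta] [/= px [d0]]; rewrite le_min => /andP[dd1 dd2] Ox.
    case: (H x Ox px) => cubes; [apply: (H1 _ _ (of_vec x)) => //|apply: (H2 _ _ (of_vec x)) => //].
      by rewrite of_vecK.
    by rewrite of_vecK.
  rewrite near_withinE => /nbhs_ballP[e /= e0 He].
  exists (e / 2); first by rewrite divr_gt0.
  move=> delta dl0 dle v Ov; apply: He => //=.
  rewrite /ball /= sub0r normrN gtr0_norm//; lra.
exists d0 => // delta dl0 dd0 x Ox.
by have := Hd delta dl0 dd0 (to_vec x) (subset_closure Ox) Ox; rewrite to_vecK.
Unshelve. all: by end_near. Qed.

(** The diameter is at most [2 * M]. The nonconstant Lipschitz function is the first coordinate: the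
    part of [O] where it differs from a given [c] is open and nonempty, hence of positive
    measure. *)
Lemma lipschitz_admissible : O !=set0 -> lipschitz_set O ->
  admissible leb n (to_vec @^-1` O) (@rn_dist R n) (Num.max 1 (2 * M)).
Proof.
move=> O0 lO; split.
- exact: measurable_open_to_vec.
- exact: open_to_vec_gt0.
- exact: measurable_bounded.
- exact: rn_dist_ge0.
- exact: rn_distC.
- exact: rn_dist_tri.
- exact: rn_dist_eq0.
- exact: measurable_rn_dist.
- by rewrite le_max lexx.
- move=> x y Ox Oy; rewrite le_max; apply/orP; right.
  apply: (le_trans (euclD _ _)); rewrite euclN mulr_natl mulr2n.
  by apply: lerD; exact: OM.
- by move=> A; exact: tker_unbounded_lipschitz.
- exists (4 ^+ n.+1) => t x t0 _; apply: rn_dist_pow_int => //.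
  exact: measurable_open_to_vec.
- exact: net_bounded.
- exists (fun x => Defs.coord x 0%N); split.
  + by apply: measurable_funTS; exact: measurable_coord.
  + move=> x y _ _; have := coord_le_eucl (to_vec x - to_vec y) ord0.
    by rewrite !mxE.
  + move=> c nc.
    pose B := O `&` [set v : V | v ord0 ord0 != c].
    have oB : open B.
      apply: openI => //.
      rewrite (_ : [set v : V | _] = (fun v : V => v ord0 ord0) @^-1` [set r | r != c]); last by [].
      apply: open_comp; last exact: open_neq.
      by move=> v _; exact: coord_continuous.
    have B0 : B !=set0.
      move: O0 => [p Op]; have [pc|pc] := eqVneq (p ord0 ord0) c; last by exists p.
      have /nbhs_ballP[e /= e0 eO] : nbhs p O by exact: open_nbhs_nbhs.
      exists (p + const_mx (e / 2)); split => /=.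
        apply: eO; apply/(ball_coord _ _ e0) => i; rewrite !mxE opprD addrA subrr sub0r normrN.
        rewrite ger0_norm; lra.
      by rewrite !mxE pc -subr_eq0 addrAC subrr add0r gt_eqF// divr_gt0.
    have := open_to_vec_gt0 oB B0.
    rewrite (_ : leb (to_vec @^-1` B) = 0%E) ?ltxx//.
    apply: measure_negligible; first exact: measurable_open_to_vec.
    apply: negligibleS nc => x [Ox /= xc]; split => //=.
    by move: xc; rewrite mxE.
Qed.

End lipschitz_admissible.

(** * Back to functions of row vectors *)

Section transfer.
Variables (R : realType) (n : nat) (O : set 'rV[R]_n.+1).

Local Notation dom := (@to_vec R n @^-1` O).
Local Notation pull u := (u \o @to_vec R n).

(** Both sides unfold to the same integrals; only the quantification over test functions calls for
    the inverse [of_vec]. *)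
Lemma eigenfunction_pull s l u : eigenfunction s O l u <->
  is_eigen (lebN R n) n dom (@rn_dist R n) s l (pull u).
Proof.
split=> -[hu nz Hu]; split.
- exact: hu.
- exact: nz.
- move=> v hv; pose w := v \o @of_vec R n.
  have wE : v = pull w by apply/funext => x; rewrite /w /= to_vecK.
  clearbody w; rewrite {v}wE in hv *; exact: (Hu w hv).
- exact: hu.
- exact: nz.
- by move=> v hv; exact: (Hu (pull v) hv).
Qed.

Lemma lambda1_first_eigen s :
  lambda1 O s = first_eigen (lebN R n) n dom (@rn_dist R n) s.
Proof.
congr inf; apply/seteqP; split => l [l0 [u Hu]]; split => //.
  by exists (pull u); apply/eigenfunction_pull.
exists (u \o @of_vec R n); apply/eigenfunction_pull.
suff -> : pull (u \o @of_vec R n) = u by [].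
by apply/funext => x /=; rewrite to_vecK.
Qed.

End transfer.

(** Over the empty set every function is negligible, so there are no eigenvalues and the infimum
    takes its default value, the same for every [s]. *)
Lemma lambda1_set0 (R : realType) n s : lambda1 (set0 : set 'rV[R]_n.+1) s = inf set0.
Proof.
congr inf; apply/seteqP; split => // l [_ [u [_ nz _]]]; apply: nz.
by rewrite set0I; exact: negligible_set0.
Qed.

(* Dimension N = n.+1; Omega ⊂ R^N represented as a set of row vectors. *)
Theorem theorem5p3 (R : realType) (n : nat) (O : set 'rV[R]_(n.+1)) :
  open O -> boundedN O -> lipschitz_set O ->
  (lambda1 O s @[s --> 0^'+] --> lambda1 O 0) /\
  (forall (sk : nat -> R) (xi : nat -> 'rV[R]_(n.+1) -> R),
     (forall k, 0 < sk k) -> sk @ \oo --> 0 ->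
     (forall k, eigenfunction (sk k) O (lambda1 O (sk k)) (xi k)) ->
     (forall k, intN O (fun x => ((xi k x) ^+ 2)%:E) = 1%E) ->
     exists (phi : nat -> nat) (xi1 : 'rV[R]_(n.+1) -> R),
       [/\ (forall i j, (i < j)%N -> (phi i < phi j)%N),
           eigenfunction 0 O (lambda1 O 0) xi1 &
           (fun k => intN O (fun x => ((xi (phi k) x - xi1 x) ^+ 2)%:E))
             @ \oo --> 0%E]).
Proof.
move=> oO [M OM] lO.
(* The empty set satisfies the hypotheses: there [lambda1] is constant in [s], and no function has
   norm 1. *)
have [->|/set0P O0] := eqVneq O set0.
  split.
    under eq_fun do rewrite lambda1_set0.
    by rewrite lambda1_set0; exact: cvg_cst.
  move=> sk xi _ _ _ /(_ 0%N); rewrite /intN preimage_set0 integral_set0 => /esym/eqP.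
  by rewrite onee_eq0.
have adm := lipschitz_admissible oO OM O0 lO.
split.
  under eq_fun do rewrite lambda1_first_eigen.
  by rewrite lambda1_first_eigen; exact: (first_eigen_cvg adm).
move=> sk xi sk0 skc Hxi xi1.
have [||phi [v [phiS Hv cv]]] :=
    @eigenfunctions_converge _ _ _ _ _ _ _ _ adm sk (fun k => xi k \o @to_vec R n) sk0 skc.
- by move=> k; rewrite -lambda1_first_eigen; apply/eigenfunction_pull.
- exact: xi1.
have vE : (v \o @of_vec R n) \o @to_vec R n = v.
  by apply/funext => x /=; rewrite to_vecK.
exists phi, (v \o @of_vec R n); split => //.
  by apply/eigenfunction_pull; rewrite vE lambda1_first_eigen.
rewrite /intN; under eq_fun do under eq_integral do rewrite /= to_vecK.
exact: cv.
Qed.
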